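(* The Weil–Petersson semi-norm $\|\cdot\|_{WP}$ is non-degenerate on $\mathcal{B}_2^{fm}$; that is, for every $[f]\in\mathcal{B}_2^{fm}$ and every non-zero $\vec v\in T_{[f]}\mathcal{B}_2^{fm}$, $\|\vec v\|_{WP}\neq0$.
   Context: Notation: $\Delta=\{z\in\mathbb{P}^1:|z|<1\}$, $1/\Delta=\{z\in\mathbb{P}^1:|z|>1\}$, $S^1=\partial\Delta$. Spaces (for $d\ge2$; here $d=2$). $\mathrm{Rat}_d^{fm}$ is the space of tuples $(f;x_1,\dots,x_{d+1})$ where $f$ is a degree-$d$ rational map and $x_1,\dots,x_{d+1}$ is an ordering of its fixed points (with multiplicity). $\mathrm{PSL}(2,\mathbb{C})$ acts by $\phi\cdot(f;x_i)=(\phi f\phi^{-1};\phi(x_i))$. A hyperbolic rational map is a quasi-Blaschke product if its Julia set is a quasicircle and it fixes each of its two Fatou components. $\widetilde{\mathcal{QB}}{}_d^{fm}$ is the connected component of the set of fixed-point-marked degree-$d$ quasi-Blaschke products containing $(z^d;0,\infty,1,\zeta,\dots,\zeta^{d-2})$, $\zeta=e^{2\pi i/(d-1)}$ (for $d=2$: $(z^2;0,\infty,1)$); $\mathcal{QB}_d^{fm}=\widetilde{\mathcal{QB}}{}_d^{fm}/\mathrm{PSL}(2,\mathbb{C})$, a complex manifold. $\mathcal{B}_d^{fm}\subset\mathcal{QB}_d^{fm}$ is the real-analytic submanifold of classes represented by Blaschke products $e^{2\pi i\theta}\prod_{i=1}^d\frac{z-a_i}{1-\overline{a_i}z}$, $a_i\in\Delta$.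 The standard representative of a class is the one with $x_1=0,x_2=\infty,x_3=1$ (for classes in $\mathcal{B}_d^{fm}$ it is a Blaschke product); $x_3,\dots,x_{d+1}$ lie on the Julia set in counterclockwise order. Mating. For $[f_1],[f_2]\in\mathcal{B}_d^{fm}$ with standard representatives $f_1,f_2$, $\mathrm{Mate}([f_1],[f_2])\in\mathcal{QB}_d^{fm}$ is the class whose standard representative $F$ satisfies: if $U\ni0$, $V\ni\infty$ are its Fatou components, there are biholomorphisms $A:\Delta\to U$, $B:1/\Delta\to V$ with $A\circ f_1=F\circ A$, $B\circ f_2=F\circ B$, whose continuous extensions to $S^1$ both send $1$ to $1$. Weil–Petersson semi-norm. Let $([f_t])_{t\in(-1,1)}$ be a smooth path in $\mathcal{B}_d^{fm}$ with $\vec v=\frac{d}{dt}|_{t=0}[f_t]$ and $f_t$ standard, and let $F_t$ be the standard representative of $\mathrm{Mate}([f_0],[f_t])$, so $F_0=f_0$. There is a unique smooth family of conformal maps $H_t:\Delta\to\mathbb{P}^1$ (injective) with $H_t\circ F_0=F_t\circ H_t$ and $H_0(z)=z$. Put $\eta_{\vec v}(z)=\frac{d}{dt}|_{t=0}H_t(z)$, a holomorphic vector field on $\Delta$, and $$\|\vec v\|_{WP}^2:=\lim_{r\to1}\frac{1}{4\pi|\log(1-r)|}\int_{|z|=r}|\eta_{\vec v}'(z)|^2|dz|.$$ *)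

(* Defs.v *)
From HB Require Import structures.
From mathcomp Require Import all_boot all_order all_algebra.
From mathcomp Require Import all_classical all_reals all_analysis.
From mathcomp Require Import complex.

Set Implicit Arguments.
Unset Strict Implicit.
Unset Printing Implicit Defensive.

Import Order.TTheory GRing.Theory Num.Theory.
Import numFieldNormedType.Exports.

Local Open Scope classical_set_scope.
Local Open Scope ring_scope.

(* Typing the complex numbers as a [numClosedFieldType] gives them the norm
   and the topology that the library attaches to every numeric field. *)
Definition C (R : realType) : numClosedFieldType := R[i].

Definition P1 (R : realType) := one_point_compactification (C R).

(* A map of the sphere with d + 1 marked points. On rational maps of a fixed
   degree, the compact-open topology is that of the coefficients up to scaling. *)
Definition marked (R : realType) (d : nat) :=
  ({compact-open, P1 R -> P1 R} * {ptws 'I_d.+1 -> P1 R})%type.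

Section Sphere.
Variable R : realType.
Local Notation C := (C R).
Local Notation P1 := (P1 R).

Definition modulus (z : C) : R := complex.Re (`|z| : C).

Definition expi (t : R) : C := Complex (cos t) (sin t).

Definition fin (z : C) : P1 := Some z.

Definition infty : P1 := None.

(* The value at infinity is irrelevant. *)
Definition affine (x : P1) : C := if x is Some z then z else 0.

Definition inv (x : P1) : P1 :=
  if x is Some z then (if z == 0 then infty else fin z^-1) else fin 0.

Definition disk : set P1 := [set x | if x is Some z then `|z| < 1 else False].

Definition closed_disk : set P1 :=
  [set x | if x is Some z then `|z| <= 1 else False].

Definition outer_disk : set P1 :=
  [set x | if x is Some z then 1 < `|z| else True].

Definition closed_outer_disk : set P1 :=
  [set x | if x is Some z then 1 <= `|z| else True].

Definition circle : set P1 := [set x | if x is Some z then `|z| = 1 else False].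

Definition chordal (x y : P1) : R :=
  match x, y with
  | Some z, Some w => 2 * modulus (z - w)
      / (Num.sqrt (1 + modulus z ^+ 2) * Num.sqrt (1 + modulus w ^+ 2))
  | Some z, None | None, Some z => 2 / Num.sqrt (1 + modulus z ^+ 2)
  | None, None => 0
  end.

(* The affine coordinate or its inverse, whichever is finite at [a]; its domain;
   and its inverse map. *)
Definition chart (a x : P1) : C :=
  if a is Some _ then affine x else affine (inv x).

Definition chart_dom (a : P1) : set P1 :=
  if a is Some _ then [set x | x <> infty] else [set x | x <> fin 0].

Definition unchart (a : P1) (w : C) : P1 :=
  if a is Some _ then fin w else inv (fin w).

Definition holomorphic_at (f : P1 -> P1) (x : P1) : Prop :=
  {for x, continuous f} /\
  derivable (fun w : C => chart (f x) (f (unchart x w))) (chart x x) 1.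

Definition holomorphic_on (D : set P1) (f : P1 -> P1) : Prop :=
  forall x, D x -> holomorphic_at f x.

Definition conformal_on (D : set P1) (f : P1 -> P1) : Prop :=
  holomorphic_on D f /\ set_inj D f.

Definition biholomorphic (D U : set P1) (f : P1 -> P1) : Prop :=
  [/\ holomorphic_on D f, f @` D = U &
      exists g : P1 -> P1, [/\ holomorphic_on U g,
        (forall x, D x -> g (f x) = x) & (forall y, U y -> f (g y) = y)]].

End Sphere.

Arguments infty {R}.
Arguments circle {R}.
Arguments disk {R}.
Arguments outer_disk {R}.
Arguments closed_disk {R}.
Arguments closed_outer_disk {R}.

Section Smoothness.
Variable R : realType.

Fixpoint class_C (E : normedModType R) (n : nat) (U : set E) (g : E -> R)
    : Prop :=
  (forall x, U x -> {for x, continuous g}) /\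
  if n is n'.+1 then
    forall v, (forall x, U x -> derivable g x v) /\ class_C n' U ('D_v g)
  else True.

Definition smooth (E : normedModType R) (U : set E) (g : E -> C R) : Prop :=
  forall n, class_C n U (fun x => complex.Re (g x)) /\
            class_C n U (fun x => complex.Im (g x)).

(* R[i] is not a normed module over R in the library, hence the real and
   imaginary parts. *)
Definition ddt0 (g : R -> C R) : C R :=
  Complex (derive1 (fun t => complex.Re (g t)) 0)
          (derive1 (fun t => complex.Im (g t)) 0).

Definition param : set R := `]-1, 1[.

(* Joint smoothness on (-1, 1) x disk, read in the charts of the target. *)
Definition smooth_family (H : R -> P1 R -> P1 R) : Prop :=
  forall (t : R) (z : C R), param t -> `|z| < 1 ->
  exists W : set (R * R * R)%type,
    [/\ open W, W (t, complex.Re z, complex.Im z),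
        (forall u, W u -> chart_dom (H t (fin z))
           (H u.1.1 (fin (Complex u.1.2 u.2)))) &
        smooth W (fun u => chart (H t (fin z))
           (H u.1.1 (fin (Complex u.1.2 u.2))))].

End Smoothness.

Arguments param {R}.

Section RationalMaps.
Variable R : realType.
Local Notation C := (C R).
Local Notation P1 := (P1 R).

Definition ratmap (p q : {poly C}) (x : P1) : P1 :=
  let value (a b : C) := if b == 0 then infty else fin (a / b) in
  if x is Some z then value p.[z] q.[z]
  else let d := (maxn (size p) (size q)).-1 in value p`_d q`_d.

Definition ratfrac (d : nat) (p q : {poly C}) : Prop :=
  coprimep p q /\ maxn (size p) (size q) = d.+1.

Definition rational_map (d : nat) (f : P1 -> P1) : Prop :=
  exists p q, ratfrac d p q /\ f = ratmap p q.

(* The fixed points of p/q are the d + 1 zeros of the binary form of degree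
   d + 1 whose dehomogenization is p - X q; the multiplicity of infinity is the
   drop in degree. *)
Definition fixed_marked (d : nat) (m : marked R d) : Prop :=
  exists p q (c : C), [/\ ratfrac d p q, m.1 = ratmap p q, c != 0 &
    p - 'X * q =
    c *: \prod_(i < d.+1) (if m.2 i is Some z then 'X - z%:P else 1)].

(* The largest open set on which the iterates are equicontinuous. *)
Definition fatou_set (f : P1 -> P1) : set P1 :=
  [set x | \forall y \near x, forall e : R, 0 < e ->
    \forall w \near y, forall n, chordal (iter n f y) (iter n f w) < e].

Definition julia (f : P1 -> P1) : set P1 := ~` fatou_set f.

Definition fatou_component (f : P1 -> P1) (U : set P1) : Prop :=
  exists2 x, fatou_set f x & U = connected_component (fatou_set f) x.

Definition critical (f : P1 -> P1) : set P1 :=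
  [set x | forall U, nbhs x U -> ~ set_inj U f].

Definition postcritical (f : P1 -> P1) : set P1 :=
  closure (\bigcup_(n in [set n | (0 < n)%N]) (iter n f @` critical f)).

Definition hyperbolic (f : P1 -> P1) : Prop :=
  postcritical f `&` julia f = set0.

(* The metric definition: the linear dilatation is uniformly bounded. *)
Definition quasiconformal (phi : P1 -> P1) : Prop :=
  [/\ continuous phi,
      exists psi : P1 -> P1,
        [/\ continuous psi, cancel phi psi & cancel psi phi] &
      exists K : R, forall x : P1, \forall r \near (0 : R)^'+,
        forall y z, chordal x y = r -> chordal x z = r ->
          chordal (phi x) (phi y) <= K * chordal (phi x) (phi z)].

Definition quasicircle (J : set P1) : Prop :=
  exists phi, quasiconformal phi /\ J = phi @` circle.

Definition quasi_blaschke (d : nat) (f : P1 -> P1) : Prop :=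
  [/\ rational_map d f, hyperbolic f, quasicircle (julia f) &
      forall U, fatou_component f U -> f @` U = U].

Definition marked_quasi_blaschke (d : nat) : set (marked R d) :=
  [set m | fixed_marked m /\ quasi_blaschke d m.1].

Definition power_marked (d : nat) : marked R d :=
  (ratmap 'X^d 1,
   fun i : 'I_d.+1 => match (i : nat) with
     | 0%N => fin 0
     | 1%N => infty
     | k.+2 => fin (expi (2 * pi * k%:R / d.-1%:R))
     end).

Definition QB_tilde (d : nat) : set (marked R d) :=
  connected_component (@marked_quasi_blaschke d) (power_marked d).

Definition moebius_class (d : nat) (m : marked R d) : set (marked R d) :=
  [set m' | exists phi psi : P1 -> P1,
    [/\ rational_map 1 phi, cancel phi psi, cancel psi phi &
        m'.1 = phi \o m.1 \o psi /\ forall i, m'.2 i = phi (m.2 i)]].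

Definition QB (d : nat) : set (set (marked R d)) :=
  @moebius_class d @` @QB_tilde d.

Definition blaschke (d : nat) (f : P1 -> P1) : Prop :=
  exists (theta : R) (a : 'I_d -> C), (forall i, `|a i| < 1) /\
    f = ratmap (expi (2 * pi * theta) *: \prod_(i < d) ('X - (a i)%:P))
               (\prod_(i < d) (1 - (a i)^* *: 'X)).

Definition B (d : nat) : set (set (marked R d)) :=
  [set c | QB c /\ exists2 m, c m & blaschke d m.1].

(* Meant for 2 <= d. *)
Definition standard (d : nat) (c : set (marked R d)) (m : marked R d) : Prop :=
  [/\ c m, m.2 (inord 0) = fin 0, m.2 (inord 1) = infty &
      m.2 (inord 2) = fin 1].

Definition mate (d : nat) (c1 c2 c : set (marked R d)) : Prop :=
  QB c /\ exists f1 f2 F, [/\ standard c1 f1, standard c2 f2, standard c F &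
  exists (U V : set P1) (phi psi : P1 -> P1),
    [/\ (fatou_component F.1 U /\ U (fin 0)) /\
        (fatou_component F.1 V /\ V (infty)),
        biholomorphic disk U phi /\ biholomorphic (outer_disk) V psi,
        (forall z, disk z -> phi (f1.1 z) = F.1 (phi z)) /\
        (forall z, outer_disk z -> psi (f2.1 z) = F.1 (psi z)),
        {within closed_disk, continuous phi} /\
        {within closed_outer_disk, continuous psi} &
        phi (fin 1) = fin 1 /\ psi (fin 1) = fin 1]].

(* The standard representatives form a slice of the PSL(2, C)-action, so that a
   path of classes is smooth iff its standard representatives are a smooth path
   of rational maps, i.e. have smooth homogeneous coefficients. The standard
   representative of a class in [B] is a Blaschke product. *)
Definition smooth_path (d : nat) (c : R -> set (marked R d))
    (f : R -> marked R d) : Prop :=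
  (forall t, param t -> [/\ B (c t), standard (c t) (f t) &
                              blaschke d (f t).1]) /\
  exists p q : R -> {poly C},
    [/\ (forall t, param t -> ratfrac d (p t) (q t) /\
                                (f t).1 = ratmap (p t) (q t)),
        (forall k, smooth param (fun t => (p t)`_k)) &
        (forall k, smooth param (fun t => (q t)`_k))].

(* A tangent vector is recorded by the variation d/dt f_t(z) at t = 0 of the
   standard representatives on the unit disk, where it is finite: tangent
   vectors to spaces of rational maps are determined by this vector field, and
   only the values of [v] on the unit disk are meaningful. *)
Definition represents (d : nat) (c : R -> set (marked R d))
    (f : R -> marked R d) (c0 : set (marked R d)) (v : C -> C) : Prop :=
  [/\ smooth_path c f, c 0 = c0 &
      forall z, `|z| < 1 -> v z = ddt0 (fun t => affine ((f t).1 (fin z)))].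

Definition tangent (d : nat) (c0 : set (marked R d)) (v : C -> C) : Prop :=
  exists c f, represents c f c0 v.

Definition nonzero (v : C -> C) : Prop := exists z, `|z| < 1 /\ v z != 0.

Definition WP_mean (eta : C -> C) (r : R) : R :=
  (4 * pi * `|ln (1 - r)|)^-1 *
  \int[lebesgue_measure]_(s in `[0, 2 * pi])
     (modulus (derive1 eta (Complex r 0 * expi s)) ^+ 2 * r).

(* A relation, [N] being the Weil-Petersson length of [v]: the mating, the family
   of conjugacies and the limit that define it enter through their defining
   properties. *)
Definition WP_seminorm (d : nat) (c0 : set (marked R d)) (v : C -> C) (N : R)
    : Prop :=
  0 <= N /\
  exists (c : R -> set (marked R d)) (f F : R -> marked R d)
         (H : R -> P1 -> P1),
    [/\ represents c f c0 v,
        (forall t, param t -> exists2 cF,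
           mate (c 0) (c t) cF & standard cF (F t)),
        smooth_family H /\
        (forall t, param t -> conformal_on disk (H t)),
        (forall t z, param t -> disk z ->
           H t ((F 0).1 z) = (F t).1 (H t z)) /\
        (forall z, disk z -> H 0 z = z) &
        WP_mean (fun z => ddt0 (fun t => affine (H t (fin z)))) r
          @[r --> (1 : R)^'-] --> N ^+ 2].

End RationalMaps.

(* Main.v *)
(* In standard form a quadratic Blaschke product [f] is determined by its
   multiplier [a] at 0, and the mating of [f_0] with [f_t] is the quadratic map
   fixing 0, infinity and 1 with multipliers [a_0] at 0 and [conj a_t] at
   infinity. Differentiating [H_t o F_0 = F_t o H_t] at [t = 0] gives
   [eta (f z) = X z + f' z * eta z], where [X z = K z^2 (1 - z) / (1 + B z)^2]
   and [K] is a nonzero multiple of [conj a_0'], so that [K != 0].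

   Since [X 1 = 0], this equation determines boundary values of [eta] at the
   iterated preimages of 1, with value 0 at 1. The preimages of order [n] cut
   the circle into arcs; as [f] fixes 0 it preserves the length of arcs, in the
   sense that the two preimages of an arc have the total length of that arc, and
   the slopes of the (rotated) boundary values along the arcs form a martingale. Its
   increments are almost invariant under [f], and those next to 1 do not tend to
   0 because [X' 1 != 0]. By invariance of length the sum of the squared
   increments, that is the mean square of the slopes at generation [n], grows
   linearly in [n]. By the Cauchy-Schwarz inequality the mean square of [eta']
   over [|z| = r] dominates that of the slopes at generation [n] once [1 - r] is
   a small power of the arc lengths, and then [|log (1 - r)|] is comparable to
   [n]. Hence the Weil-Petersson mean does not tend to 0. *)

From mathcomp Require Import all_boot all_order all_algebra.
From mathcomp Require Import all_classical all_reals all_analysis.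
From mathcomp Require Import complex ring lra.
Require Import Defs.

Set Implicit Arguments.
Unset Strict Implicit.
Unset Printing Implicit Defensive.

Import Order.TTheory GRing.Theory Num.Theory.
Import numFieldNormedType.Exports.

Local Open Scope classical_set_scope.
Local Open Scope ring_scope.

(** * Complex numbers as pairs of reals *)

Section Modulus.
Variable R : realType.
Implicit Types z w : C R.

(** The field [eta] lives inside the disk and its boundary values exist only on a countable set, so
    no boundary function is ever integrated. Instead [eta] on [|z| = r] is compared with the
    boundary values at the [2 ^ n] nodes, by running both through the functional equation for [N]
    iterates: this gains a factor [lam ^ N] and spreads the points by [mu ^ N]. With [N = L * n] and
    [1 - r] of order [(lam / mu) ^ (L * n)] the error is of order [lam ^ (L * n)]. Its square must
    beat [2 ^ n] arcs divided by the least arc length, of order [nu ^ n] with [nu = (1 - |B|) / 2];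
    this fixes [L].

    The rotation comes from [z f' / f = |f'|] on the circle: for [eta / z] the functional equation
    has a real positive coefficient, the derivative of a lift of [f] to the line.

    A conjugacy preserves multipliers, hence the mating is known once its multipliers at 0 and
    infinity are. Only the one at infinity moves with [t], and [X] is the derivative of the
    quadratic map in that multiplier.

    Holomorphy of [eta] and continuity of [eta'] are read off the mixed second derivatives of the
    family [H]. *)

Definition rc (x : R) : C R := Complex x 0.

Lemma rcD x y : rc (x + y) = rc x + rc y.
Proof. exact: (rmorphD (real_complex R)). Qed.

Lemma rcB x y : rc (x - y) = rc x - rc y.
Proof. exact: (rmorphB (real_complex R)). Qed.

Lemma rcM x y : rc (x * y) = rc x * rc y.
Proof. exact: (rmorphM (real_complex R)). Qed.

Lemma rcV x : rc x^-1 = (rc x)^-1.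
Proof. exact: (fmorphV (real_complex R)). Qed.

Lemma rc_eq0 x : (rc x == 0) = (x == 0).
Proof. exact: (fmorph_eq0 (real_complex R)). Qed.

Lemma Re_mul z w : complex.Re (z * w : C R) =
  complex.Re z * complex.Re w - complex.Im z * complex.Im w.
Proof. by case: z w => a b [c d]. Qed.

Lemma Im_mul z w : complex.Im (z * w : C R) =
  complex.Re z * complex.Im w + complex.Im z * complex.Re w.
Proof. by case: z w => a b [c d]. Qed.

Lemma Re_add z w : complex.Re (z + w : C R) = complex.Re z + complex.Re w.
Proof. by case: z w => a b [c d]. Qed.

Lemma Im_add z w : complex.Im (z + w : C R) = complex.Im z + complex.Im w.
Proof. by case: z w => a b [c d]. Qed.

Lemma Re_opp z : complex.Re (- z : C R) = - complex.Re z.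
Proof. by case: z. Qed.

Lemma Im_opp z : complex.Im (- z : C R) = - complex.Im z.
Proof. by case: z. Qed.

Lemma complex_ext z w : complex.Re z = complex.Re w ->
  complex.Im z = complex.Im w -> z = w.
Proof. by case: z w => a b [c d] /= -> ->. Qed.

Lemma normE z : `|z| = rc (modulus z).
Proof. by case: z => a b; rewrite /modulus /rc normc_def. Qed.

Lemma modulus_sqr z : modulus z ^+ 2 = complex.Re z ^+ 2 + complex.Im z ^+ 2.
Proof.
by case: z => a b; rewrite /modulus normc_def sqr_sqrtr ?addr_ge0 ?sqr_ge0.
Qed.

Lemma modulus_ge0 z : 0 <= modulus z.
Proof. by have := normr_ge0 z; rewrite normE lecE => /andP[]. Qed.

Lemma modulusM z w : modulus (z * w) = modulus z * modulus w.
Proof.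
have := normrM z w; rewrite !normE => /(congr1 (@complex.Re R)).
by rewrite -rcM.
Qed.

Lemma modulusX z n : modulus (z ^+ n) = modulus z ^+ n.
Proof.
have := normrX n z; rewrite !normE => /(congr1 (@complex.Re R)).
by rewrite -(rmorphXn (real_complex R)).
Qed.

Lemma modulusV z : modulus z^-1 = (modulus z)^-1.
Proof.
have := normfV z; rewrite !normE => /(congr1 (@complex.Re R)).
by rewrite -rcV.
Qed.

Lemma modulusD z w : modulus (z + w) <= modulus z + modulus w.
Proof. by have := ler_normD z w; rewrite !normE -rcD lecE => /andP[]. Qed.

Lemma modulusN z : modulus (- z) = modulus z.
Proof. by rewrite /modulus normrN. Qed.

Lemma modulus_sym z w : modulus (z - w) = modulus (w - z).
Proof. by rewrite /modulus distrC. Qed.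

Lemma modulusB z w : modulus (z - w) <= modulus z + modulus w.
Proof. by rewrite -(modulusN w) modulusD. Qed.

Lemma modulus_rev z w : modulus z - modulus w <= modulus (z - w).
Proof.
by rewrite lerBlDr; apply: le_trans (modulusD _ _); rewrite subrK.
Qed.

Lemma modulus_tri u z w : modulus (z - w) <= modulus (z - u) + modulus (u - w).
Proof. by apply: le_trans (modulusD _ _); rewrite addrA subrK. Qed.

Lemma modulus0 : modulus (0 : C R) = 0.
Proof. by rewrite /modulus normr0. Qed.

Lemma modulus1 : modulus (1 : C R) = 1.
Proof. by rewrite /modulus normr1. Qed.

Lemma modulus_eq0 z : (modulus z == 0) = (z == 0).
Proof. by rewrite -rc_eq0 -normE normr_eq0. Qed.

Lemma modulus_gt0 z : (0 < modulus z) = (z != 0).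
Proof. by rewrite lt0r modulus_ge0 andbT modulus_eq0. Qed.

Lemma modulus_rc x : modulus (rc x) = `|x|.
Proof. by rewrite /modulus normc_def /= expr0n addr0 sqrtr_sqr. Qed.

Lemma normc_lt z x : (`|z| < rc x) = (modulus z < x).
Proof. by rewrite normE ltcR. Qed.

Lemma normc_le z x : (`|z| <= rc x) = (modulus z <= x).
Proof. by rewrite normE lecR. Qed.

Lemma normc_lt1 z : (`|z| < 1) = (modulus z < 1).
Proof. exact: normc_lt. Qed.

Lemma Re_le_modulus z : `|complex.Re z| <= modulus z.
Proof.
rewrite -(ler_pXn2r (n := 2)) ?nnegrE ?modulus_ge0 // modulus_sqr.
by rewrite real_normK ?num_real // lerDl sqr_ge0.
Qed.

Lemma Im_le_modulus z : `|complex.Im z| <= modulus z.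
Proof.
rewrite -(ler_pXn2r (n := 2)) ?nnegrE ?modulus_ge0 // modulus_sqr.
by rewrite real_normK ?num_real // lerDr sqr_ge0.
Qed.

Lemma modulus_le_ReIm z : modulus z <= `|complex.Re z| + `|complex.Im z|.
Proof.
rewrite -(ler_pXn2r (n := 2)) ?nnegrE ?modulus_ge0 ?addr_ge0 //.
rewrite modulus_sqr sqrrD !real_normK ?num_real //.
by rewrite lerD2r lerDl mulrn_wge0 // mulr_ge0.
Qed.

Lemma modulus_sqrD z w :
  modulus (z + w) ^+ 2 <= 2 * modulus z ^+ 2 + 2 * modulus w ^+ 2.
Proof.
rewrite !modulus_sqr Re_add Im_add; set x := complex.Re z;
  set y := complex.Im z.
set p := complex.Re w; set q := complex.Im w.
by have := sqr_ge0 (x - p); have := sqr_ge0 (y - q); lra.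
Qed.

End Modulus.

(** * Slopes over a refining family of partitions *)

Lemma sum_double (R : realType) (F : nat -> R) N :
  \sum_(0 <= k < N * 2) F k = \sum_(0 <= k < N) (F (k * 2)%N + F (k * 2).+1).
Proof.
elim: N => [|N IH]; first by rewrite mul0n !big_geq.
by rewrite mulSn addSn add1n !big_nat_recr ?IH //= addrA.
Qed.

Lemma sum_multiples_le (R : realType) (F : nat -> R) M N : (0 < M)%N ->
  (forall k, 0 <= F k) ->
  \sum_(0 <= j < N) F (j * M)%N <= \sum_(0 <= k < N * M) F k.
Proof.
move=> M0 F0; elim: N => [|N IH]; first by rewrite mul0n !big_geq.
rewrite big_nat_recr //= mulSn addnC.
rewrite [leRHS](@big_cat_nat _ _ _ (N * M)) ?leq_addr //=.
apply: lerD => //; rewrite big_ltn ?lerDl ?sumr_ge0 //.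
by rewrite -{1}[(N * M)%N]addn0 ltn_add2l.
Qed.

(* The numbers [a n k], [k <= 2 ^ n], are the ends of the arcs of generation
   [n], each of which is cut into two arcs of the next generation; [w] is a
   function on these ends. The slopes of [w] on the arcs form a martingale whose
   increments [slope_jump] are asymptotically invariant under the dynamics. *)
Section Slopes.
Variables (R : realType) (a : nat -> nat -> R) (w : nat -> nat -> C R).

Definition arc_len n k := a n k.+1 - a n k.
Definition chord n k := w n k.+1 - w n k.
Definition chord_slope n k := chord n k / rc (arc_len n k).
Definition slope_jump n k := chord_slope n.+1 (k * 2) - chord_slope n k.
(** The integral of the squared slope of the piecewise linear interpolation of [w]: up to the total
    length, the second moment of the martingale of slopes. *)
Definition energy n :=
  \sum_(0 <= k < 2 ^ n) (modulus (chord n k) ^+ 2 / arc_len n k).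

Hypothesis a_refine : forall n k, a n.+1 (k * 2)%N = a n k.
Hypothesis w_refine : forall n k, w n.+1 (k * 2)%N = w n k.
Hypothesis arc_gt0 : forall n k, 0 < arc_len n k.
Hypothesis w_periodic : forall n k, w n (k + 2 ^ n)%N = w n k.
Hypothesis arc_periodic : forall n k, arc_len n (k + 2 ^ n)%N = arc_len n k.
(** Indices follow the dynamics: arc [k] of generation [n.+1] is mapped onto arc [k] of generation
    [n], and the other preimage lies [2 ^ n] arcs further on. The index doubles only under
    refinement. *)
Hypothesis arc_preimages : forall n k,
  arc_len n.+1 k + arc_len n.+1 (k + 2 ^ n)%N = arc_len n k.

(** Orthogonality of the martingale increment on one arc: the slope of the union is the mean of the
    two slopes with weights [p] and [q]. The deviation on the right half is proportional to that on
    the left half, so the variance is expressed by the latter alone. *)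
Lemma energy_step_identity (x y : C R) (p q : R) : 0 < p -> 0 < q ->
  modulus x ^+ 2 / p + modulus y ^+ 2 / q - modulus (x + y) ^+ 2 / (p + q) =
  modulus (x / rc p - (x + y) / rc (p + q)) ^+ 2 * (p * (p + q) / q).
Proof.
move=> p0 q0.
have hp : p != 0 by rewrite gt_eqF.
have hq : q != 0 by rewrite gt_eqF.
have hpq : p + q != 0 by rewrite gt_eqF // addr_gt0.
rewrite -!rcV !modulus_sqr !(Re_add, Im_add, Re_opp, Im_opp, Re_mul, Im_mul) /rc
  /=.
by field; rewrite hp hq hpq.
Qed.

(** Only the share of the left half is kept; the factor [(p + q) / q] that is dropped is at least
    1. *)
Lemma energy_step n k :
  modulus (slope_jump n k) ^+ 2 * arc_len n.+1 (k * 2) <=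
  modulus (chord n.+1 (k * 2)) ^+ 2 / arc_len n.+1 (k * 2) +
  modulus (chord n.+1 (k * 2).+1) ^+ 2 / arc_len n.+1 (k * 2).+1 -
  modulus (chord n k) ^+ 2 / arc_len n k.
Proof.
have next : (k * 2).+2 = (k.+1 * 2)%N by rewrite mulSn.
have -> : chord n k = chord n.+1 (k * 2) + chord n.+1 (k * 2).+1.
  by rewrite /chord next !w_refine; ring.
have arcE : arc_len n k = arc_len n.+1 (k * 2) + arc_len n.+1 (k * 2).+1.
  by rewrite /arc_len next !a_refine; ring.
rewrite arcE energy_step_identity //.
have -> : slope_jump n k = chord n.+1 (k * 2) / rc (arc_len n.+1 (k * 2)) -
   (chord n.+1 (k * 2) + chord n.+1 (k * 2).+1) /
   rc (arc_len n.+1 (k * 2) + arc_len n.+1 (k * 2).+1).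
  rewrite /slope_jump /chord_slope -arcE; congr (_ - _ / _).
  by rewrite /chord next !w_refine; ring.
have p0 := arc_gt0 n.+1 (k * 2); have q0 := arc_gt0 n.+1 (k * 2).+1.
rewrite ler_wpM2l ?sqr_ge0 // -mulrA; apply: ler_peMr; first exact: ltW.
by rewrite ler_pdivlMr // mul1r lerDr ltW.
Qed.

(** Every arc contributes a non-negative amount, so the sum may be restricted to the indices
    [j * 2 ^ m]. These are the arcs that [d] iterates carry, up to full turns, to the arc 0 of
    generation [m]. *)
Lemma energy_increment m d :
  \sum_(0 <= j < 2 ^ d) (modulus (slope_jump (m + d) (j * 2 ^ m)) ^+ 2 *
    arc_len (m + d).+1 (j * 2 ^ m * 2)) <= energy (m + d).+1 - energy (m + d).
Proof.
rewrite /energy expnS mulnC sum_double -sumrB.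
rewrite expnD [(2 ^ m * _)%N]mulnC.
apply: le_trans (sum_multiples_le _ _ _); last 2 first.
- by rewrite expn_gt0.
- by move=> k; apply: le_trans (energy_step _ _);
    rewrite mulr_ge0 ?sqr_ge0 // ltW.
by apply: ler_sum => j _; rewrite energy_step.
Qed.

(** Doubling the range of [j] adds to each arc the one [2 ^ (m + d)] further on, the other preimage
    of the same arc. *)
Lemma sum_preimage_arcs m d :
  \sum_(0 <= j < 2 ^ d) arc_len (m + d) (j * 2 ^ m) = arc_len m 0.
Proof.
elim: d => [|d IH]; first by rewrite addn0 expn0 big_nat1 mul0n.
rewrite -IH addnS expnS mul2n -addnn.
rewrite (@big_cat_nat _ _ _ (2 ^ d)) ?leq_addr //=.
rewrite -{2}[(2 ^ d)%N]add0n big_addn addnK -big_split /=.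
apply: eq_bigr => j _.
by rewrite mulnDl -expnD [(d + m)%N]addnC arc_preimages.
Qed.

Lemma w_periodic_mul n j k : w n (k + j * 2 ^ n)%N = w n k.
Proof.
by elim: j => [|j IH]; rewrite ?addn0 // mulSn addnCA addnC w_periodic.
Qed.

Lemma arc_periodic_mul n j k : arc_len n (k + j * 2 ^ n)%N = arc_len n k.
Proof.
by elim: j => [|j IH]; rewrite ?addn0 // mulSn addnCA addnC arc_periodic.
Qed.

Lemma slope_periodic_mul n j k : chord_slope n (k + j * 2 ^ n)%N =
  chord_slope n k.
Proof. by rewrite /chord_slope /chord -addSn !w_periodic_mul arc_periodic_mul.
Qed.

Lemma delta_periodic_mul n j : slope_jump n (j * 2 ^ n) = slope_jump n 0.
Proof.
rewrite /slope_jump -[(j * 2 ^ n)%N]add0n slope_periodic_mul mulnDl -mulnA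
  -expnSr.
by rewrite slope_periodic_mul.
Qed.

Variables (K rho : R).
Hypothesis rho_ge0 : 0 <= rho.
Hypothesis rho_lt1 : rho < 1.
Hypothesis delta_invariant : forall n k,
  modulus (slope_jump n.+1 k - slope_jump n k) <= K * rho ^+ n.

(** Changing the generation at a fixed index follows one arc along its orbit, so the deviations form
    a geometric series. *)
Lemma delta_drift m d k :
  modulus (slope_jump (m + d) k - slope_jump m k) <= K * rho ^+ m / (1 - rho).
Proof.
have r1 : 0 < 1 - rho by rewrite subr_gt0.
(* The exact partial sum of the series is what the induction on [d] propagates. *)
suff : modulus (slope_jump (m + d) k - slope_jump m k) <=
    K * rho ^+ m * (1 - rho ^+ d) / (1 - rho).
  move=> /le_trans; apply.
  rewrite ler_pM2r ?invr_gt0 // ler_piMr ?lerBlDr ?lerDl ?exprn_ge0 //.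
  exact: le_trans (modulus_ge0 _) (delta_invariant m k).
elim: d => [|d IH]; first by rewrite addn0 subrr modulus0 expr0 subrr mulr0
  mul0r.
apply: le_trans (modulus_tri (slope_jump (m + d) k) _ _) _; rewrite addnS.
apply: le_trans (lerD (delta_invariant _ _) IH) _.
rewrite exprD exprS le_eqVlt; apply/orP; left; apply/eqP.
by field; rewrite gt_eqF.
Qed.

(** A jump on the arc 0 of generation [m] that exceeds the total drift by [c] persists with size at
    least [c] on all preimages of this arc. Their left halves have total length [arc_len m.+1 0] in
    every generation, so each generation adds at least the same amount. *)
Lemma energy_linear_growth m (c : R) : 0 <= c ->
  c + K * rho ^+ m / (1 - rho) <= modulus (slope_jump m 0) ->
  forall d, d%:R * (c ^+ 2 * arc_len m.+1 0) <= energy (m + d).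
Proof.
move=> c0 hc; elim=> [|d IH].
  rewrite mul0r addn0 sumr_ge0 // => k _.
  by rewrite divr_ge0 ?sqr_ge0 ?ltW.
rewrite addnS -natr1 mulrDl mul1r -[energy _.+1](subrK (energy (m + d))) addrC.
apply: lerD IH; apply: le_trans (energy_increment m d).
rewrite -(sum_preimage_arcs m.+1 d) mulr_sumr; apply: ler_sum => j _.
rewrite addSn [(j * 2 ^ m.+1)%N]mulnC expnS -mulnA mulnC [(_ * j)%N]mulnC.
apply: ler_wpM2r; first exact: ltW.
rewrite ler_pXn2r ?nnegrE ?modulus_ge0 //.
have := delta_drift m d (j * 2 ^ m); rewrite delta_periodic_mul modulus_sym.
have := modulus_rev (slope_jump m 0) (slope_jump (m + d) (j * 2 ^ m)); lra.
Qed.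

Lemma delta_zero_lower_bound (kappa : C R) (K' : R) :
  (forall m, modulus (slope_jump m 0 + kappa) <= K' * rho ^+ m) ->
  kappa != 0 ->
  exists2 c : R, 0 < c & exists m, forall d, c * d%:R <= energy (m + d).
Proof.
move=> hk k0; have kp : 0 < modulus kappa by rewrite modulus_gt0.
(* [M * rho ^ m] bounds the distance of the jump from [- kappa] together with its drift over all
   later generations. *)
pose M := K' + K / (1 - rho).
have : (fun m => M * rho ^+ m) @ \oo --> (M * 0 : R).
  by apply: cvgMr; apply: cvg_expr; rewrite ger0_norm.
rewrite mulr0 => /cvgr_lt /(_ (modulus kappa / 2)) [];
  first by rewrite divr_gt0.
move=> m _ /(_ m (leqnn m)) /= hm.
exists ((modulus kappa / 2) ^+ 2 * arc_len m.+1 0).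
  by rewrite mulr_gt0 // exprn_gt0 // divr_gt0.
exists m => d; rewrite mulrC; apply: energy_linear_growth.
  by rewrite divr_ge0 ?modulus_ge0.
have := hk m; have := modulus_rev kappa (- slope_jump m 0).
rewrite opprK modulusN addrC [kappa + _]addrC.
have -> : K * rho ^+ m / (1 - rho) = M * rho ^+ m - K' * rho ^+ m.
  by rewrite /M; ring.
lra.
Qed.

End Slopes.

(** * Expanding circle maps of degree two *)

Lemma modulus_sum4 (R : realType) (x1 x2 x3 x4 : C R) (y1 y2 y3 y4 : R) :
  modulus x1 <= y1 -> modulus x2 <= y2 -> modulus x3 <= y3 ->
  modulus x4 <= y4 ->
  modulus (x1 + x2 + x3 + x4) <= y1 + y2 + y3 + y4.
Proof.
move=> h1 h2 h3 h4.
apply: le_trans (modulusD _ _) (lerD _ h4).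
apply: le_trans (modulusD _ _) (lerD _ h3).
exact: le_trans (modulusD _ _) (lerD h1 h2).
Qed.

(* [phi] is the lift to the line of an expanding circle map of degree 2 that
   fixes 0, [psi] is its inverse and [P] its derivative. [bval] is the solution
   of [w (phi s) = V s + P s * w s] on the preimages of 0. *)
Section ExpandingLift.
Variables (R : realType) (phi psi P P1 : R -> R) (V V1 : R -> C R).
Variables (lam M : R).

Hypothesis psiK : cancel psi phi.
Hypothesis psi_mono : {mono psi : x y / x < y}.
Hypothesis psi0 : psi 0 = 0.
Hypothesis psi_periodic : forall x, psi (x + 2 * (2 * pi)) = psi x + 2 * pi.
(** [psi] and its value a full turn later are the two inverse branches on the circle; their images
    of an interval have together its length. *)
Hypothesis psi_preimages : forall x y,
  psi y - psi x + (psi (y + 2 * pi) - psi (x + 2 * pi)) = y - x.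
Hypothesis P_periodic : forall x, P (x + 2 * pi) = P x.
Hypothesis V_periodic : forall x, V (x + 2 * pi) = V x.
Hypothesis V0 : V 0 = 0.
Hypothesis lam_gt0 : 0 < lam.
Hypothesis lam_lt1 : lam < 1.
Hypothesis P_expand : forall x, 1 <= lam * P x.
Hypothesis M_ge0 : 0 <= M.
Hypothesis phi_expand : forall a b, a < b -> b - a <= lam * (phi b - phi a).
Hypothesis phi_taylor : forall a b, a < b ->
  `|phi b - phi a - P a * (b - a)| <= M * (b - a) ^+ 2.
Hypothesis P_taylor : forall a b, a < b ->
  `|P b - P a - P1 a * (b - a)| <= M * (b - a) ^+ 2.
Hypothesis P_lipschitz : forall a b, a < b -> `|P b - P a| <= M * (b - a).
Hypothesis P1_bound : forall a, `|P1 a| <= M.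
Hypothesis V_taylor : forall a b, a < b ->
  modulus (V b - V a - V1 a * rc (b - a)) <= M * (b - a) ^+ 2.
Hypothesis V_lipschitz : forall a b, a < b -> modulus (V b - V a) <=
  M * (b - a).
Hypothesis V1_bound : forall a, modulus (V1 a) <= M.
Hypothesis V_bound : forall a, modulus (V a) <= M.

(** The preimages of order [n] of the base point of the circle, lifted to the line; as [psi] is
    increasing they come in order, [2 ^ n] of them per turn. *)
Definition node n k : R := iter n psi (2 * pi * k%:R).

Fixpoint bval n k : C R :=
  if n is m.+1 then (bval m k - V (node n k)) / rc (P (node n k)) else 0.

Local Notation arc := (arc_len node).
Local Notation diff := (chord bval).
Local Notation slope := (chord_slope node bval).
Local Notation delta := (slope_jump node bval).

Lemma bvalS n k :
  bval n.+1 k = (bval n k - V (node n.+1 k)) / rc (P (node n.+1 k)).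
Proof. by []. Qed.

Lemma phi_node n k : phi (node n.+1 k) = node n k.
Proof. exact: psiK. Qed.

Lemma psi_2pi k : psi (2 * pi * (k * 2)%:R) = 2 * pi * k%:R.
Proof.
elim: k => [|k IH]; first by rewrite mul0n mulr0 psi0.
have -> : 2 * pi * (k.+1 * 2)%:R = 2 * pi * (k * 2)%:R + 2 * (2 * pi) :> R.
  by rewrite mulSn natrD; ring.
by rewrite psi_periodic IH -natr1; ring.
Qed.

Lemma node_refine n k : node n.+1 (k * 2)%N = node n k.
Proof. by rewrite /node iterSr psi_2pi. Qed.

Lemma node0 n : node n 0 = 0.
Proof. by rewrite /node mulr0; elim: n => [//|n /= ->]. Qed.

Lemma node_lt n k : node n k < node n k.+1.
Proof.
elim: n => [|n IH]; last by rewrite /node /= psi_mono.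
by rewrite /node /= ltr_pM2l ?mulr_gt0 ?pi_gt0 // ltr_nat.
Qed.

Lemma node_periodic n k : node n (k + 2 ^ n)%N = node n k + 2 * pi.
Proof.
elim: n k => [|n IH] k; first by rewrite /node /= natrD; ring.
have E m : node n.+1 m = psi (node n m) by [].
rewrite 2!E expnS mul2n -addnn addnA !IH -psi_periodic.
by congr psi; ring.
Qed.

Lemma V_node0 k : V (node 0 k) = 0.
Proof.
elim: k => [|k IH]; first by rewrite node0 V0.
by rewrite -addn1 -[1%N]/(2 ^ 0)%N node_periodic V_periodic.
Qed.

(** The value at a point does not depend on the generation in which the point is listed. It starts
    with [V 0 = 0]: at the fixed point the value 0 solves the equation. *)
Lemma bval_refine n k : bval n.+1 (k * 2)%N = bval n k.
Proof.
elim: n => [|n IH].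
  by rewrite bvalS node_refine V_node0 subrr mul0r.
by rewrite bvalS IH node_refine.
Qed.

Lemma bval_zero n : bval n 0 = 0.
Proof. by elim: n => [//|n IH]; rewrite -[0%N]/(0 * 2)%N bval_refine. Qed.

Lemma bval_periodic n k : bval n (k + 2 ^ n)%N = bval n k.
Proof.
elim: n k => [//|n IH] k.
rewrite 2!bvalS node_periodic P_periodic V_periodic.
by rewrite expnS mul2n -addnn addnA !IH.
Qed.

Lemma arc_gt0 n k : 0 < arc n k.
Proof. by rewrite subr_gt0 node_lt. Qed.

Lemma arc_periodic n k : arc n (k + 2 ^ n)%N = arc n k.
Proof. by rewrite /arc_len -addSn !node_periodic; ring. Qed.

Lemma arc_preimages n k : arc n.+1 k + arc n.+1 (k + 2 ^ n)%N = arc n k.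
Proof.
have E m : node n.+1 m = psi (node n m) by [].
by rewrite /arc_len !E -addSn !node_periodic psi_preimages.
Qed.

Lemma P_gt0 x : 0 < P x.
Proof.
have := P_expand x; rewrite -(pmulr_rgt0 _ lam_gt0).
exact: lt_le_trans.
Qed.

Lemma P_ge1 x : 1 <= P x.
Proof.
apply: le_trans (P_expand x) _.
by apply: ler_piMl; apply: ltW => //; exact: P_gt0.
Qed.

Lemma rcP_neq0 x : rc (P x) != 0.
Proof. by rewrite rc_eq0 gt_eqF ?P_gt0. Qed.

Lemma modulus_divP (z : C R) x : modulus (z / rc (P x)) <= lam * modulus z.
Proof.
rewrite modulusM modulusV modulus_rc ger0_norm ?(ltW (P_gt0 _)) //.
rewrite ler_pdivrMr ?P_gt0 // mulrAC ler_peMl ?modulus_ge0 //.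
Qed.

Lemma bval_eq n k :
  bval n k = V (node n.+1 k) + rc (P (node n.+1 k)) * bval n.+1 k.
Proof.
rewrite bvalS mulrC divfK ?rcP_neq0 //.
by rewrite addrC subrK.
Qed.

Lemma bval_bound n k : modulus (bval n k) <= M / (1 - lam).
Proof.
have l1 : 0 < 1 - lam by rewrite subr_gt0.
elim: n => [|n IH]; first by rewrite modulus0 divr_ge0 // ltW.
apply: le_trans (modulus_divP _ _) _.
have : modulus (bval n k - V (node n.+1 k)) <= M / (1 - lam) + M.
  by apply: le_trans (modulusB _ _) (lerD IH (V_bound _)).
move=> /(ler_wpM2l (ltW lam_gt0))/le_trans; apply.
rewrite -subr_ge0.
have -> : M / (1 - lam) - lam * (M / (1 - lam) + M) = M * (1 - lam).
  by field; rewrite gt_eqF.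
by rewrite mulr_ge0 // ltW.
Qed.

Lemma arc_step n k : arc n.+1 k <= lam * arc n k.
Proof. by have := phi_expand (node_lt n.+1 k); rewrite !phi_node. Qed.

Lemma arc_bound n k : arc n k <= 2 * pi * lam ^+ n.
Proof.
elim: n => [|n IH].
  by rewrite /arc_len /node /= -natr1 expr0 le_eqVlt; apply/orP; left;
    apply/eqP; ring.
apply: le_trans (arc_step n k) _.
rewrite exprS mulrCA; apply: ler_wpM2l IH; exact: ltW.
Qed.

Definition bnd := M / (1 - lam).

Lemma bnd_ge0 : 0 <= bnd.
Proof. by rewrite divr_ge0 // subr_ge0 ltW. Qed.

Variable rho : R.
Hypothesis rho_gt : lam < rho.
Hypothesis rho_lt1 : rho < 1.

(** The solution [c] of [lam * (c + (M + M * bnd) * (2 * pi)) = rho * c]. The recursion for the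
    chords contracts by [lam] and is driven by arcs of order [lam ^ n]; this resonance would produce
    [n * lam ^ n], which the larger rate [rho] absorbs. *)
Definition diff_const := lam * (M + M * bnd) * (2 * pi) / (rho - lam).

Lemma rho_gt0 : 0 < rho. Proof. exact: lt_trans rho_gt. Qed.

Lemma diff_const_ge0 : 0 <= diff_const.
Proof.
rewrite /diff_const divr_ge0 ?subr_ge0 ?(ltW rho_gt) // mulr_ge0 //.
  by rewrite mulr_ge0 ?(ltW lam_gt0) // addr_ge0 // mulr_ge0 // bnd_ge0.
by rewrite mulr_ge0 // pi_ge0.
Qed.

Lemma diff_bound n k : modulus (diff n k) <= diff_const * rho ^+ n.
Proof.
elim: n => [|n IH].
  by rewrite /chord /= subrr modulus0 mulr_ge0 ?diff_const_ge0 // exprn_ge0 ?ltW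
    ?rho_gt0.
set a := node n.+1 k; set b := node n.+1 k.+1.
have ab : a < b := node_lt n.+1 k.
have -> : diff n.+1 k = (diff n k - (V b - V a) -
    rc (P b - P a) * bval n.+1 k.+1) / rc (P a).
  apply: (mulIf (rcP_neq0 a)); rewrite divfK ?rcP_neq0 //.
  by rewrite /chord !(bval_eq n) -/a -/b rcB; ring.
apply: le_trans (modulus_divP _ _) _.
set L := arc n.+1 k; have LE : L = b - a by [].
have L0 : 0 < L := arc_gt0 _ _.
have hL : L <= 2 * pi * rho ^+ n.
  apply: le_trans (arc_bound _ _) _; rewrite ler_wpM2l ?mulr_ge0 ?pi_ge0 //.
  apply: (@le_trans _ _ (lam ^+ n)).
    by rewrite exprS; apply: ler_piMl; [apply: exprn_ge0|]; apply: ltW.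
  by apply: lerXn2r; rewrite ?nnegrE; apply: ltW => //; exact: rho_gt0.
have h1 : modulus (rc (P b - P a) * bval n.+1 k.+1) <= M * L * bnd.
  rewrite modulusM modulus_rc; apply: ler_pM; rewrite ?modulus_ge0 //.
    by rewrite LE P_lipschitz.
  exact: bval_bound.
have h2 : modulus (V b - V a) <= M * L by rewrite LE V_lipschitz.
have := modulusB (diff n k - (V b - V a)) (rc (P b - P a) * bval n.+1 k.+1).
have := modulusB (diff n k) (V b - V a).
move=> h3 h4.
have h5 : M * L + M * L * bnd <= (M + M * bnd) * (2 * pi * rho ^+ n).
  have -> : M * L + M * L * bnd = (M + M * bnd) * L by ring.
  by rewrite ler_wpM2l // addr_ge0 // mulr_ge0 // bnd_ge0.
apply: (@le_trans _ _ (lam * (diff_const * rho ^+ n +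
    (M + M * bnd) * (2 * pi * rho ^+ n)))).
  apply: ler_wpM2l; first exact: ltW.
  lra.
rewrite exprS /diff_const le_eqVlt; apply/orP; left; apply/eqP.
by field; rewrite gt_eqF // subr_gt0.
Qed.

(* Differentiating [w (phi s) = V s + P s * w s] shows that the slopes of [w] at
   [phi s] and at [s] differ by [slope_drop s (w s)]. *)
Definition slope_drop (s : R) (z : C R) : C R := (V1 s + rc (P1 s) * z) / rc
  (P s).

Definition drop_const := M + M * bnd + (M + M * bnd) * M + 2 * M.

(** Subtracting the functional equation at the two ends of an arc gives the chord of its image;
    dividing by the length [D] of the image, which is [P a * L] to first order, leaves the slope of
    the arc plus the drop, with errors of the size of the arc and of its chord. *)
Lemma slope_step n k :
  modulus (slope n k - slope n.+1 k - slope_drop (node n.+1 k) (bval n.+1 k))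
  <= drop_const * (arc n.+1 k + modulus (diff n.+1 k)).
Proof.
set a := node n.+1 k; set b := node n.+1 k.+1.
have ab : a < b := node_lt n.+1 k.
set L := arc n.+1 k; have LE : L = b - a by [].
have L0 : 0 < L := arc_gt0 _ _.
set D := arc n k.
have DE : D = phi b - phi a by rewrite /a /b !phi_node.
have LD : L <= D.
  apply: le_trans (arc_step n k) _.
  by apply: ler_piMl; apply: ltW => //; exact: arc_gt0.
have D0 : 0 < D := arc_gt0 _ _.
have rL : rc L != 0 by rewrite rc_eq0 gt_eqF.
have rD : rc D != 0 by rewrite rc_eq0 gt_eqF.
have rP := rcP_neq0 a.
set wa := bval n.+1 k; set wb := bval n.+1 k.+1; set dw := diff n.+1 k.
have dwE : wb = wa + dw by rewrite /dw /chord addrC subrK.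
(* The four errors: the Taylor remainders of [V] and [P]; the value [wb] used in place of [wa];
   [L / D] used in place of [1 / P a] in the drop; [D] used in place of [P a * L] in the slope. *)
rewrite [X in modulus X](_ : _ =
  ((V b - V a - V1 a * rc L) + rc (P b - P a - P1 a * L) * wb) / rc D
   + rc (P1 a * L / D) * dw
   + (V1 a + rc (P1 a) * wa) * rc ((P a * L - D) / (D * P a))
   + dw * rc ((P a * L - D) / (D * L))); last first.
  rewrite /chord_slope /slope_drop -/dw -/L -/D.
  have -> : diff n k = V b - V a + rc (P b - P a) * wb + rc (P a) * dw.
    by rewrite /chord !(bval_eq n) -/a -/b -/wa -/wb dwE rcB; ring.
  rewrite dwE !(rcM, rcB, rcV).
  by field; rewrite -!rcB; apply/and3P; split.
have hd : `|P a * L - D| <= M * L ^+ 2.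
  by rewrite distrC DE LE phi_taylor.
have b0 := bnd_ge0.
have P1' := P_ge1 a.
have P0 := P_gt0 a.
have h1 : modulus (((V b - V a - V1 a * rc L) +
    rc (P b - P a - P1 a * L) * wb) / rc D) <= (M + M * bnd) * L.
  rewrite modulusM modulusV modulus_rc gtr0_norm // ler_pdivrMr //.
  apply: (@le_trans _ _ ((M + M * bnd) * L * L)); last first.
    by rewrite ler_wpM2l // mulr_ge0 ?(ltW L0) // addr_ge0 // mulr_ge0.
  apply: le_trans (modulusD _ _) _.
  have -> : (M + M * bnd) * L * L = M * L ^+ 2 + M * L ^+ 2 * bnd by ring.
  apply: lerD; first by rewrite LE V_taylor.
  rewrite modulusM modulus_rc; apply: ler_pM; rewrite ?modulus_ge0 //.
    by rewrite LE P_taylor.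
  exact: bval_bound.
have h2 : modulus (rc (P1 a * L / D) * dw) <= M * modulus dw.
  rewrite modulusM modulus_rc; apply: ler_wpM2r; first exact: modulus_ge0.
  rewrite -mulrA normrM -[leRHS]mulr1; apply: ler_pM => //.
  by rewrite gtr0_norm ?divr_gt0 // ler_pdivrMr // mul1r.
have h3 : modulus ((V1 a + rc (P1 a) * wa) * rc ((P a * L - D) / (D * P a)))
    <= (M + M * bnd) * M * L.
  rewrite modulusM modulus_rc -[leRHS]mulrA; apply: ler_pM;
    rewrite ?modulus_ge0 //.
    apply: le_trans (modulusD _ _) (lerD (V1_bound _) _).
    rewrite modulusM modulus_rc; apply: ler_pM; rewrite ?modulus_ge0 //.
    exact: bval_bound.
  rewrite normrM normfV [`|D * _|]gtr0_norm ?mulr_gt0 // ler_pdivrMr ?mulr_gt0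
    //.
  apply: le_trans hd _; rewrite expr2 -mulrA ler_wpM2l // ler_wpM2l ?(ltW L0)
    //.
  by apply: le_trans LD _; apply: ler_peMr => //; exact: ltW.
have h4 : modulus (dw * rc ((P a * L - D) / (D * L))) <= M * modulus dw.
  rewrite modulusM modulus_rc mulrC; apply: ler_wpM2r; first exact: modulus_ge0.
  rewrite normrM normfV [`|D * _|]gtr0_norm ?mulr_gt0 // ler_pdivrMr ?mulr_gt0
    //.
  apply: le_trans hd _; rewrite expr2; apply: ler_wpM2l => //;
    apply: ler_wpM2r => //; exact: ltW.
apply: le_trans (modulus_sum4 h1 h2 h3 h4) _.
rewrite /drop_const -subr_ge0.
set m := modulus dw; have m0 : 0 <= m by exact: modulus_ge0.
set S := M + M * bnd.
have S0 : 0 <= S by rewrite addr_ge0 // mulr_ge0.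
have -> : (S + S * M + 2 * M) * (L + m) -
  (S * L + M * m + S * M * L + M * m) = (S + S * M) * m + 2 * M * L by ring.
by rewrite addr_ge0 // mulr_ge0 ?(ltW L0) // ?addr_ge0 // mulr_ge0.
Qed.

Definition step_const := drop_const * (2 * pi + diff_const).

Lemma drop_const_ge0 : 0 <= drop_const.
Proof.
have b0 := bnd_ge0; have m0 := M_ge0; rewrite /drop_const.
by do ![exact: b0 | exact: m0 | exact: ler0n | apply: addr_ge0 |
  apply: mulr_ge0].
Qed.

Lemma slope_step_rho n k :
  modulus (slope n k - slope n.+1 k - slope_drop (node n.+1 k) (bval n.+1 k))
  <= step_const * rho ^+ n.
Proof.
apply: le_trans (slope_step n k) _.
rewrite /step_const -mulrA; apply: ler_wpM2l; first exact: drop_const_ge0.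
have r0 := ltW rho_gt0; have p0 : 0 <= pi :> R by exact: pi_ge0.
have le1 : rho ^+ n.+1 <= rho ^+ n by rewrite exprS; apply: ler_piMl;
  [apply: exprn_ge0|]; apply: ltW => //; exact: rho_gt0.
rewrite mulrDl; apply: lerD.
  apply: le_trans (arc_bound _ _) _; rewrite ler_wpM2l ?mulr_ge0 //.
  apply: le_trans le1; apply: lerXn2r; rewrite ?nnegrE; apply: ltW => //;
    exact: rho_gt0.
by apply: le_trans (diff_bound _ _) _; rewrite ler_wpM2l ?diff_const_ge0.
Qed.

Lemma step_const_ge0 : 0 <= step_const.
Proof.
by rewrite mulr_ge0 ?drop_const_ge0 // addr_ge0 ?diff_const_ge0 // mulr_ge0 //
  pi_ge0.
Qed.

(** Arc [k] of generation [n.+1] and its left half have the same left end, where the drop is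
    evaluated; hence the drops cancel when the slopes of the arc and of its half are compared. *)
Lemma delta_invariant n k :
  modulus (delta n.+1 k - delta n k) <= (2 * step_const) * rho ^+ n.
Proof.
have h1 := slope_step_rho n k; have h2 := slope_step_rho n.+1 (k * 2).
rewrite node_refine bval_refine in h2.
set g := slope_drop _ _ in h1 h2.
have -> : delta n.+1 k - delta n k = (slope n k - slope n.+1 k - g) -
    (slope n.+1 (k * 2) - slope n.+2 (k * 2) - g).
  by rewrite /slope_jump; ring.
apply: le_trans (modulusB _ _) _.
rewrite -mulrA mulrDl !mul1r; apply: lerD => //.
apply: le_trans h2 _; rewrite ler_wpM2l ?step_const_ge0 //.
by rewrite exprS; apply: ler_piMl; [apply: exprn_ge0|]; apply: ltW => //;
  exact: rho_gt0.
Qed.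

(** At index 0 passing to the left half and taking the preimage coincide, so the jump is minus the
    drop at the fixed point, where [bval] vanishes. *)
Lemma delta_zero_limit m :
  modulus (delta m 0 + V1 0 / rc (P 0)) <= (2 * step_const) * rho ^+ m.
Proof.
have h := slope_step_rho m 0; rewrite node0 bval_zero in h.
have -> : delta m 0 + V1 0 / rc (P 0) =
    - (slope m 0 - slope m.+1 0 - slope_drop 0 0).
  by rewrite /slope_jump mul0n /slope_drop mulr0 addr0; ring.
rewrite modulusN; apply: le_trans h _.
rewrite -mulrA ler_peMl ?ler1n //.
by rewrite mulr_ge0 ?step_const_ge0 // exprn_ge0 // ltW // rho_gt0.
Qed.

Lemma energy_growth : V1 0 != 0 ->
  exists2 c : R, 0 < c &
    exists m, forall d, c * d%:R <= energy node bval (m + d).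
Proof.
move=> V10.
apply: (delta_zero_lower_bound node_refine bval_refine arc_gt0 bval_periodic
  arc_periodic arc_preimages (ltW rho_gt0) rho_lt1 delta_invariant
  delta_zero_limit).
by rewrite mulf_neq0 // invr_eq0 rcP_neq0.
Qed.

End ExpandingLift.

(** * Curves with Lipschitz derivative *)

Section RealDerivative.
Variable R : realType.
Implicit Types (f g : R -> R) (x a b : R).

Lemma derC x (c : R) : is_derive x (1 : R) (fun=> c) 0.
Proof. exact: is_derive_cst. Qed.

Lemma derI x : is_derive x (1 : R) (fun y => y) 1.
Proof. exact: is_derive_id. Qed.

Lemma derD f g x a b : is_derive x (1 : R) f a -> is_derive x (1 : R) g b ->
  is_derive x (1 : R) (fun y => f y + g y) (a + b).
Proof. exact: is_deriveD. Qed.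

Lemma derN f x a : is_derive x (1 : R) f a ->
  is_derive x (1 : R) (fun y => - f y) (- a).
Proof. exact: is_deriveN. Qed.

Lemma derM f g x a b : is_derive x (1 : R) f a -> is_derive x (1 : R) g b ->
  is_derive x (1 : R) (fun y => f y * g y) (a * g x + f x * b).
Proof.
move=> hf hg; apply: is_derive_eq (is_deriveM hf hg) _.
by rewrite /GRing.scale /= addrC [a * _]mulrC.
Qed.

Lemma derV f x a : f x != 0 -> is_derive x (1 : R) f a ->
  is_derive x (1 : R) (fun y => (f y)^-1) (- a / f x ^+ 2).
Proof.
move=> f0 hf; apply: is_derive_eq (is_deriveV f0 hf) _.
by rewrite /GRing.scale /= mulNr mulrC mulNr.
Qed.

Lemma der_comp f g x a b : is_derive (g x) (1 : R) f a ->
  is_derive x (1 : R) g b -> is_derive x (1 : R) (fun y => f (g y)) (a * b).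
Proof. by move=> hf hg; exact: is_derive1_comp. Qed.

Lemma der_eq f g x a b : is_derive x (1 : R) f a -> f =1 g -> a = b ->
  is_derive x (1 : R) g b.
Proof. by move=> h /funext <- <-. Qed.

End RealDerivative.

(** * Mean value and Taylor estimates on the line *)

Section RealMeanValue.
Variable R : realType.

Lemma is_derive_continuous (f df : R -> R) :
  (forall x, is_derive x (1 : R) f (df x)) -> continuous f.
Proof.
by move=> h x; apply/differentiable_continuous/derivable1_diffP; case: (h x).
Qed.

Lemma mean_value (f df : R -> R) a b : a <= b ->
  (forall x, is_derive x (1 : R) f (df x)) ->
  exists c, [/\ a <= c, c <= b & f b - f a = df c * (b - a)].
Proof.
move=> ab h.
have cf : {within `[a, b], continuous f}.
  exact/continuous_subspaceT/is_derive_continuous.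
have [c + E] := MVT_segment ab (fun x _ => h x) cf.
by rewrite in_itv => /andP[ac cb]; exists c.
Qed.

Lemma taylor_of_lipschitz (f df : R -> R) (L a b : R) : 0 <= L -> a <= b ->
  (forall x, is_derive x (1 : R) f (df x)) ->
  (forall x y, x <= y -> `|df y - df x| <= L * (y - x)) ->
  `|f b - f a - df a * (b - a)| <= L * (b - a) ^+ 2.
Proof.
move=> L0 ab h hL; have [c [ac cb ->]] := mean_value ab h.
rewrite -mulrBl normrM [`|b - a|]ger0_norm ?subr_ge0 // expr2 mulrA.
apply: ler_wpM2r; first by rewrite subr_ge0.
apply: le_trans (hL _ _ ac) _; apply: ler_wpM2l => //.
by rewrite lerD2r.
Qed.

Lemma lipschitz_of_bound (f df : R -> R) (L a b : R) : a <= b ->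
  (forall x, is_derive x (1 : R) f (df x)) -> (forall x, `|df x| <= L) ->
  `|f b - f a| <= L * (b - a).
Proof.
move=> ab h hL; have [c [_ _ ->]] := mean_value ab h.
rewrite normrM [`|b - a|]ger0_norm ?subr_ge0 //.
by apply: ler_wpM2r; rewrite ?subr_ge0.
Qed.

Lemma abs_sin_le1 (x : R) : `|sin x| <= 1.
Proof. by rewrite ler_norml sin_geN1 sin_le1. Qed.

Lemma abs_cos_le1 (x : R) : `|cos x| <= 1.
Proof. by rewrite ler_norml cos_geN1 cos_le1. Qed.

End RealMeanValue.

(** * The exponential on the circle and the algebra of curves with Lipschitz derivative *)

Section Exponential.
Variable R : realType.
Implicit Types s t : R.

Lemma expiD s t : expi (s + t) = expi s * expi t :> C R.
Proof.
apply: complex_ext; rewrite ?Re_mul ?Im_mul /= ?cosD ?sinD //.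
by rewrite addrC.
Qed.

Lemma modulus_expi s : modulus (expi s) = 1.
Proof.
apply/eqP; rewrite -(eqrXn2 (n := 2)) ?modulus_ge0 // modulus_sqr /=.
by rewrite cos2Dsin2 expr1n.
Qed.

Lemma expi_neq0 s : expi s != 0 :> C R.
Proof. by rewrite -modulus_eq0 modulus_expi oner_eq0. Qed.

Lemma expi0 : expi 0 = 1 :> C R.
Proof. by rewrite /expi cos0 sin0. Qed.

Lemma expiN s : expi (- s) = (expi s)^-1 :> C R.
Proof.
apply: (mulIf (expi_neq0 s)); rewrite -expiD addNr expi0.
by rewrite mulVf ?expi_neq0.
Qed.

Lemma expi_conj s : (expi s : C R)^* = (expi s)^-1.
Proof. by rewrite -expiN /expi cosN sinN. Qed.

Lemma expi2pi s : expi (s + 2 * pi) = expi s :> C R.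
Proof.
by rewrite /expi mulr_natl cosD2pi sinD2pi.
Qed.

Lemma expi_eq1 s : 0 < s -> s < 2 * pi -> expi s != 1 :> C R.
Proof.
move=> s0 s2; apply/eqP => /(congr1 (@complex.Re R)) /= hc.
have : 0 < sin (s / 2).
  by apply: sin_gt0_pi; rewrite divr_gt0 //= ltr_pdivrMr // mulrC.
have : sin (s / 2) ^+ 2 = 0.
  have := cos_mulr2n (s / 2).
  have -> : (s / 2) *+ 2 = s by rewrite -mulr_natr divfK.
  by rewrite hc sin2cos2 -mulr_natr; lra.
by move=> /eqP; rewrite expf_eq0 /= => /eqP ->; rewrite ltxx.
Qed.

Definition iunit : C R := Complex 0 1.

(** First order Taylor bounds, uniform on the line. The class is closed under sums, products and
    inverses, which yields the quadratic remainders required of [P] and [V] without computing a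
    second derivative. *)
Definition lipC1 (g g' : R -> C R) := exists M : R, forall a b, a <= b ->
  [/\ modulus (g a) <= M, modulus (g' a) <= M,
      modulus (g b - g a) <= M * (b - a) &
      modulus (g b - g a - g' a * rc (b - a)) <= M * (b - a) ^+ 2].

Lemma lipC1_eq g g' h h' : lipC1 g g' -> g =1 h -> g' =1 h' -> lipC1 h h'.
Proof.
move=> [M hM] e e'; exists M => a b ab.
by have := hM a b ab; rewrite !e e'.
Qed.

Lemma lipC1P g g' : lipC1 g g' -> exists2 M : R, 0 <= M & forall a b, a <= b ->
  [/\ modulus (g a) <= M, modulus (g' a) <= M,
      modulus (g b - g a) <= M * (b - a) &
      modulus (g b - g a - g' a * rc (b - a)) <= M * (b - a) ^+ 2].
Proof.
move=> [M hM]; exists M => //; have [h _ _ _] := hM 0 0 (lexx _).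
exact: le_trans (modulus_ge0 _) h.
Qed.

Lemma lipC1_expi : lipC1 (@expi R) (fun s => iunit * expi s).
Proof.
exists 2 => a b ab.
have D0 : 0 <= b - a by rewrite subr_ge0.
have iE s : iunit * expi s = Complex (- sin s) (cos s) :> C R.
  by apply: complex_ext; rewrite ?Re_mul ?Im_mul /=; ring.
split.
- by rewrite modulus_expi ler1n.
- rewrite iE; apply: le_trans (modulus_le_ReIm _) _ => /=.
  have := abs_sin_le1 a; have := abs_cos_le1 a; rewrite normrN; lra.
- apply: le_trans (modulus_le_ReIm _) _;
  rewrite !(Re_add, Im_add, Re_opp, Im_opp) /=.
  rewrite -[2]/(1 + 1) mulrDl; apply: lerD.
    apply: (lipschitz_of_bound ab (@is_derive_cos R)) => x.
    by rewrite normrN abs_sin_le1.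
  by apply: (lipschitz_of_bound ab (@is_derive_sin R)) => x;
    rewrite abs_cos_le1.
- rewrite iE; apply: le_trans (modulus_le_ReIm _) _.
  rewrite !(Re_add, Im_add, Re_opp, Im_opp, Re_mul, Im_mul) /= !mulr0 subr0
    add0r.
  rewrite -[2]/(1 + 1) mulrDl; apply: lerD.
    apply: (taylor_of_lipschitz _ ab (@is_derive_cos R)) => // x y xy.
    rewrite -opprD normrN; apply: (lipschitz_of_bound xy (@is_derive_sin R)) =>
      z.
    by rewrite abs_cos_le1.
  apply: (taylor_of_lipschitz _ ab (@is_derive_sin R)) => // x y xy.
  apply: (lipschitz_of_bound xy (@is_derive_cos R)) => z.
  by rewrite normrN abs_sin_le1.
Qed.

Lemma lipC1_cst (z : C R) : lipC1 (fun=> z) (fun=> 0).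
Proof.
exists (modulus z) => a b ab; have D0 : 0 <= b - a by rewrite subr_ge0.
rewrite subrr mul0r subrr modulus0; split; rewrite ?modulus_ge0 //.
  by rewrite mulr_ge0 ?modulus_ge0.
by rewrite mulr_ge0 ?modulus_ge0 ?sqr_ge0.
Qed.

Lemma lipC1D g g' h h' : lipC1 g g' -> lipC1 h h' ->
  lipC1 (fun s => g s + h s) (fun s => g' s + h' s).
Proof.
move=> [M hM] [N hN]; exists (M + N) => a b ab.
have [m1 m2 m3 m4] := hM a b ab; have [n1 n2 n3 n4] := hN a b ab.
rewrite ![(M + N) * _]mulrDl; split.
- exact: le_trans (modulusD _ _) (lerD m1 n1).
- exact: le_trans (modulusD _ _) (lerD m2 n2).
- have -> : g b + h b - (g a + h a) = (g b - g a) + (h b - h a) by ring.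
  exact: le_trans (modulusD _ _) (lerD m3 n3).
- have -> : g b + h b - (g a + h a) - (g' a + h' a) * rc (b - a) =
    (g b - g a - g' a * rc (b - a)) + (h b - h a - h' a * rc (b - a)) by ring.
  exact: le_trans (modulusD _ _) (lerD m4 n4).
Qed.

Lemma lipC1M g g' h h' : lipC1 g g' -> lipC1 h h' ->
  lipC1 (fun s => g s * h s) (fun s => g' s * h s + g s * h' s).
Proof.
move=> /lipC1P[M M0 hM] /lipC1P[N N0 hN]; exists (M * N *+ 3) => a b ab.
have [m1 m2 m3 m4] := hM a b ab; have [n1 n2 n3 n4] := hN a b ab.
have [k1 k2 _ _] := hN b b (lexx b).
have D0 : 0 <= b - a by rewrite subr_ge0.
have MN0 : 0 <= M * N by rewrite mulr_ge0.
have le3 (x : R) (n : nat) : 0 <= x -> (n <= 3)%N -> x *+ n <= x *+ 3.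
  by move=> x0 n_le; rewrite ler_wpMn2l.
split.
- apply: le_trans (le3 _ 1%N MN0 isT); rewrite modulusM mulr1n.
  by apply: ler_pM; rewrite ?modulus_ge0.
- apply: le_trans (le3 _ 2%N MN0 isT); apply: le_trans (modulusD _ _) _.
  by rewrite !modulusM mulr2n; apply: lerD; apply: ler_pM; rewrite ?modulus_ge0.
- have -> : g b * h b - g a * h a = (g b - g a) * h b + g a * (h b - h a)
  by ring.
  apply: (@le_trans _ _ (M * N *+ 2 * (b - a))).
    apply: le_trans (modulusD _ _) _; rewrite !modulusM mulr2n mulrDl.
    apply: lerD; first rewrite mulrAC; last rewrite -mulrA;
      by apply: ler_pM; rewrite ?modulus_ge0.
  by apply: ler_wpM2r => //; apply: le3.
- have -> : g b * h b - g a * h a - (g' a * h a + g a * h' a) * rc (b - a) =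
    (g b - g a - g' a * rc (b - a)) * h b + g' a * rc (b - a) * (h b - h a)
    + g a * (h b - h a - h' a * rc (b - a)) by ring.
  have -> : M * N *+ 3 * (b - a) ^+ 2 = M * (b - a) ^+ 2 * N +
     M * (b - a) * (N * (b - a)) + M * (N * (b - a) ^+ 2) by ring.
  apply: le_trans (modulusD _ _) (lerD _ _).
    apply: le_trans (modulusD _ _) (lerD _ _).
      by rewrite modulusM; apply: ler_pM; rewrite ?modulus_ge0.
    rewrite !modulusM; apply: ler_pM; rewrite ?mulr_ge0 ?modulus_ge0 //.
    rewrite modulus_rc ger0_norm //; exact: ler_wpM2r.
  by rewrite modulusM; apply: ler_pM; rewrite ?modulus_ge0.
Qed.

Lemma lipC1V g g' (c : R) : 0 < c -> (forall s, c <= modulus (g s)) ->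
  lipC1 g g' -> lipC1 (fun s => (g s)^-1) (fun s => - g' s / g s ^+ 2).
Proof.
move=> c0 hc /lipC1P[M M0 hM].
have gn0 s : g s != 0 by rewrite -modulus_gt0; apply: lt_le_trans c0 (hc s).
have Vle s : modulus (g s)^-1 <= c^-1.
  by rewrite modulusV lef_pV2 ?posrE // modulus_gt0.
pose N := c^-1 + M * c^-1 ^+ 2 + M * (c^-1 * c^-1) + M * M * (c^-1 ^+ 2 * c^-1).
exists N => a b ab.
have [m1 m2 m3 m4] := hM a b ab.
have D0 : 0 <= b - a by rewrite subr_ge0.
have i0 : 0 <= c^-1 by rewrite invr_ge0 ltW.
have t1 : 0 <= M * c^-1 ^+ 2 by rewrite mulr_ge0 // exprn_ge0.
have t2 : 0 <= M * (c^-1 * c^-1) by rewrite !mulr_ge0.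
have t3 : 0 <= M * M * (c^-1 ^+ 2 * c^-1) by rewrite !mulr_ge0 // exprn_ge0.
split.
- apply: le_trans (Vle a) _; rewrite /N; lra.
- apply: (@le_trans _ _ (M * c^-1 ^+ 2)); last by rewrite /N; lra.
  rewrite modulusM modulusN -exprVn modulusX; apply: ler_pM;
    rewrite ?modulus_ge0 ?exprn_ge0 ?modulus_ge0 //.
  by rewrite lerXn2r ?nnegrE ?modulus_ge0.
- have -> : (g b)^-1 - (g a)^-1 = - (g b - g a) * ((g b)^-1 * (g a)^-1).
    by field; rewrite !gn0.
  apply: (@le_trans _ _ (M * (c^-1 * c^-1) * (b - a))).
    rewrite modulusM modulusN mulrAC; apply: ler_pM; rewrite ?modulus_ge0 //.
    by rewrite modulusM; apply: ler_pM; rewrite ?modulus_ge0.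
  by apply: ler_wpM2r => //; rewrite /N; lra.
- have -> : (g b)^-1 - (g a)^-1 - - g' a / g a ^+ 2 * rc (b - a) =
     - (g b - g a - g' a * rc (b - a)) * ((g a)^-1 * (g b)^-1) +
     g' a * rc (b - a) * ((g b - g a) * ((g a)^-1 ^+ 2 * (g b)^-1)).
    by field; rewrite !gn0.
  apply: (@le_trans _ _ ((M * (c^-1 * c^-1) + M * M * (c^-1 ^+ 2 * c^-1)) *
      (b - a) ^+ 2)); last first.
    by apply: ler_wpM2r; rewrite ?sqr_ge0 // /N; lra.
  rewrite [leRHS]mulrDl; apply: le_trans (modulusD _ _) (lerD _ _).
    rewrite modulusM modulusN mulrAC; apply: ler_pM; rewrite ?modulus_ge0 //.
    by rewrite modulusM; apply: ler_pM; rewrite ?modulus_ge0.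
  have -> : M * M * (c^-1 ^+ 2 * c^-1) * (b - a) ^+ 2 =
     M * (b - a) * (M * (b - a) * (c^-1 ^+ 2 * c^-1)) by ring.
  rewrite !modulusM; apply: ler_pM; rewrite ?mulr_ge0 ?modulus_ge0 //.
    rewrite modulus_rc ger0_norm //; exact: ler_wpM2r.
  apply: ler_pM; rewrite ?mulr_ge0 ?modulus_ge0 //.
  apply: ler_pM; rewrite ?mulr_ge0 ?modulus_ge0 //.
  by rewrite expr2; apply: ler_pM; rewrite ?modulus_ge0.
Qed.

End Exponential.

(** * Quadratic Blaschke products on the circle *)

Lemma Re_conj (R : realType) (z : C R) : complex.Re (z^* : C R) = complex.Re z.
Proof. by case: z. Qed.

Lemma Im_conj (R : realType) (z : C R) : complex.Im (z^* : C R) =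
  - complex.Im z.
Proof. by case: z. Qed.

Lemma modulus_conj (R : realType) (z : C R) : modulus (z^*) = modulus z.
Proof.
apply/eqP; rewrite -(eqrXn2 (n := 2)) ?modulus_ge0 // !modulus_sqr.
by rewrite Re_conj Im_conj sqrrN.
Qed.

Lemma mul_conj (R : realType) (z : C R) : z * z^* = rc (modulus z ^+ 2).
Proof.
rewrite modulus_sqr; apply: complex_ext.
  by rewrite Re_mul Re_conj Im_conj /=; ring.
by rewrite Im_mul Re_conj Im_conj /=; ring.
Qed.

Lemma conj_rc (R : realType) (x : R) : (rc x : C R)^* = rc x.
Proof. by apply: complex_ext; rewrite ?Re_conj ?Im_conj /= ?oppr0. Qed.

Section BlaschkeLift.
Variables (R : realType) (B : C R).
Hypothesis B_lt1 : modulus B < 1.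

Definition den (z : C R) : C R := 1 + B * z.

Lemma den_modulus z : modulus z <= 1 -> 1 - modulus B <= modulus (den z).
Proof.
move=> z1; have := modulus_rev 1 (- (B * z)).
rewrite opprK modulus1 modulusN modulusM.
have : modulus B * modulus z <= modulus B by rewrite ler_piMr ?modulus_ge0.
rewrite /den; lra.
Qed.

Lemma den_gt0 z : modulus z <= 1 -> 0 < modulus (den z).
Proof. by move=> /den_modulus; apply: lt_le_trans; rewrite subr_gt0. Qed.

Lemma den_neq0 z : modulus z <= 1 -> den z != 0.
Proof. by rewrite -modulus_gt0; apply: den_gt0. Qed.

(** The unimodular constant that makes [bmap] fix 1. *)
Definition lead : C R := den 1 / (den 1)^*.

(* The Blaschke product of degree 2 that fixes 0 and 1 and vanishes at
   [- B^*]. *)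
Definition bmap (z : C R) : C R := lead * z * (z + B^*) / den z.

Definition dbmap (z : C R) : C R :=
  lead * (B * z ^+ 2 + 2 * z + B^*) / den z ^+ 2.

Definition xden (s : R) := 1 + (complex.Re B * cos s - complex.Im B * sin s).
Definition yden (s : R) := complex.Re B * sin s + complex.Im B * cos s.

Lemma den_expi s : den (expi s) = Complex (xden s) (yden s).
Proof.
by apply: complex_ext; rewrite ?Re_add ?Im_add ?Re_mul ?Im_mul /= ?add0r.
Qed.

Lemma xden_gt0 s : 0 < xden s.
Proof.
have := Re_le_modulus (B * expi s).
rewrite modulusM modulus_expi mulr1 ler_norml Re_mul /= => /andP[h _].
by move: h B_lt1; rewrite /xden; lra.
Qed.

(** The argument of [den (expi s)]: the real part [xden] is positive, so the arctangent is a branch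
    on the whole line. *)
Definition angle s := atan (yden s / xden s).

(** On the circle [z + conj B = z * conj (den z)], so that [bmap z = lead * z ^ 2 * conj (den z) /
    den z], and [lead] contributes twice the argument of [den 1]. *)
Definition clift s := 2 * s - 2 * (angle s - angle 0).

(** The modulus of the derivative on the circle: 1 for the factor [z], and the Poisson kernel of the
    zero [- conj B] for the other Blaschke factor. *)
Definition speed s := 1 + (1 - modulus B ^+ 2) / modulus (den (expi s)) ^+ 2.

Lemma conj_expi_den s : (den (expi s))^* = 1 + B^* / expi s.
Proof. by rewrite rmorphD rmorphM rmorph1 /= expi_conj. Qed.

Lemma expi_angle s :
  expi (2 * angle s) = den (expi s) / (den (expi s))^* :> C R.
Proof.
set t := yden s / xden s.
have x0 := xden_gt0 s.
have xn0 : xden s != 0 by rewrite gt_eqF.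
have c0 : cos (angle s) != 0.
  rewrite gt_eqF // cos_gt0_pihalf //.
  by have [-> _] := atan_def (yden s / xden s).
have hs : sin (angle s) = t * cos (angle s).
  by rewrite -[t in RHS]atanK /tan divfK.
have e1 : expi (angle s) = rc (cos (angle s) / xden s) * den (expi s).
  rewrite den_expi; apply: complex_ext; rewrite ?Re_mul ?Im_mul /= ?mul0r ?subr0
    ?addr0.
    by rewrite divfK.
  by rewrite hs /t; ring.
have -> : 2 * angle s = angle s + angle s by ring.
rewrite expiD -{2}[expi (angle s)]invrK -expi_conj e1 rmorphM /= conj_rc.
have r0 : rc (cos (angle s) / xden s) != 0 by rewrite rc_eq0 mulf_neq0
  ?invr_eq0.
have d0 : (den (expi s))^* != 0.
  by rewrite conjC_eq0 den_neq0 // modulus_expi.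
by field; rewrite r0 d0.
Qed.

Lemma expi_clift s : expi (clift s) = bmap (expi s).
Proof.
have -> : clift s = s + s - 2 * angle s + 2 * angle 0 by rewrite /clift; ring.
rewrite !expiD expiN !expi_angle expi0 conj_expi_den /bmap /lead.
have := conj_expi_den s; set d := den (expi s) => dE.
have d0 : d != 0 by rewrite den_neq0 // modulus_expi.
have e0 : expi s != 0 :> C R := expi_neq0 s.
have c0 : (den 1)^* != 0 by rewrite conjC_eq0 den_neq0 // modulus1.
have c1 : d^* != 0 by rewrite conjC_eq0.
rewrite dE in c1.
have c2 : expi s + B^* != 0.
  by apply: contra_neq c1 => h; rewrite -(mulfV e0) -mulrDl h mul0r.
by field; rewrite c0 d0 e0 c2.
Qed.

Lemma clift0 : clift 0 = 0.
Proof. by rewrite /clift subrr mulr0 subr0. Qed.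

Lemma angle_periodic s : angle (s + 2 * pi) = angle s.
Proof. by rewrite /angle /xden /yden mulr_natl cosD2pi sinD2pi. Qed.

Lemma clift_periodic s : clift (s + 2 * pi) = clift s + 2 * (2 * pi).
Proof. by rewrite /clift angle_periodic; ring. Qed.

Lemma speed_periodic s : speed (s + 2 * pi) = speed s.
Proof. by rewrite /speed expi2pi. Qed.

Lemma is_derive_xden s : is_derive s (1 : R) xden (- yden s).
Proof.
apply: der_eq (derD (derC s 1) (derD
  (derM (derC s (complex.Re B)) (is_derive_cos s))
  (derN (derM (derC s (complex.Im B)) (is_derive_sin s))))) _ _ => //.
by rewrite /yden; ring.
Qed.

Lemma is_derive_yden s : is_derive s (1 : R) yden (xden s - 1).
Proof.
apply: der_eq (derD (derM (derC s (complex.Re B)) (is_derive_sin s))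
  (derM (derC s (complex.Im B)) (is_derive_cos s))) _ _ => //.
by rewrite /xden; ring.
Qed.

Lemma is_derive_clift s : is_derive s (1 : R) clift (speed s).
Proof.
have dx := is_derive_xden s; have dy := is_derive_yden s.
have x0 : xden s != 0 by rewrite gt_eqF // xden_gt0.
have n0 : xden s ^+ 2 + yden s ^+ 2 != 0.
  by rewrite gt_eqF // ltr_pwDl ?sqr_ge0 // exprn_gt0 // xden_gt0.
have Bsq : modulus B ^+ 2 = (xden s - 1) ^+ 2 + yden s ^+ 2.
  have -> : modulus B = modulus (B * expi s) by rewrite modulusM modulus_expi
    mulr1.
  rewrite modulus_sqr.
  rewrite Re_mul Im_mul /= /xden /yden; ring.
have da := der_comp (g := fun s => yden s / xden s)
  (is_derive1_atan (yden s / xden s)) (derM dy (derV x0 dx)).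
apply: der_eq (derD (derM (derC s 2) (derI s)) (derN (derM (derC s 2)
  (derD da (derN (derC s (angle 0))))))) _ _ => //.
rewrite /speed Bsq den_expi modulus_sqr /=.
by field; rewrite x0 n0.
Qed.

Lemma modulus_den_le s : modulus (den (expi s)) <= 1 + modulus B.
Proof.
by apply: le_trans (modulusD _ _) _; rewrite modulus1 modulusM modulus_expi
  mulr1.
Qed.

Lemma modulus_den_ge s : 1 - modulus B <= modulus (den (expi s)).
Proof. by apply: den_modulus; rewrite modulus_expi. Qed.

Lemma speed_ge s : 2 / (1 + modulus B) <= speed s.
Proof.
have b0 := modulus_ge0 B; have b1 := B_lt1.
have d0 : 0 < modulus (den (expi s)) by apply: den_gt0; rewrite modulus_expi.
have -> : 2 / (1 + modulus B) =
    1 + (1 - modulus B ^+ 2) / (1 + modulus B) ^+ 2.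
  by field; rewrite gt_eqF //; lra.
rewrite lerD2l ler_wpM2l //; first by rewrite subr_ge0 expr_le1 // ltW.
rewrite lef_pV2 ?posrE ?exprn_gt0 //; last by lra.
by rewrite lerXn2r ?nnegrE ?modulus_den_le // ?(ltW d0) //; lra.
Qed.

Lemma speed_le s : speed s <= 2 / (1 - modulus B).
Proof.
have b0 := modulus_ge0 B; have b1 := B_lt1.
have d0 : 0 < modulus (den (expi s)) by apply: den_gt0; rewrite modulus_expi.
have -> : 2 / (1 - modulus B) =
    1 + (1 - modulus B ^+ 2) / (1 - modulus B) ^+ 2.
  by field; rewrite gt_eqF //; lra.
rewrite lerD2l ler_wpM2l //; first by rewrite subr_ge0 expr_le1 // ltW.
rewrite lef_pV2 ?posrE ?exprn_gt0 //; last by lra.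
by rewrite lerXn2r ?nnegrE ?modulus_den_ge // ?(ltW d0) //; lra.
Qed.

Lemma speed_gt1 s : 1 < speed s.
Proof.
apply: lt_le_trans (speed_ge s).
have b0 := modulus_ge0 B; have b1 := B_lt1.
by rewrite ltr_pdivlMr; lra.
Qed.

Lemma clift_expand a b : a <= b -> 2 / (1 + modulus B) * (b - a) <=
  clift b - clift a.
Proof.
move=> ab; have [c [_ _ ->]] := mean_value ab is_derive_clift.
by rewrite ler_wpM2r ?subr_ge0 ?speed_ge.
Qed.

Lemma clift_contract a b : a <= b -> clift b - clift a <=
  2 / (1 - modulus B) * (b - a).
Proof.
move=> ab; have [c [_ _ ->]] := mean_value ab is_derive_clift.
by rewrite ler_wpM2r ?subr_ge0 ?speed_le.
Qed.

Lemma clift_ge a b : a <= b -> b - a <= clift b - clift a.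
Proof.
move=> ab; have [c [_ _ ->]] := mean_value ab is_derive_clift.
by rewrite ler_peMl ?subr_ge0 // ltW // speed_gt1.
Qed.

Lemma clift_mono : {mono clift : x y / x < y}.
Proof.
have le x y : x <= y -> clift x <= clift y.
  by move=> xy; have := clift_ge xy; rewrite -subr_ge0 in xy; lra.
move=> x y; apply/idP/idP => [|xy].
  by apply: contraTT; rewrite -!leNgt; apply: le.
by have := clift_ge (ltW xy); rewrite -subr_gt0 in xy; lra.
Qed.

Lemma clift_inj : injective clift.
Proof.
move=> x y e; apply/eqP; rewrite eq_le !leNgt.
by rewrite -(clift_mono x y) -(clift_mono y x) e ltxx.
Qed.

Lemma clift_surj y : exists x, clift x = y.
Proof.
have cl : continuous clift := is_derive_continuous is_derive_clift.
have h : - `|y| <= `|y| by rewrite -subr_ge0 opprK addr_ge0.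
have p1 := clift_ge (normr_ge0 y).
have m1 : - `|y| <= 0 by rewrite oppr_le0.
have p2 := clift_ge m1.
have y1 := ler_norm y; have y2 := lerNnormlW (lexx `|y|).
rewrite clift0 in p1 p2.
have [||x _ hx] := @IVT R clift (- `|y|) `|y| y h.
- exact: continuous_subspaceT.
- by rewrite ge_min le_max; apply/andP; split; apply/orP; [left|right]; lra.
by exists x.
Qed.

Definition clift_inv y := projT1 (cid (clift_surj y)).

Lemma clift_invK : cancel clift_inv clift.
Proof. by move=> y; rewrite /clift_inv; case: cid. Qed.

Lemma cliftK : cancel clift clift_inv.
Proof. by move=> x; apply: clift_inj; rewrite clift_invK. Qed.

Lemma clift_inv_mono : {mono clift_inv : x y / x < y}.
Proof. by move=> x y; rewrite -clift_mono !clift_invK. Qed.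

Lemma clift_inv0 : clift_inv 0 = 0.
Proof. by rewrite -{1}clift0 cliftK. Qed.

Lemma clift_inv_periodic x : clift_inv (x + 2 * (2 * pi)) =
  clift_inv x + 2 * pi.
Proof. by apply: clift_inj; rewrite clift_invK clift_periodic clift_invK. Qed.

Lemma rc_speed s : rc (speed s) =
  1 + expi s * (1 - B * B^*) / (den (expi s) * (expi s + B^*)).
Proof.
have d0 : den (expi s) != 0 by rewrite den_neq0 // modulus_expi.
have e0 : expi s != 0 :> C R := expi_neq0 s.
have c0 : (den (expi s))^* != 0 by rewrite conjC_eq0.
rewrite /speed rcD rcM rcV rcB !expr2 -expr2 -!mul_conj.
rewrite conj_expi_den in c0 *.
have c2 : expi s + B^* != 0.
  by apply: contra_neq c0 => h; rewrite -(mulfV e0) -mulrDl h mul0r.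
have -> : rc 1 = 1 :> C R by [].
by field; rewrite d0 e0 c2.
Qed.

Lemma expi_addBc_ge s : 1 - modulus B <= modulus (expi s + B^*).
Proof.
have := modulus_rev (expi s) (- B^*); rewrite modulusN modulus_conj opprK.
by rewrite modulus_expi.
Qed.

Lemma expi_addBc_neq0 s : expi s + B^* != 0.
Proof.
by rewrite -modulus_gt0; apply: lt_le_trans (expi_addBc_ge s); rewrite subr_gt0.
Qed.

(** After clearing denominators the difference of the two values is divisible by the difference of
    the two points; this is the quotient. *)
Lemma preimage_relation s t : bmap (expi s) = bmap (expi t) ->
  expi s != expi t :> C R ->
  expi s + expi t + B^* + B * expi s * expi t = 0.
Proof.
move=> e ne.
have d1 : den (expi s) != 0 by rewrite den_neq0 // modulus_expi.
have d2 : den (expi t) != 0 by rewrite den_neq0 // modulus_expi.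
have l0 : lead != 0.
  by rewrite mulf_neq0 ?invr_eq0 ?conjC_eq0 ?den_neq0 ?modulus1.
have h : lead * ((expi s - expi t) *
   (expi s + expi t + B^* + B * expi s * expi t)) = 0.
  have -> : lead * ((expi s - expi t) *
   (expi s + expi t + B^* + B * expi s * expi t)) =
   (bmap (expi s) - bmap (expi t)) * (den (expi s) * den (expi t)).
    by rewrite /bmap; move: d1 d2; rewrite /den => d1 d2; field; rewrite d1 d2.
  by rewrite e subrr mul0r.
have st : expi s - expi t != 0 :> C R by rewrite subr_eq0.
by apply: (mulfI st); apply: (mulfI l0); rewrite h !mulr0.
Qed.

(** The infinitesimal form of the invariance of length: the transfer operator fixes the constant
    1. *)
Lemma inv_speed_sum s t : bmap (expi s) = bmap (expi t) ->
  expi s != expi t :> C R -> (speed s)^-1 + (speed t)^-1 = 1.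
Proof.
move=> e ne; have rel := preimage_relation e ne.
(* Expressed by both preimages, the inverse speed has a denominator antisymmetric in them, and the
   two numerators differ by that same denominator. *)
have inv z w : expi z + expi w + B^* + B * expi z * expi w = 0 ->
    expi z != expi w :> C R ->
    rc (speed z)^-1 = (expi z + B^*) / (expi z - expi w).
  move=> r n.
  have dz : den (expi z) != 0 by rewrite den_neq0 // modulus_expi.
  have cz := expi_addBc_neq0 z.
  have zw : expi z - expi w != 0 :> C R by rewrite subr_eq0.
  rewrite rcV rc_speed; apply: (canLR (@invrK _)).
  have -> : ((expi z + B^*) / (expi z - expi w))^-1 =
     (expi z - expi w) / (expi z + B^*) by rewrite invfM invrK mulrC.
  apply: (mulIf dz); apply: (mulIf cz).
  have -> : (1 + expi z * (1 - B * B^*) / (den (expi z) * (expi z + B^*))) *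
     den (expi z) * (expi z + B^*) =
     expi z * den (expi z) + (expi z + B^*).
    by move: dz; rewrite /den => dz; field; rewrite dz cz.
  rewrite [RHS]mulrAC divfK //.
  have -> : expi z + B^* = - (expi w * den (expi z)).
    apply/eqP; rewrite -subr_eq0 opprK; apply/eqP; rewrite -[RHS]r /den; ring.
  ring.
have ne' : expi t != expi s :> C R by rewrite eq_sym.
have rel' : expi t + expi s + B^* + B * expi t * expi s = 0.
  by rewrite -rel; ring.
have st : expi s - expi t != 0 :> C R by rewrite subr_eq0.
have ts : expi t - expi s != 0 :> C R by rewrite subr_eq0.
suff [] : rc ((speed s)^-1 + (speed t)^-1) = rc 1 by [].
rewrite rcD (inv _ _ rel ne) (inv _ _ rel' ne').
have -> : rc 1 = 1 :> C R by [].
by field; rewrite st ts.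
Qed.

Lemma is_derive_clift_inv y : is_derive y (1 : R) clift_inv
  (speed (clift_inv y))^-1.
Proof.
have can : {near clift_inv y, cancel clift clift_inv} by near=> x;
  exact: cliftK.
have cont : {near clift_inv y, continuous clift}.
  by near=> x; exact: (is_derive_continuous is_derive_clift).
have n0 : speed (clift_inv y) !=
  0 by rewrite gt_eqF // (lt_trans _ (speed_gt1 _)).
have := is_derive_inverse can cont (is_derive_clift (clift_inv y)) n0.
by rewrite clift_invK.
Unshelve. all: by end_near. Qed.

(** The derivative of [F] is the sum of the inverse speeds at two preimages, minus 1. The preimages
    are distinct on the circle because their lifts differ by more than 0 and less than a full
    turn. *)
Lemma clift_inv_preimages x y :
  clift_inv y - clift_inv x + (clift_inv (y + 2 * pi) - clift_inv (x + 2 * pi))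
    = y - x.
Proof.
pose F z := clift_inv z + clift_inv (z + 2 * pi) - z.
have dF z : is_derive z (1 : R) F 0.
  have d2 := der_comp (g := fun z => z + 2 * pi)
    (is_derive_clift_inv (z + 2 * pi)) (derD (derI z) (derC z (2 * pi))).
  apply: der_eq (derD (derD (is_derive_clift_inv z) d2) (derN (derI z))) _ _ =>
    //.
  rewrite addr0 mulr1 inv_speed_sum ?subrr //.
    by rewrite -!expi_clift !clift_invK expi2pi.
  have p0 : 0 < pi :> R by exact: pi_gt0.
  have l1 : clift_inv z < clift_inv (z + 2 * pi) by rewrite clift_inv_mono ltrDl
    mulr_gt0.
  have l2 : clift_inv (z + 2 * pi) < clift_inv z + 2 * pi.
    rewrite -clift_inv_periodic clift_inv_mono; lra.
  have := @expi_eq1 R (clift_inv (z + 2 * pi) - clift_inv z).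
  rewrite subr_gt0 ltrBlDr [2 * pi + _]addrC expiD expiN => /(_ l1 l2).
  by apply: contra_neq => ->; rewrite mulfV ?expi_neq0.
have := is_derive_0_is_cst y x dF; rewrite /F; lra.
Qed.

End BlaschkeLift.

(** * Boundary values of the variation field *)

Section BoundaryValues.
Variables (R : realType) (B K : C R).
Hypothesis B_lt1 : modulus B < 1.
Hypothesis K_neq0 : K != 0.

Local Notation denB := (den B).
Local Notation bmapB := (bmap B).
Local Notation leadB := (lead B).
Local Notation speedB := (speed B).

(** The double zero at 0 reflects the constant fixed point and multiplier there, the zero at 1 the
    constant fixed point 1. *)
Definition forcing (z : C R) : C R := K * z ^+ 2 * (1 - z) / denB z ^+ 2.

(** Dividing the functional equation at [z] by [bmap z] gives the equation of [eta / z], in which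
    [dbmap z * z / bmap z] is the real number [speed]. *)
Definition forcing_circle (s : R) : C R := forcing (expi s) / bmapB (expi s).

Lemma lead_neq0 : leadB != 0.
Proof. by rewrite mulf_neq0 ?invr_eq0 ?conjC_eq0 ?den_neq0 ?modulus1. Qed.

Lemma modulus_lead : modulus leadB = 1.
Proof.
rewrite /lead modulusM modulusV modulus_conj mulfV //.
by rewrite modulus_eq0 den_neq0 // modulus1.
Qed.

Lemma lipC1_den_inv : exists g', lipC1 (fun s => (denB (expi s))^-1) g'.
Proof.
have h := lipC1D (lipC1_cst 1) (lipC1M (lipC1_cst B) (@lipC1_expi R)).
have c0 : 0 < 1 - modulus B by rewrite subr_gt0.
eexists; exact: (lipC1V (g := fun s => denB (expi s)) c0 (@modulus_den_ge R B)
  h).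
Qed.

Lemma lipC1_addBc_inv : exists g', lipC1 (fun s => (expi s + B^*)^-1) g'.
Proof.
have h := lipC1D (@lipC1_expi R) (lipC1_cst (B^*)).
have c0 : 0 < 1 - modulus B by rewrite subr_gt0.
eexists; exact: (lipC1V (g := fun s => expi s + B^*) c0 (@expi_addBc_ge R B) h).
Qed.

Lemma lipC1_speed : exists g', lipC1 (fun s => rc (speedB s)) g'.
Proof.
have [g1 n1] := lipC1_den_inv; have [g2 n2] := lipC1_addBc_inv.
have h := lipC1D (lipC1_cst 1)
  (lipC1M (lipC1M (@lipC1_expi R) (lipC1_cst (1 - B * B^*))) (lipC1M n1 n2)).
eexists; apply: lipC1_eq h _ _ => [s|s]; last by [].
by rewrite (rc_speed B_lt1) invfM.
Qed.

(** The factor [1 - z] is split off: as it vanishes at [z = 1], the derivative there is its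
    derivative times the nonzero cofactor. *)
Lemma lipC1_forcing :
  exists2 g', lipC1 forcing_circle g' & g' 0 != 0.
Proof.
have [g1 n1] := lipC1_den_inv; have [g2 n2] := lipC1_addBc_inv.
have h1 := lipC1M (lipC1M (lipC1_cst (K / leadB)) (@lipC1_expi R))
  (lipC1M n1 n2).
have h2 := lipC1D (lipC1_cst 1) (lipC1M (lipC1_cst (-1)) (@lipC1_expi R)).
have h := lipC1M h2 h1.
eexists; first (apply: lipC1_eq h _ _ => [s|s]; last by []).
  have d0 : denB (expi s) != 0 by rewrite den_neq0 // modulus_expi.
  have a0 := expi_addBc_neq0 B_lt1 s; have e0 := @expi_neq0 R s.
  have l0 := lead_neq0.
  rewrite /= /forcing_circle /forcing /bmap; field.
  by rewrite d0 a0 e0 l0.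
rewrite /= expi0 !mul0r !mulr1 !mulN1r !add0r subrr mul0r addr0.
have i0 : iunit R != 0.
  by apply/eqP => /(congr1 (@complex.Im R)) /= /eqP; rewrite oner_eq0.
have := expi_addBc_neq0 B_lt1 0; rewrite expi0 => a0.
rewrite !mulf_neq0 ?invr_eq0 ?oppr_eq0 ?lead_neq0 //.
by rewrite den_neq0 // modulus1.
Qed.

(** The inverse of the lower bound of [speed]. *)
Definition contraction := (1 + modulus B) / 2.

Local Notation lam := contraction.

Lemma contraction_gt0 : 0 < lam.
Proof. by have := modulus_ge0 B; rewrite /contraction; lra. Qed.

Lemma contraction_lt1 : lam < 1.
Proof. by have := B_lt1; rewrite /contraction; lra. Qed.

Lemma speed_expand s : 1 <= lam * speedB s.
Proof.
rewrite mulrC -ler_pdivrMr ?contraction_gt0 //.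
apply: le_trans (speed_ge B_lt1 s); rewrite /contraction invf_div.
by rewrite mul1r.
Qed.

Lemma clift_expand_contraction a b : a < b ->
  b - a <= lam * (clift B b - clift B a).
Proof.
move=> ab; have := clift_expand B_lt1 (ltW ab).
rewrite -ler_pdivlMl; last by rewrite divr_gt0 //; have := modulus_ge0 B; lra.
by rewrite invf_div.
Qed.

Local Notation psi := (clift_inv B_lt1).

Lemma forcing_circle_periodic s :
  forcing_circle (s + 2 * pi) = forcing_circle s.
Proof. by rewrite /forcing_circle expi2pi. Qed.

Lemma forcing_circle0 : forcing_circle 0 = 0.
Proof. by rewrite /forcing_circle /forcing expi0 subrr mulr0 !mul0r. Qed.

Lemma speed_taylor : exists P1 : R -> R, exists2 M : R, 0 <= M &
  forall a b, a <= b -> [/\ `|P1 a| <= M, `|speedB b - speedB a| <=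
    M * (b - a) &
     `|speedB b - speedB a - P1 a * (b - a)| <= M * (b - a) ^+ 2].
Proof.
have [g' /lipC1P[M M0 hM]] := lipC1_speed.
exists (fun s => complex.Re (g' s)), M => // a b ab.
have [_ h1 h2 h3] := hM a b ab.
split; first exact: le_trans (Re_le_modulus _) h1.
  by apply: le_trans h2; rewrite -rcB modulus_rc.
apply: le_trans h3; apply: le_trans (Re_le_modulus _).
by rewrite !(Re_add, Re_opp, Re_mul) /= mulr0 subr0.
Qed.

Definition cnode := node psi.
Definition cbval := bval psi speedB forcing_circle.

Lemma boundary_energy_growth : exists2 c : R, 0 < c &
  exists m, forall d, c * d%:R <= energy cnode cbval (m + d).
Proof.
have [P1 [M1 M10 hP]] := speed_taylor.
have [V1 /lipC1P[M2 M20 hV] V10] := lipC1_forcing.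
pose M := M1 + M2; have M0 : 0 <= M by rewrite addr_ge0.
have le1 : M1 <= M by rewrite lerDl.
have le2 : M2 <= M by rewrite lerDr.
have up1 (x y : R) : 0 <= y -> x <= M1 * y -> x <= M * y.
  by move=> y0 /le_trans; apply; apply: ler_wpM2r.
have up2 (x y : R) : 0 <= y -> x <= M2 * y -> x <= M * y.
  by move=> y0 /le_trans; apply; apply: ler_wpM2r.
have l1 := contraction_lt1.
apply: (@energy_growth R (clift B) psi speedB P1 forcing_circle V1 lam M _ _ _ _
   _ _ _ _ _ _ _ _ _ _ _ _ _ _ _ _ _ ((1 + lam) / 2)) => //.
- exact: clift_invK.
- exact: clift_inv_mono.
- exact: clift_inv0.
- exact: clift_inv_periodic.
- exact: clift_inv_preimages.
- exact: speed_periodic.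
- exact: forcing_circle_periodic.
- exact: forcing_circle0.
- exact: contraction_gt0.
- exact: speed_expand.
- exact: clift_expand_contraction.
- move=> a b ab; apply: (taylor_of_lipschitz M0 (ltW ab)
  (is_derive_clift B_lt1)).
  move=> x y xy; apply: up1; first by rewrite subr_ge0.
  by have [_ ? _] := hP x y xy.
- by move=> a b /ltW ab; apply: up1; rewrite ?sqr_ge0 //; have [] := hP a b ab.
- move=> a b /ltW ab; apply: up1; first by rewrite subr_ge0.
  by have [] := hP a b ab.
- by move=> a; apply: le_trans le1; have [] := hP a a (lexx _).
- by move=> a b /ltW ab; apply: up2; rewrite ?sqr_ge0 //; have [] := hV a b ab.
- move=> a b /ltW ab; apply: up2; first by rewrite subr_ge0.
  by have [] := hV a b ab.
- by move=> a; apply: le_trans le2; have [] := hV a a (lexx _).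
- by move=> a; apply: le_trans le2; have [] := hV a a (lexx _).
- by lra.
- by lra.
Qed.

Lemma cbval_bounded : exists M : R, forall n k, modulus (cbval n k) <= M.
Proof.
have [V1 /lipC1P[M M0 hV] _] := lipC1_forcing.
exists (M / (1 - lam)) => n k.
apply: (@bval_bound R psi speedB forcing_circle lam M) => //.
- exact: contraction_gt0.
- exact: contraction_lt1.
- exact: speed_expand.
- by move=> a; have [] := hV a a (lexx _).
Qed.

Lemma cnode_lt n k : cnode n k < cnode n k.+1.
Proof. by apply: node_lt; apply: clift_inv_mono. Qed.

Lemma cnode0 n : cnode n 0 = 0.
Proof. by apply: node0; apply: clift_inv0. Qed.

Lemma cnode_last n : cnode n (2 ^ n) = 2 * pi.
Proof.
rewrite -[(2 ^ n)%N]add0n /cnode node_periodic ?node0 ?add0r //.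
- exact: clift_inv0.
- exact: clift_inv_periodic.
Qed.

(** The ratio is the inverse of the upper bound of [speed]. The bound serves where errors are
    divided by arc lengths. *)
Lemma arc_lower_bound n k :
  2 * pi * ((1 - modulus B) / 2) ^+ n <= arc_len cnode n k.
Proof.
elim: n => [|n IH].
  by rewrite expr0 mulr1 /arc_len /cnode /node /= -natr1 le_eqVlt;
    apply/orP; left; apply/eqP; ring.
have b1 : 0 < 1 - modulus B by rewrite subr_gt0.
have := clift_contract B_lt1 (ltW (cnode_lt n.+1 k)).
rewrite -ler_pdivrMl; last by rewrite divr_gt0.
rewrite invf_div !clift_invK => /(le_trans _); apply.
rewrite exprS mulrCA; apply: ler_wpM2l IH.
by rewrite divr_ge0 // ltW.
Qed.

Lemma expi_cnode n k : bmapB (expi (cnode n.+1 k)) = expi (cnode n k).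
Proof. by rewrite -expi_clift // /cnode /= clift_invK. Qed.

Lemma expi_cnode0 k : expi (cnode 0 k) = 1 :> C R.
Proof.
elim: k => [|k IH]; first by rewrite cnode0 expi0.
have -> : cnode 0 k.+1 = cnode 0 k + 2 * pi.
  by rewrite /cnode /node /= -[k.+1%:R]natr1; ring.
by rewrite expi2pi.
Qed.

Lemma dbmap_expi s : bmapB (expi s) * rc (speedB s) = dbmap B (expi s) * expi s.
Proof.
have d0 : denB (expi s) != 0 by rewrite den_neq0 // modulus_expi.
have a0 := expi_addBc_neq0 B_lt1 s.
rewrite (rc_speed B_lt1) /bmap /dbmap; move: d0; rewrite /den => d0.
by field; rewrite d0 a0.
Qed.

(** Undoing the rotation turns [cbval] into the boundary values of [eta] itself. *)
Definition ctheta n k := expi (cnode n k) * cbval n k.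

Lemma ctheta_eq n k :
  ctheta n k = forcing (expi (cnode n.+1 k)) +
    dbmap B (expi (cnode n.+1 k)) * ctheta n.+1 k.
Proof.
have -> : ctheta n k = bmapB (expi (cnode n.+1 k)) *
    (forcing_circle (cnode n.+1 k) + rc (speedB (cnode n.+1 k)) * cbval n.+1 k).
  rewrite expi_cnode /ctheta; congr (_ * _).
  exact: (bval_eq psi forcing_circle contraction_gt0 speed_expand).
have b0 : bmapB (expi (cnode n.+1 k)) != 0 by rewrite expi_cnode expi_neq0.
rewrite mulrDr mulrA dbmap_expi /ctheta mulrA; congr (_ + _).
by rewrite /forcing_circle mulrC divfK.
Qed.

Lemma ctheta0 k : ctheta 0 k = 0.
Proof. by rewrite /ctheta mulr0. Qed.

End BoundaryValues.

(** * Growth of solutions near the circle *)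

Section DiskLipschitz.
Variable R : realType.

Definition disk_lip (g : C R -> C R) := exists2 M : R, 0 <= M &
  forall z w, modulus z <= 1 -> modulus w <= 1 ->
  modulus (g z) <= M /\ modulus (g z - g w) <= M * modulus (z - w).

Lemma disk_lip_cst (c : C R) : disk_lip (fun=> c).
Proof.
exists (modulus c); first exact: modulus_ge0.
by move=> z w _ _; rewrite subrr modulus0 mulr_ge0 ?modulus_ge0.
Qed.

Lemma disk_lip_id : disk_lip id.
Proof. by exists 1 => // z w hz _; rewrite mul1r. Qed.

Lemma disk_lipD g h : disk_lip g -> disk_lip h ->
  disk_lip (fun z => g z + h z).
Proof.
move=> [M M0 hM] [N N0 hN]; exists (M + N); first exact: addr_ge0.
move=> z w hz hw; have [m1 m2] := hM z w hz hw; have [n1 n2] := hN z w hz hw.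
split; first exact: le_trans (modulusD _ _) (lerD m1 n1).
have -> : g z + h z - (g w + h w) = (g z - g w) + (h z - h w) by ring.
by rewrite mulrDl; exact: le_trans (modulusD _ _) (lerD m2 n2).
Qed.

Lemma disk_lipM g h : disk_lip g -> disk_lip h ->
  disk_lip (fun z => g z * h z).
Proof.
move=> [M M0 hM] [N N0 hN]; exists (M * N *+ 2);
  first by rewrite mulrn_wge0 ?mulr_ge0.
move=> z w hz hw; have [m1 m2] := hM z w hz hw; have [n1 n2] := hN z w hz hw.
have [k1 _] := hM w w hw hw.
split.
  rewrite modulusM mulr2n; apply: (@le_trans _ _ (M * N)).
    by apply: ler_pM; rewrite ?modulus_ge0.
  by rewrite lerDl mulr_ge0.
have -> : g z * h z - g w * h w = (g z - g w) * h z + g w * (h z - h w) by ring.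
rewrite mulr2n [leRHS]mulrDl; apply: le_trans (modulusD _ _) (lerD _ _).
  by rewrite modulusM mulrAC; apply: ler_pM; rewrite ?modulus_ge0.
by rewrite modulusM -mulrA; apply: ler_pM; rewrite ?modulus_ge0.
Qed.

Lemma disk_lipV g (c : R) : 0 < c ->
  (forall z, modulus z <= 1 -> c <= modulus (g z)) ->
  disk_lip g -> disk_lip (fun z => (g z)^-1).
Proof.
move=> c0 hc [M M0 hM].
have gn0 z : modulus z <= 1 -> g z != 0.
  by move=> /hc hz; rewrite -modulus_gt0; apply: lt_le_trans c0 hz.
have Vle z : modulus z <= 1 -> modulus (g z)^-1 <= c^-1.
  move=> hz; rewrite modulusV lef_pV2 ?posrE ?hc // modulus_gt0; exact: gn0.
have i0 : 0 <= c^-1 by rewrite invr_ge0 ltW.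
exists (c^-1 + M * (c^-1 * c^-1)); first by rewrite addr_ge0 // !mulr_ge0.
move=> z w hz hw; split.
  by apply: le_trans (Vle z hz) _; rewrite lerDl !mulr_ge0.
have -> : (g z)^-1 - (g w)^-1 = - (g z - g w) * ((g z)^-1 * (g w)^-1).
  by field; rewrite !gn0.
apply: (@le_trans _ _ (M * (c^-1 * c^-1) * modulus (z - w))); last first.
  by apply: ler_wpM2r; rewrite ?modulus_ge0 // lerDr.
have [_ h2] := hM z w hz hw.
rewrite modulusM modulusN mulrAC; apply: ler_pM; rewrite ?modulus_ge0 //.
by rewrite modulusM; apply: ler_pM; rewrite ?modulus_ge0 ?Vle.
Qed.

Lemma disk_lip_eq g h : disk_lip g -> g =1 h -> disk_lip h.
Proof. by move=> hg /funext <-. Qed.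

Lemma polar (z : C R) : modulus z = 1 -> exists s, z = expi s.
Proof.
move=> hz; have := modulus_sqr z; rewrite hz expr1n => e.
have hx : -1 <= complex.Re z <= 1.
  by rewrite -ler_norml -hz Re_le_modulus.
have hs : sin (acos (complex.Re z)) = `|complex.Im z|.
  rewrite sin_acos // -sqrtr_sqr; congr Num.sqrt; lra.
have hc : cos (acos (complex.Re z)) = complex.Re z by rewrite acosK // in_itv.
have [y0|y0] := leP 0 (complex.Im z).
  exists (acos (complex.Re z)); apply: complex_ext => /=; first by rewrite hc.
  by rewrite hs ger0_norm.
exists (- acos (complex.Re z)); apply: complex_ext => /=.
  by rewrite cosN hc.
by rewrite sinN hs ltr0_norm ?opprK.
Qed.

Lemma le_of_geometric (x M N lam : R) : 0 <= lam -> lam < 1 ->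
  (forall n, x <= M + N * lam ^+ n) -> x <= M.
Proof.
move=> l0 l1 h.
have : (fun n => M + N * lam ^+ n) @ \oo --> (M + N * 0 : R).
  apply: cvgD; first exact: cvg_cst.
  by apply: cvgMr; apply: cvg_expr; rewrite ger0_norm.
rewrite mulr0 addr0 => cv.
by apply: (cvgr_to_ge cv); exact: nearW.
Qed.

End DiskLipschitz.

(** * The functional equation in the disk and its comparison with the boundary values *)

Section DiskEquation.
Variables (R : realType) (B K : C R).
Hypothesis B_lt1 : modulus B < 1.

Local Notation denB := (den B).
Local Notation bmapB := (bmap B).
Local Notation dbmapB := (dbmap B).
Local Notation forcingBK := (forcing B K).

Lemma disk_lip_den_inv : disk_lip (fun z => (denB z)^-1).
Proof.
apply: (@disk_lipV _ denB (1 - modulus B)); first by rewrite subr_gt0.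
  by move=> z; exact: den_modulus.
exact: disk_lipD (disk_lip_cst 1) (disk_lipM (disk_lip_cst B) (@disk_lip_id R)).
Qed.

Lemma disk_lip_bmap : disk_lip bmapB.
Proof.
have h := disk_lipM (disk_lipM (disk_lipM (disk_lip_cst (lead B))
  (@disk_lip_id R))
  (disk_lipD (@disk_lip_id R) (disk_lip_cst (B^*)))) disk_lip_den_inv.
exact: h.
Qed.

Lemma disk_lip_dbmap : disk_lip dbmapB.
Proof.
have h := disk_lipM (disk_lipM (disk_lip_cst (lead B)) (disk_lipD (disk_lipD
  (disk_lipM (disk_lip_cst B) (disk_lipM (@disk_lip_id R) (@disk_lip_id R)))
  (disk_lipM (disk_lip_cst 2) (@disk_lip_id R))) (disk_lip_cst (B^*))))
  (disk_lipM disk_lip_den_inv disk_lip_den_inv).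
by apply: disk_lip_eq h _ => z; rewrite /dbmap expr2 -exprVn expr2.
Qed.

Lemma disk_lip_forcing : disk_lip forcingBK.
Proof.
have h := disk_lipM (disk_lipM (disk_lipM (disk_lip_cst K)
  (disk_lipM (@disk_lip_id R) (@disk_lip_id R)))
  (disk_lipD (disk_lip_cst 1) (disk_lipM (disk_lip_cst (-1)) (@disk_lip_id R))))
  (disk_lipM disk_lip_den_inv disk_lip_den_inv).
by apply: disk_lip_eq h _ => z; rewrite /forcing mulN1r expr2 -exprVn expr2.
Qed.

(** The Schwarz lemma, here from [|den z|^2 - |z + conj B|^2 = (1 - |B|^2) (1 - |z|^2)]. *)
Lemma modulus_bmap_le z : modulus z <= 1 -> modulus (bmapB z) <= modulus z.
Proof.
move=> z1.
have -> : modulus (bmapB z) =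
  modulus z * (modulus (z + B^*) / modulus (denB z)).
  rewrite /bmap modulusM modulusV (modulusM (lead B * z)) (modulusM (lead B)).
  by rewrite (modulus_lead B_lt1) mul1r mulrA.
rewrite ler_piMr ?modulus_ge0 // ler_pdivrMr ?den_gt0 // mul1r.
rewrite -(ler_pXn2r (n := 2)) ?nnegrE ?modulus_ge0 // /den !modulus_sqr.
rewrite !(Re_add, Im_add, Re_mul, Im_mul) Re_conj Im_conj /=.
have hB : complex.Re B ^+ 2 + complex.Im B ^+ 2 <= 1.
  by rewrite -modulus_sqr expr_le1 ?modulus_ge0 // ltW.
have hz : complex.Re z ^+ 2 + complex.Im z ^+ 2 <= 1.
  by rewrite -modulus_sqr expr_le1 ?modulus_ge0.
have := mulr_ge0 (_ : 0 <= 1 - (complex.Re B ^+ 2 + complex.Im B ^+ 2))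
  (_ : 0 <= 1 - (complex.Re z ^+ 2 + complex.Im z ^+ 2)).
rewrite !subr_ge0 => /(_ hB hz); lra.
Qed.

Lemma modulus_dbmap_expi s : modulus (dbmapB (expi s)) = speed B s.
Proof.
have := dbmap_expi B_lt1 s => /(congr1 (@modulus R)).
rewrite (modulusM (bmapB _)) (modulusM (dbmapB _)) -expi_clift // !modulus_expi
  mulr1 mul1r.
by rewrite modulus_rc ger0_norm // ltW // (lt_trans _ (speed_gt1 B_lt1 _)).
Qed.

(* [dl] is the width of a neighborhood of the circle where [bmapB] expands. *)
Lemma disk_constants : exists L lam dl : R,
  [/\ 1 <= L, 0 < lam < 1, 0 < dl <= 1,
   forall z w, modulus z <= 1 -> modulus w <= 1 ->
    [/\ modulus (forcingBK z) <= L,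
        modulus (forcingBK z - forcingBK w) <= L * modulus (z - w),
        modulus (bmapB z - bmapB w) <= L * modulus (z - w) &
        modulus (dbmapB z - dbmapB w) <= L * modulus (z - w)] &
   forall z s, modulus z <= 1 -> modulus (z - expi s) <= dl ->
     1 <= lam * modulus (dbmapB z)].
Proof.
have [L1 L10 h1] := disk_lip_forcing.
have [L2 L20 h2] := disk_lip_bmap.
have [L3 L30 h3] := disk_lip_dbmap.
pose L := 1 + L1 + L2 + L3.
pose g := 2 / (1 + modulus B).
have b0 := modulus_ge0 B; have b1 := B_lt1.
have g1 : 1 < g by rewrite /g ltr_pdivlMr; lra.
have L1' : 1 <= L by rewrite /L; lra.
have L0 : 0 < L by lra.
have mono (x y z : R) : 0 <= z -> y <= L -> x <= y * z -> x <= L * z.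
  by move=> z0 yL /le_trans; apply; apply: ler_wpM2r.
have gp : 0 < 2 / (1 + g) < 1.
  by rewrite divr_gt0 ?ltr_pdivrMr //; lra.
(* On the circle the derivative has modulus at least [g]; at distance [dl] it loses at most
   [(g - 1) / 2] and stays above [(1 + g) / 2], the inverse of the chosen [lam]. *)
exists L, (2 / (1 + g)), (Num.min 1 ((g - 1) / (2 * L))); split => //.
- rewrite ge_min lexx lt_min ltr01 divr_gt0 //; first lra.
  by rewrite mulr_gt0.
- move=> z w hz hw; have [p1 p2] := h1 z w hz hw; have [q1 q2] := h2 z w hz hw.
  have [r1 r2] := h3 z w hz hw.
  have [l1 l2 l3] : [/\ L1 <= L, L2 <= L & L3 <= L] by rewrite /L; split; lra.
  split; [exact: le_trans p1 l1 | apply: mono p2 | apply: mono q2 |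
    apply: mono r2];
   by rewrite ?modulus_ge0.
- move=> z s hz; rewrite le_min => /andP[_].
  rewrite ler_pdivlMr ?mulr_gt0 // => hd.
  have es : modulus (expi s : C R) <= 1 by rewrite modulus_expi.
  have [_ hl] := h3 z (expi s) hz es.
  have sg := speed_ge b1 s; rewrite -/g -modulus_dbmap_expi in sg.
  have := modulus_rev (dbmapB (expi s)) (dbmapB z); rewrite modulus_sym => hr.
  have : modulus (dbmapB z - dbmapB (expi s)) <= (g - 1) / 2.
    have L3L : L3 <= L by rewrite /L; lra.
    have := mono _ _ _ (modulus_ge0 _) L3L hl; lra.
  move=> hh; have ge : (1 + g) / 2 <= modulus (dbmapB z) by lra.
  by rewrite mulrC mulrA ler_pdivlMr; lra.
Qed.

Variable eta : C R -> C R.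
Hypothesis eta_eq : forall z, modulus z < 1 ->
  eta (bmapB z) = forcingBK z + dbmapB z * eta z.
Hypothesis eta_locally_bounded : forall r : R, r < 1 ->
  exists M, forall z, modulus z <= r -> modulus (eta z) <= M.

(** Near the circle the equation bounds [eta z] by [lam * (|eta (bmap z)| + L)], and [M] is stable
    under this map. As [bmap] preserves the disk [|z| <= |z0|], the bound [N] on it, which depends
    on [z0], only starts an induction in which its contribution decays like [lam ^ n]. *)
Lemma eta_bounded : exists2 M : R, 0 <= M &
  forall z, modulus z < 1 -> modulus (eta z) <= M.
Proof.
have [L [lam [dl [L1 /andP[l0 l1] /andP[d0 d1] hL hdl]]]] := disk_constants.
have [M0 hM0] : exists M, forall z, modulus z <= 1 - dl -> modulus (eta z) <= M.
  by apply: eta_locally_bounded; lra.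
have M00 : 0 <= M0.
  apply: le_trans (modulus_ge0 (eta 0)) (hM0 _ _); rewrite modulus0; lra.
have l1' : 0 < 1 - lam by rewrite subr_gt0.
pose M := M0 + lam * L / (1 - lam).
have ML : 0 <= lam * L / (1 - lam) by rewrite divr_ge0 ?mulr_ge0 //; lra.
have M0' : 0 <= M by rewrite addr_ge0.
have MC : lam * (M + L) <= M.
  rewrite -subr_ge0; have -> : M - lam * (M + L) = (1 - lam) * M0.
    by rewrite /M; field; rewrite gt_eqF.
  by rewrite mulr_ge0 // ltW.
exists M => // z0 hz0.
have [N hN] := eta_locally_bounded hz0.
apply: (@le_of_geometric _ _ _ N lam) => // [|n]; first exact: ltW.
have N0 : 0 <= N by apply: le_trans (modulus_ge0 (eta z0)) (hN _ (lexx _)).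
suff gen z : modulus z <= modulus z0 -> modulus (eta z) <= M + N * lam ^+ n.
  exact: gen.
elim: n z => [|n IH] z hz.
  by rewrite expr0 mulr1; apply: le_trans (hN z hz) _; rewrite lerDr.
have z1 : modulus z < 1 := le_lt_trans hz hz0.
have pn : 0 <= N * lam ^+ n.+1 by rewrite mulr_ge0 // exprn_ge0 // ltW.
have [zs|zl] := leP (modulus z) (1 - dl).
  by apply: le_trans (hM0 z zs) _; rewrite /M -addrA lerDl addr_ge0.
have zp : 0 < modulus z by lra.
have [s hs] : exists s, z / rc (modulus z) = expi s.
  by apply: polar; rewrite modulusM modulusV modulus_rc ger0_norm ?mulfV ?gt_eqF
    ?ltW.
have dist : modulus (z - expi s) <= dl.
  rewrite -hs; have -> : z - z / rc (modulus z) =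
    z / rc (modulus z) * rc (modulus z - 1).
    rewrite rcB mulrBr divfK ?rc_eq0 ?gt_eqF //.
    have -> : rc 1 = 1 :> C R by []. by rewrite mulr1.
  by rewrite hs modulusM modulus_expi mul1r modulus_rc ler0_norm; lra.
have exz := hdl z s (ltW z1) dist.
have bz := modulus_bmap_le (ltW z1).
have hb := IH (bmapB z) (le_trans bz hz).
have [hf _ _ _] := hL z z (ltW z1) (ltW z1).
have hd : modulus (dbmapB z) * modulus (eta z) <= M + N * lam ^+ n + L.
  rewrite -modulusM; have -> : dbmapB z * eta z = eta (bmapB z) - forcingBK z.
    by rewrite eta_eq // addrC addKr.
  exact: le_trans (modulusB _ _) (lerD hb hf).
have : modulus (eta z) <= lam * (M + N * lam ^+ n + L).
  apply: le_trans (ler_wpM2l (ltW l0) hd).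
  by rewrite mulrA ler_peMl ?modulus_ge0.
move=> /le_trans; apply; rewrite exprS; lra.
Qed.

Local Notation node := (cnode B_lt1).
Local Notation theta := (ctheta K B_lt1).

(** In generation 0 the node is the fixed point 1, where the forcing and the value vanish, so it is
    its own image. Hence an orbit of nodes can be continued for any number of steps. *)
Lemma boundary_predecessor n k : exists n' k',
  bmapB (expi (node n k)) = expi (node n' k') /\
  theta n' k' = forcingBK (expi (node n k)) + dbmapB (expi (node n k)) * theta n
    k.
Proof.
case: n => [|n]; last first.
  by exists n, k; split; [exact: expi_cnode | exact: ctheta_eq].
exists 0%N, k; rewrite !ctheta0 expi_cnode0 /forcing subrr !mulr0 mul0r addr0.
split=> //; rewrite -expi0 -expi_clift // clift0 expi0 //.
Qed.

Hypothesis K_neq0 : K != 0.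

(** The point and the node are followed for [N] iterates. Their distance grows at most by [mu] per
    step and stays below [dl], where solving the equation for the preimage contracts differences by
    [lam]; after the last iterate only the uniform bounds of [eta] and [theta] are used. *)
Lemma eta_near_boundary : exists lam mu dl Q : R,
  [/\ 0 < lam < 1, 1 <= mu, 0 < dl, 0 <= Q &
  forall N n k z eps, modulus z < 1 -> modulus (z - expi (node n k)) <= eps ->
    eps * mu ^+ N <= dl ->
    modulus (eta z - theta n k) <= Q * (lam ^+ N + mu ^+ N * eps)].
Proof.
have [L [lam [dl [L1 /andP[l0 l1] /andP[d0 d1] hL hdl]]]] := disk_constants.
have [M M0 hM] := eta_bounded.
have [T hT0] := cbval_bounded B_lt1 K_neq0.
have hT n k : modulus (theta n k) <= T.
  by rewrite /ctheta modulusM modulus_expi mul1r.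
have T0 : 0 <= T by apply: le_trans (modulus_ge0 _) (hT 0%N 0%N).
have l1' : 0 < 1 - lam by rewrite subr_gt0.
(* [M + T] serves for [N = 0]; the last summand absorbs the error [L * (1 + T) * eps] of each
   step. *)
pose Q := M + T + lam * (L * (1 + T)) / (1 - lam).
have Q1 : 0 <= lam * (L * (1 + T)) / (1 - lam).
  apply: divr_ge0; last exact: ltW.
  by apply: mulr_ge0; [exact: ltW | apply: mulr_ge0; lra].
have Q0 : 0 <= Q by rewrite /Q; lra.
exists lam, L, dl, Q; split => //; first by rewrite l0.
elim=> [|N IH] n k z eps z1 hz heps.
  rewrite !expr0; apply: le_trans (modulusB _ _) _.
  have e0 : 0 <= eps := le_trans (modulus_ge0 _) hz.
  apply: le_trans (lerD (hM z z1) (hT n k)) _.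
  have : 0 <= Q * eps by rewrite mulr_ge0.
  rewrite /Q; lra.
have e0 : 0 <= eps := le_trans (modulus_ge0 _) hz.
have LN n' : 1 <= L ^+ n' by rewrite exprn_ege1.
have [n' [k' [eb et]]] := boundary_predecessor n k.
set e := expi (node n k) in hz eb et *.
have e1 : modulus e <= 1 by rewrite modulus_expi.
have [_ hf hb hd] := hL z e (ltW z1) e1.
have bz := le_lt_trans (modulus_bmap_le (ltW z1)) z1.
have hb' : modulus (bmapB z - expi (node n' k')) <= L * eps.
  by rewrite -eb; apply: le_trans hb _; rewrite ler_wpM2l //; lra.
have := IH n' k' (bmapB z) (L * eps) bz hb' _.
rewrite -mulrA mulrCA -exprS => /(_ heps) ih.
have epsdl : eps <= dl.
  by apply: le_trans heps; rewrite ler_peMr.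
have ex := hdl z (node n k) (ltW z1) (le_trans hz epsdl).
have key : modulus (dbmapB z) * modulus (eta z - theta n k) <=
   Q * (lam ^+ N + L ^+ N.+1 * eps) + L * eps + L * eps * T.
  rewrite -modulusM.
  have -> : dbmapB z * (eta z - theta n k) = (eta (bmapB z) - theta n' k')
    - (forcingBK z - forcingBK e) - (dbmapB z - dbmapB e) * theta n k.
    by rewrite eta_eq // et; ring.
  apply: le_trans (modulusB _ _) (lerD _ _).
    apply: le_trans (modulusB _ _) (lerD _ _).
      by apply: le_trans ih _; rewrite exprS; apply: ler_wpM2l => //; lra.
    by apply: le_trans hf _; rewrite ler_wpM2l //; lra.
  rewrite modulusM; apply: ler_pM; rewrite ?modulus_ge0 //.
  by apply: le_trans hd _; rewrite ler_wpM2l //; lra.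
have step : modulus (eta z - theta n k) <=
  lam * (Q * (lam ^+ N + L ^+ N.+1 * eps) + L * eps + L * eps * T).
  apply: le_trans (ler_wpM2l (ltW l0) key).
  by rewrite mulrA ler_peMl ?modulus_ge0.
apply: le_trans step _; rewrite (exprS lam).
have QC : lam * (L * (1 + T)) <= (1 - lam) * Q.
  rewrite -subr_ge0; have -> : (1 - lam) * Q - lam * (L * (1 + T)) =
    (1 - lam) * (M + T).
    by rewrite /Q; field; rewrite gt_eqF.
  by apply: mulr_ge0; [exact: ltW | exact: addr_ge0].
have : lam * (L * (1 + T)) * eps <= (1 - lam) * Q * (L ^+ N.+1 * eps).
  apply: (@le_trans _ _ ((1 - lam) * Q * eps)); first exact: ler_wpM2r.
  apply: ler_wpM2l; first by rewrite mulr_ge0 // ltW.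
  by rewrite ler_peMl.
lra.
Qed.

End DiskEquation.

(** * Real and complex differentiability *)

Section DeriveEps.
Variable F : numFieldType.
Implicit Types (f : F -> F) (x l : F).

(** A form without division, valid also at [t = x], in which real and complex differentiability can
    be composed. *)
Lemma is_derive_eps f x l :
  is_derive x (1 : F) f l <->
  forall e : F, 0 < e -> exists2 d : F, 0 < d & forall t, `|t - x| < d ->
    `|f t - f x - l * (t - x)| <= e * `|t - x|.
Proof.
split=> [[df dl] e e0|h].
- have : (fun h => h^-1 *: ((f \o shift x) (h *: (1 : F)) - f x)) @ 0^' --> l.
    by rewrite -dl; exact: df.
  move=> /cvgrPdist_le /(_ e e0); rewrite near_withinE => -[d /= d0 hd].
  exists d => // t td; have [->|tx] := eqVneq t x.
    by rewrite !subrr mulr0 subrr normr0 mulr0.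
  have tx0 : t - x != 0 by rewrite subr_eq0.
  have := hd (t - x); rewrite /= sub0r normrN => /(_ td tx0).
  rewrite /shift /GRing.scale /= mulr1 subrK => hh.
  have -> : f t - f x - l * (t - x) = - (l - (t - x)^-1 * (f t - f x))
    * (t - x).
    by rewrite mulNr mulrBl mulrAC mulVf // mul1r opprB.
  by rewrite normrM normrN ler_wpM2r.
- have cv : (fun h => h^-1 *: ((f \o shift x) (h *: (1 : F)) - f x)) @ 0^' -->
  l.
    apply/cvgrPdist_le => e e0; have [d d0 hd] := h e e0.
    rewrite near_withinE; exists d => //= t /=; rewrite sub0r normrN => td t0.
    have := hd (t + x); rewrite addrK => /(_ td).
    rewrite /shift /GRing.scale /= mulr1 => hh.
    have -> : l - t^-1 * (f (t + x) - f x) = - (f (t + x) - f x - l * t) / t.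
      by field.
    by rewrite normrM normrN normfV ler_pdivrMr ?normr_gt0.
  by split; [exact: cvgP cv | exact: cvg_lim cv].
Qed.

End DeriveEps.

(** * Curves in the complex plane, complex differentiability and the chain rule between them *)

Section CurveDerivative.
Variable R : realType.
Implicit Types (g h : R -> C R) (s : R) (a b : C R).

Definition rdiff g s a := is_derive s (1 : R) (fun t => complex.Re (g t))
  (complex.Re a)
  /\ is_derive s (1 : R) (fun t => complex.Im (g t)) (complex.Im a).

Lemma rdiff_eps g s a : rdiff g s a <->
  forall e : R, 0 < e -> exists2 d : R, 0 < d & forall t, `|t - s| < d ->
    modulus (g t - g s - a * rc (t - s)) <= e * `|t - s|.
Proof.
have ReE t : complex.Re (g t - g s - a * rc (t - s)) =
    complex.Re (g t) - complex.Re (g s) - complex.Re a * (t - s).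
  by rewrite !(Re_add, Re_opp, Re_mul) /= mulr0 subr0.
have ImE t : complex.Im (g t - g s - a * rc (t - s)) =
    complex.Im (g t) - complex.Im (g s) - complex.Im a * (t - s).
  by rewrite !(Im_add, Im_opp, Im_mul) /= mulr0 add0r.
split=> [[/is_derive_eps h1 /is_derive_eps h2] e e0|h].
  have e2 : 0 < e / 2 by rewrite divr_gt0.
  have [d1 d10 k1] := h1 _ e2; have [d2 d20 k2] := h2 _ e2.
  exists (Num.min d1 d2); first by rewrite lt_min d10.
  move=> t; rewrite lt_min => /andP[t1 t2].
  apply: le_trans (modulus_le_ReIm _) _; rewrite ReE ImE.
  have := lerD (k1 t t1) (k2 t t2); lra.
split; apply/is_derive_eps => e e0; have [d d0 k] := h e e0;
  exists d => // t td.
  by apply: le_trans (k t td); rewrite -ReE Re_le_modulus.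
by apply: le_trans (k t td); rewrite -ImE Im_le_modulus.
Qed.

Lemma rdiff_eq g h s a b : rdiff g s a -> g =1 h -> a = b -> rdiff h s b.
Proof. by move=> hg /funext <- <-. Qed.

Lemma rdiff_cst a s : rdiff (fun=> a) s 0.
Proof. by split; exact: derC. Qed.

Lemma rdiffD g h s a b : rdiff g s a -> rdiff h s b ->
  rdiff (fun t => g t + h t) s (a + b).
Proof.
move=> [g1 g2] [h1 h2]; split.
  by apply: der_eq (derD g1 h1) _ _ => [t|]; rewrite Re_add.
by apply: der_eq (derD g2 h2) _ _ => [t|]; rewrite Im_add.
Qed.

Lemma rdiffN g s a : rdiff g s a -> rdiff (fun t => - g t) s (- a).
Proof.
move=> [g1 g2]; split.
  by apply: der_eq (derN g1) _ _ => [t|]; rewrite Re_opp.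
by apply: der_eq (derN g2) _ _ => [t|]; rewrite Im_opp.
Qed.

Lemma rdiffM g h s a b : rdiff g s a -> rdiff h s b ->
  rdiff (fun t => g t * h t) s (a * h s + g s * b).
Proof.
move=> [g1 g2] [h1 h2]; split.
  apply: der_eq (derD (derM g1 h1) (derN (derM g2 h2))) _ _ => [t|].
    by rewrite Re_mul.
  by rewrite !(Re_add, Re_mul); ring.
apply: der_eq (derD (derM g1 h2) (derM g2 h1)) _ _ => [t|].
  by rewrite Im_mul.
by rewrite !(Im_add, Im_mul); ring.
Qed.

Lemma rdiff_conj g s a : rdiff g s a -> rdiff (fun t => (g t)^*) s (a^*).
Proof.
move=> [g1 g2]; split; first by apply: der_eq g1 _ _ => [t|]; rewrite Re_conj.
by apply: der_eq (derN g2) _ _ => [t|]; rewrite Im_conj.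
Qed.

Lemma rdiff_expi s : rdiff (@expi R) s (iunit R * expi s).
Proof.
split.
  by apply: der_eq (is_derive_cos s) _ _ => //; rewrite Re_mul /=; ring.
by apply: der_eq (is_derive_sin s) _ _ => //; rewrite Im_mul /=; ring.
Qed.

Lemma rdiff_continuous g s a : rdiff g s a ->
  forall e : R, 0 < e -> exists2 d : R, 0 < d & forall t, `|t - s| < d ->
    modulus (g t - g s) < e.
Proof.
move=> /rdiff_eps h e e0; have [d d0 hd] := h 1 ltr01.
have m0 := modulus_ge0 a.
exists (Num.min d (e / (2 + modulus a))).
  by rewrite lt_min d0 divr_gt0 //; lra.
move=> t; rewrite lt_min => /andP[t1]; rewrite ltr_pdivlMr; last lra.
move=> t2; have := hd t t1.
have := modulus_rev (g t - g s) (a * rc (t - s)).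
rewrite modulusM modulus_rc; have := normr_ge0 (t - s); nra.
Qed.

Lemma rdiff_inv g s a : g s != 0 -> rdiff g s a ->
  rdiff (fun t => (g t)^-1) s (- a / g s ^+ 2).
Proof.
move=> g0 hg.
have n0 : complex.Re (g s) ^+ 2 + complex.Im (g s) ^+ 2 != 0.
  by rewrite -modulus_sqr expf_eq0 /= modulus_eq0.
have [g1 g2] := hg.
have VE (z : C R) : z^-1 =
  Complex (complex.Re z / (complex.Re z ^+ 2 + complex.Im z ^+ 2))
    (- (complex.Im z / (complex.Re z ^+ 2 + complex.Im z ^+ 2))) by case: z.
have dn := derD (derM g1 g1) (derM g2 g2).
have n0' : complex.Re (g s) * complex.Re (g s) + complex.Im (g s) * complex.Im
  (g s) != 0.
  by rewrite -!expr2.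
have dV := derV (f := fun t => complex.Re (g t) * complex.Re (g t) +
   complex.Im (g t) * complex.Im (g t)) n0' dn.
split.
  apply: der_eq (derM g1 dV) _ _ => [t|]; first by rewrite VE /= -!expr2.
  rewrite -[(g s ^+ 2)^-1]exprVn VE expr2 !(Re_mul, Im_mul, Re_opp, Im_opp) /=.
  by field.
apply: der_eq (derN (derM g2 dV)) _ _ => [t|]; first by rewrite VE /= -!expr2.
rewrite -[(g s ^+ 2)^-1]exprVn VE expr2 !(Re_mul, Im_mul, Re_opp, Im_opp) /=.
by field.
Qed.

Lemma ddt0E g a : rdiff g 0 a -> ddt0 g = a.
Proof.
by case: a => x y [[_ h1] [_ h2]]; rewrite /ddt0 !derive1E h1 h2.
Qed.

Definition cdiff (f : C R -> C R) (z d : C R) :=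
  forall e : R, 0 < e -> exists2 r : R, 0 < r & forall w, modulus (w - z) < r ->
    modulus (f w - f z - d * (w - z)) <= e * modulus (w - z).

Lemma complex_gt0 (e : C R) : 0 < e -> exists2 x : R, 0 < x & e = rc x.
Proof.
case: e => x y; rewrite ltcE /= => /andP[/eqP -> x0].
by exists x.
Qed.

Lemma cdiffP f z d : cdiff f z d <-> is_derive z (1 : C R) f d.
Proof.
split=> [h|/is_derive_eps h e e0].
  apply/is_derive_eps => _ /complex_gt0[e e0 ->].
  have [r r0 hr] := h e e0; exists (rc r); first by rewrite ltcR.
  move=> t; rewrite normc_lt => /hr; rewrite (normE (t - z)) -rcM.
  by rewrite normc_le.
have [|_ /complex_gt0[r r0 ->] hr] := h (rc e); first by rewrite ltcR.
exists r => // w; rewrite -normc_lt => /hr.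
by rewrite (normE (w - z)) -rcM normc_le.
Qed.

Lemma rdiff_cdiff f g s a d : cdiff f (g s) d -> rdiff g s a ->
  rdiff (fun t => f (g t)) s (d * a).
Proof.
move=> hf hg; apply/rdiff_eps => e e0.
have m0 := modulus_ge0 a; have d0 := modulus_ge0 d.
pose e1 := e / (2 * (1 + modulus a)).
have e10 : 0 < e1 by rewrite divr_gt0 // mulr_gt0; lra.
have [r r0 hr] := hf e1 e10.
have [r1 r10 hr1] := rdiff_continuous hg r0.
pose e2 := Num.min 1 (e / (2 * (1 + modulus d))).
have e20 : 0 < e2 by rewrite lt_min ltr01 divr_gt0 //; lra.
have /rdiff_eps/(_ e2 e20)[r2 r20 hr2] := hg.
exists (Num.min r1 r2); first by rewrite lt_min r10.
move=> t; rewrite lt_min => /andP[t1 t2].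
have h1 := hr _ (hr1 t t1); have h2 := hr2 t t2.
have hm : modulus (g t - g s) <= (1 + modulus a) * `|t - s|.
  have := modulus_rev (g t - g s) (a * rc (t - s)).
  rewrite modulusM modulus_rc.
  have : e2 * `|t - s| <= 1 * `|t - s| by rewrite ler_wpM2r // ge_min lexx.
  lra.
have -> : f (g t) - f (g s) - d * a * rc (t - s) =
   (f (g t) - f (g s) - d * (g t - g s)) + d * (g t - g s - a * rc (t - s))
     by ring.
apply: le_trans (modulusD _ _) _; rewrite [modulus (d * _)]modulusM.
have p1 : e1 * modulus (g t - g s) <= e / 2 * `|t - s|.
  have -> : e / 2 * `|t - s| = e1 * ((1 + modulus a) * `|t - s|).
    by rewrite /e1; field; rewrite gt_eqF //; lra.
  by apply: ler_wpM2l => //; exact: ltW.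
have p2 : modulus d * (e2 * `|t - s|) <= e / 2 * `|t - s|.
  rewrite mulrA; apply: ler_wpM2r => //.
  apply: (@le_trans _ _ (modulus d * (e / (2 * (1 + modulus d))))).
    by apply: ler_wpM2l => //; rewrite ge_min lexx orbT.
  have -> : e / 2 = (1 + modulus d) * (e / (2 * (1 + modulus d))).
    by field; rewrite gt_eqF //; lra.
  apply: ler_wpM2r; last lra.
  by rewrite divr_ge0 ?(ltW e0) //; lra.
have p3 := ler_wpM2l d0 h2.
lra.
Qed.

End CurveDerivative.

(** * Mean square increments and continuity *)

Section Analysis.
Variable R : realType.

(** The Cauchy-Schwarz inequality with [G] as an antiderivative of a bound of [|g'|^2]. With
    [p + i q] the mean slope of [g], the derivative of [F] is at least [|g' - (p + i q)|^2], so [F]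
    does not decrease from [a] to [b], which is the claim. *)
Lemma increment_sq_le (g g' : R -> C R) (G G' : R -> R) (a b : R) : a < b ->
  (forall x, a <= x <= b -> rdiff g x (g' x)) ->
  (forall x, a <= x <= b -> is_derive x (1 : R) G (G' x)) ->
  (forall x, a <= x <= b -> modulus (g' x) ^+ 2 <= G' x) ->
  modulus (g b - g a) ^+ 2 <= (b - a) * (G b - G a).
Proof.
move=> ab hg hG hle; have ba : 0 < b - a by rewrite subr_gt0.
pose p := complex.Re (g b - g a) / (b - a).
pose q := complex.Im (g b - g a) / (b - a).
pose F x := (p ^+ 2 + q ^+ 2) * x + G x -
  2 * (p * complex.Re (g x) + q * complex.Im (g x)).
pose F' x := (p ^+ 2 + q ^+ 2) + G' x -
  2 * (p * complex.Re (g' x) + q * complex.Im (g' x)).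
have dF x : a <= x <= b -> is_derive x (1 : R) F (F' x).
  move=> hx; have [d1 d2] := hg x hx.
  apply: der_eq (derD (derD (derM (derC x (p ^+ 2 + q ^+ 2)) (derI x))
    (hG x hx))
    (derN (derM (derC x 2) (derD (derM (derC x p) d1)
      (derM (derC x q) d2))))) _ _ => //.
  by rewrite /F'; ring.
have dF' x : x \in `]a, b[ -> is_derive x (1 : R) F (F' x).
  by rewrite in_itv => /andP[/ltW h1 /ltW h2]; apply: dF; rewrite h1 h2.
have cF : {within `[a, b], continuous F}.
  apply: derivable_within_continuous => x; rewrite in_itv => hx.
  by have [] := dF x hx.
have [c] := MVT_segment (ltW ab) dF' cF; rewrite in_itv => hc hF.
have F0 : 0 <= F' c.
  have := hle c hc; rewrite modulus_sqr /F'.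
  have := sqr_ge0 (p - complex.Re (g' c));
    have := sqr_ge0 (q - complex.Im (g' c)).
  lra.
have : 0 <= F b - F a by rewrite hF mulr_ge0 // ltW.
have pE : complex.Re (g b) - complex.Re (g a) = p * (b - a).
  by rewrite /p divfK ?gt_eqF // Re_add Re_opp.
have qE : complex.Im (g b) - complex.Im (g a) = q * (b - a).
  by rewrite /q divfK ?gt_eqF // Im_add Im_opp.
rewrite modulus_sqr !(Re_add, Im_add, Re_opp, Im_opp) pE qE => h.
have -> : (p * (b - a)) ^+ 2 + (q * (b - a)) ^+ 2 =
  (b - a) * ((p ^+ 2 + q ^+ 2) * (b - a)) by ring.
apply: ler_wpM2l; first exact: ltW.
have e : F b - F a = (G b - G a) + (p ^+ 2 + q ^+ 2) * (b - a)
  - 2 * (p * (complex.Re (g b) - complex.Re (g a)) +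
    q * (complex.Im (g b) - complex.Im (g a))).
  by rewrite /F; ring.
rewrite e pE qE in h; lra.
Qed.

Lemma antiderivative (F : R -> R) (b : R) : 0 < b -> continuous F ->
  exists G : R -> R, (forall x, 0 <= x <= b -> is_derive x (1 : R) G (F x)) /\
    \int[lebesgue_measure]_(s in `[0, b]) F s = G b - G 0.
Proof.
move=> b0 cF.
have iF : lebesgue_measure.-integrable `[(-1)%R, b + 1] (EFin \o F).
  apply: continuous_compact_integrable; first exact: segment_compact.
  exact: continuous_subspaceT.
(* The interval of integration starts at -1 and extends to [b + 1], so that both 0 and [b] are
   interior and [G] has two-sided derivatives there. *)
pose G x := (\int[lebesgue_measure]_(t in `[(-1)%R, x]) F t)%R.
have dG x : 0 <= x <= b -> is_derive x (1 : R) G (F x).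
  move=> /andP[x0 xb].
  have [|||d1 d2] := @continuous_FTC1_closed R F (-1) x (b + 1) _ iF.
  - by lra.
  - by lra.
  - exact: cF.
  - by constructor; [exact: d1 | rewrite -derive1E; exact: d2].
exists G; split => //.
have cG x : 0 <= x <= b -> {for x, continuous G}.
  move=> hx; have [d _] := dG x hx.
  exact/differentiable_continuous/derivable1_diffP.
have h0 : 0 <= (0 : R) <= b by rewrite lexx ltW.
have hb : 0 <= b <= b by rewrite lexx ltW.
rewrite /Rintegral (@continuous_FTC2 R F G 0 b b0) //.
- exact: continuous_subspaceT.
- split.
  + by move=> x; rewrite in_itv => /andP[/ltW h1 /ltW h2]; have [] := dG x;
    rewrite ?h1.
  + by apply: cvg_at_right_filter; exact: cG.
  + by apply: cvg_at_left_filter; exact: cG.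
- move=> x; rewrite in_itv => /andP[/ltW h1 /ltW h2].
  by rewrite derive1E; have [|_ ->] := dG x; rewrite ?h1.
Qed.

Definition ccont (f : C R -> C R) (z : C R) :=
  forall e : R, 0 < e -> exists2 d : R, 0 < d &
    forall w, modulus (w - z) < d -> modulus (f w - f z) < e.

Lemma cdiff_ccont f z d : cdiff f z d -> ccont f z.
Proof.
move=> h e e0; have [r r0 hr] := h 1 ltr01.
have m0 := modulus_ge0 d.
exists (Num.min r (e / (2 + modulus d))).
  by rewrite lt_min r0 divr_gt0 //; lra.
move=> w; rewrite lt_min => /andP[t1]; rewrite ltr_pdivlMr; last lra.
move=> t2; have := hr w t1.
have := modulus_rev (f w - f z) (d * (w - z)).
rewrite modulusM; have := modulus_ge0 (w - z); nra.
Qed.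

Lemma locally_bounded (f : C R -> C R) :
  (forall z, modulus z < 1 -> ccont f z) ->
  forall r : R, r < 1 -> exists M, forall z, modulus z <= r -> modulus (f z) <=
    M.
Proof.
move=> cf r r1; have [r0|r0] := ltP r 0.
  by exists 0 => z hz; have := le_lt_trans hz r0; rewrite ltNge modulus_ge0.
pose A := [set p : R * R | p.1 ^+ 2 + p.2 ^+ 2 <= r ^+ 2].
pose F (p : R * R) : R := modulus (f (Complex p.1 p.2)).
have mA (z : C R) : modulus z <= r -> A (complex.Re z, complex.Im z).
  by move=> hz; rewrite /A /= -modulus_sqr lerXn2r ?nnegrE ?modulus_ge0.
have Am (p : R * R) : A p -> modulus (Complex p.1 p.2 : C R) <= r.
  move=> hp; rewrite -(ler_pXn2r (n := 2)) ?nnegrE ?modulus_ge0 //.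
  by rewrite modulus_sqr.
have clA : closed A.
  have cq : continuous (fun p : R * R => p.1 ^+ 2 + p.2 ^+ 2).
    move=> p; apply: cvgD.
      by apply: (@continuous_comp _ _ _ fst (fun x : R => x ^+ 2));
        [exact: cvg_fst|exact: exprn_continuous].
    by apply: (@continuous_comp _ _ _ snd (fun x : R => x ^+ 2));
      [exact: cvg_snd|exact: exprn_continuous].
  have := closed_comp (f := fun p : R * R => p.1 ^+ 2 + p.2 ^+ 2)
    (D := [set x | x <= r ^+ 2]).
  by apply; [move=> p _; exact: cq | exact: closed_le].
have coA : compact A.
  have sub : A `<=` `[- r, r] `*` `[- r, r].
    move=> [x y] /= hp; split; rewrite /= in_itv /= -ler_norml;
     rewrite -(ler_pXn2r (n := 2)) ?nnegrE // real_normK ?num_real //.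
      by move: hp; rewrite /A /=; have := sqr_ge0 y; lra.
    by move: hp; rewrite /A /=; have := sqr_ge0 x; lra.
  rewrite -(setIidr sub); apply: compact_closedI => //.
  by apply: compact_setX; exact: segment_compact.
have cF : {within A, continuous F}.
  apply: continuous_in_subspaceT => p; rewrite inE => /Am hp.
  apply/cvgrPdist_lt => e e0.
  have [d d0 hd] := cf _ (le_lt_trans hp r1) e e0.
  have d2 : 0 < d / 2 by rewrite divr_gt0.
  apply: filterS (nbhsx_ballx p (d / 2) d2) => -[x y] [/= b1 b2].
  rewrite /ball /= in b1 b2.
  rewrite /F /=; set z := Complex p.1 p.2; set w := Complex x y.
  have hw : modulus (w - z : C R) < d.
    apply: le_lt_trans (modulus_le_ReIm _) _.
    rewrite Re_add Im_add Re_opp Im_opp /= ![`|_ - p.1|]distrC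
      ![`|_ - p.2|]distrC; lra.
  apply: le_lt_trans (hd w hw); rewrite distrC ler_norml.
  have := modulus_rev (f w) (f z); have := modulus_rev (f z) (f w).
  by rewrite modulus_sym; lra.
have A0 : A !=set0 by exists (0, 0); rewrite /A /= expr0n /= addr0 sqr_ge0.
have [c _ hc] := compact_EVT_max A0 coA cF.
exists (F c) => z hz; have := hc _ (mem_set (mA z hz)).
by rewrite /F /=; case: z hz.
Qed.

Lemma circle_continuous (h : C R -> C R) (r : R) : 0 <= r -> r < 1 ->
  (forall z, modulus z < 1 -> ccont h z) ->
  continuous (fun s => modulus (h (Complex r 0 * expi s)) ^+ 2 * r).
Proof.
move=> r0 r1 ch s.
apply: cvgM; last exact: cvg_cst.
apply: (@continuous_comp _ _ _ (fun s => modulus (h (Complex r 0 * expi s)))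
  (fun x : R => x ^+ 2)); last exact: exprn_continuous.
apply/cvgrPdist_lt => e e0; rewrite -/(rc r).
have m1 t : modulus (rc r * expi t) < 1.
  by rewrite modulusM modulus_expi mulr1 modulus_rc ger0_norm.
have [d' d'0 hd] := ch _ (m1 s) e e0.
have [d d0 hd2] := rdiff_continuous (rdiff_expi s) d'0.
apply/nbhs_ballP; exists d => //= t; rewrite /ball /= distrC => /hd2 b1.
have close : modulus (rc r * expi t - rc r * expi s) < d'.
  rewrite -mulrBr modulusM modulus_rc ger0_norm //.
  by apply: le_lt_trans b1; rewrite ler_piMl ?modulus_ge0 // ltW.
apply: le_lt_trans (hd _ close); rewrite distrC ler_norml.
set z := h _; set w := h _.
have := modulus_rev z w; have := modulus_rev w z.
by rewrite modulus_sym; lra.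
Qed.

End Analysis.

(** * Lower bound for the Weil--Petersson mean *)

Section Core.
Variables (R : realType) (B K : C R).
Hypothesis B_lt1 : modulus B < 1.
Hypothesis K_neq0 : K != 0.
Variable eta : C R -> C R.
Hypothesis eta_diff : forall z, modulus z < 1 -> cdiff eta z (derive1 eta z).
Hypothesis deta_cont : forall z, modulus z < 1 -> ccont (derive1 eta) z.
Hypothesis eta_eq : forall z, modulus z < 1 ->
  eta (bmap B z) = forcing B K z + dbmap B z * eta z.

Local Notation node := (cnode B_lt1).
Local Notation bvalue := (cbval K B_lt1).
Local Notation theta := (ctheta K B_lt1).

Definition circle_density (r s : R) :=
  modulus (derive1 eta (Complex r 0 * expi s)) ^+ 2 * r.

Definition circle_integral (r : R) :=
  \int[lebesgue_measure]_(s in `[0, 2 * pi]) circle_density r s.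

Lemma node_in n k : (k <= 2 ^ n)%N -> 0 <= node n k <= 2 * pi.
Proof.
have mono j i : node n j <= node n (i + j).
  by elim: i => [//|i IH]; apply: le_trans IH (ltW (cnode_lt _ _ _)).
move=> hk; have := mono 0%N k; rewrite addn0 cnode0 => -> /=.
by have := mono k (2 ^ n - k)%N; rewrite subnK // cnode_last.
Qed.

(** Each chord of boundary values is an increment of [W] up to an error [2 * E]. The squared
    increment divided by the arc length is controlled by [increment_sq_le], and the resulting bounds
    telescope around the circle. *)
Lemma energy_upper_bound (M r E : R) n : 0 <= r -> r < 1 ->
  (forall z, modulus z < 1 -> modulus (eta z) <= M) ->
  (forall k, modulus (eta (rc r * expi (node n k)) - theta n k) <= E) ->
  energy node bvalue n <= 4 * circle_integral r + 8 * pi * M ^+ 2 +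
    2 ^+ n * (8 * E ^+ 2 / (2 * pi * ((1 - modulus B) / 2) ^+ n)).
Proof.
move=> r0 r1 hM hE.
have p0 : 0 < 2 * pi :> R by rewrite mulr_gt0 // pi_gt0.
have cF := circle_continuous r0 r1 deta_cont.
have [G [dG ->]] : exists G : R -> R,
    (forall x, 0 <= x <= 2 * pi -> is_derive x (1 : R) G (circle_density r x))
      /\
    circle_integral r = G (2 * pi) - G 0 := antiderivative p0 cF.
have m1 s : modulus (rc r * expi s) < 1.
  by rewrite modulusM modulus_expi mulr1 modulus_rc ger0_norm.
(* The rotated restriction of [eta] to [|z| = r], to be compared with [bvalue]; differentiating the
   rotation costs the term [M ^ 2]. *)
pose W s := (expi s)^-1 * eta (rc r * expi s).
pose W' s := - (iunit R * expi s) / expi s ^+ 2 * eta (rc r * expi s) +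
   (expi s)^-1 * (derive1 eta (rc r * expi s) * (rc r * (iunit R * expi s))).
have i1 : modulus (iunit R) = 1.
  by apply/eqP; rewrite -(eqrXn2 (n := 2)) ?modulus_ge0 // modulus_sqr /= expr0n
    add0r.
have dW s : rdiff W s (W' s).
  apply: rdiffM.
    by apply: rdiff_inv (rdiff_expi s); exact: expi_neq0.
  apply: (rdiff_cdiff (f := eta) (g := fun t => rc r * expi t)).
    exact: eta_diff.
  apply: rdiff_eq (rdiffM (rdiff_cst (rc r) s) (rdiff_expi s)) _ _ => //.
  by rewrite mul0r add0r.
have M0 : 0 <= M := le_trans (modulus_ge0 _) (hM _ (m1 0)).
pose H x := 2 * M ^+ 2 * x + 2 * G x.
have dH x : 0 <= x <= 2 * pi ->
    is_derive x (1 : R) H (2 * M ^+ 2 + 2 * circle_density r x).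
  move=> hx; apply: der_eq (derD (derM (derC x (2 * M ^+ 2)) (derI x))
    (derM (derC x 2) (dG x hx))) _ _ => //; ring.
have W'_le x : modulus (W' x) ^+ 2 <= 2 * M ^+ 2 + 2 * circle_density r x.
  apply: le_trans (modulus_sqrD _ _) _.
  rewrite /circle_density; apply: lerD; apply: ler_wpM2l => //.
    rewrite lerXn2r ?nnegrE ?modulus_ge0 // modulusM modulusM modulusN modulusV.
    by rewrite modulusX modulusM i1 modulus_expi mul1r expr1n invr1 !mul1r hM.
  rewrite modulusM modulusV modulus_expi invr1 mul1r modulusM (modulusM (rc r)).
  rewrite modulusM i1 modulus_expi mulr1 modulus_rc ger0_norm // mulr1 exprMn.
  rewrite -/(rc r); apply: ler_wpM2l; first exact: sqr_ge0.
  by rewrite expr2 ler_piMl // ltW.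
have near k : modulus (W (node n k) - bvalue n k) <= E.
  have -> : W (node n k) - bvalue n k =
     (expi (node n k))^-1 * (eta (rc r * expi (node n k)) - theta n k).
    by rewrite /W /ctheta mulrBr mulrA mulVf ?expi_neq0 // mul1r.
  by rewrite modulusM modulusV modulus_expi invr1 mul1r.
have E0 : 0 <= E := le_trans (modulus_ge0 _) (hE 0%N).
set nu := 2 * pi * _ ^+ n.
have nu0 : 0 < nu.
  by rewrite mulr_gt0 // exprn_gt0 // divr_gt0 // subr_gt0.
have term k : (k < 2 ^ n)%N -> modulus (chord bvalue n k) ^+ 2 / arc_len node n
  k <=
   (2 * H (node n k.+1) - 2 * H (node n k)) + 8 * E ^+ 2 / nu.
  move=> hk; have hk' := ltnW hk.
  have /andP[a0 _] := node_in hk'; have /andP[_ b1] := node_in hk.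
  have ab : node n k < node n k.+1 := cnode_lt B_lt1 n k.
  have inc := increment_sq_le ab (fun x _ => dW x) (fun x hx => dH x (_ hx))
    (fun x _ => W'_le x).
  have {}inc : modulus (W (node n k.+1) - W (node n k)) ^+ 2 <=
     arc_len node n k * (H (node n k.+1) - H (node n k)).
    apply: inc => x /andP[x0 x1]; rewrite (le_trans a0 x0).
    exact: le_trans x1 b1.
  have ar0 : 0 < arc_len node n k by rewrite subr_gt0.
  have arnu : nu <= arc_len node n k := arc_lower_bound B_lt1 n k.
  have -> : chord bvalue n k = (W (node n k.+1) - W (node n k)) +
     ((W (node n k) - bvalue n k) - (W (node n k.+1) - bvalue n k.+1)).
    by rewrite /chord; ring.
  have er : modulus ((W (node n k) - bvalue n k) -
    (W (node n k.+1) - bvalue n k.+1)) <= 2 * E.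
    apply: le_trans (modulusB _ _) _.
    by have := near k; have := near k.+1; lra.
  have er2 : modulus ((W (node n k) - bvalue n k) -
    (W (node n k.+1) - bvalue n k.+1)) ^+ 2
      <= 4 * E ^+ 2.
    have -> : 4 * E ^+ 2 = (2 * E) ^+ 2 by ring.
    by rewrite lerXn2r ?nnegrE ?modulus_ge0 // mulr_ge0.
  rewrite ler_pdivrMr // mulrDl.
  apply: le_trans (modulus_sqrD _ _) _.
  have e2 : 8 * E ^+ 2 <= 8 * E ^+ 2 / nu * arc_len node n k.
    rewrite -mulrA ler_peMr ?mulr_ge0 ?sqr_ge0 //.
    by rewrite mulrC ler_pdivlMr // mul1r.
  lra.
rewrite /energy.
apply: (@le_trans _ _ (\sum_(0 <= k < 2 ^ n)
   ((2 * H (node n k.+1) - 2 * H (node n k)) + 8 * E ^+ 2 / nu))).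
  by apply: ler_sum_nat => k /andP[_ hk]; exact: term.
rewrite big_split /= telescope_sumr // cnode_last cnode0.
rewrite sumr_const_nat subn0 -[_ *+ (2 ^ n)%N]mulr_natl natrX /H.
rewrite le_eqVlt; apply/orP; left; apply/eqP; ring.
Qed.

Lemma exists_pow_le (lam A : R) : 0 < lam < 1 -> 0 < A ->
  exists2 L : nat, (0 < L)%N & lam ^+ L <= A.
Proof.
move=> /andP[l0 l1] A0.
have : (fun n => lam ^+ n) @ \oo --> (0 : R).
  by apply: cvg_expr; rewrite gtr0_norm.
move=> /cvgr_lt /(_ A A0) [m _ hm]; exists m.+1 => //.
by apply: ltW; apply: hm => /=.
Qed.

(** The radius approaches 1 geometrically in [n], so that [|log (1 - r)|] grows linearly, while the
    comparison error in the energy stays bounded by [C1]. *)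
Lemma energy_growth_bound : exists C1 dl q : R,
  [/\ 0 < dl <= 1, 0 < q < 1 & forall n,
    energy node bvalue n <= 4 * circle_integral (1 - dl * q ^+ n) + C1].
Proof.
have [M M0 hM] := eta_bounded B_lt1 eta_eq
  (locally_bounded (fun z hz => cdiff_ccont (eta_diff hz))).
have [lam [mu [dl' [Q [/andP[l0 l1] mu1 dl'0 Q0 hQ]]]]] :=
  eta_near_boundary B_lt1 eta_eq
  (locally_bounded (fun z hz => cdiff_ccont (eta_diff hz))) K_neq0.
pose dl := Num.min 1 dl'.
have dl0 : 0 < dl by rewrite lt_min ltr01.
have dl1 : dl <= 1 by rewrite ge_min lexx.
have dldl' : dl <= dl' by rewrite ge_min lexx orbT.
have mu0 : 0 < mu by lra.
pose nu := (1 - modulus B) / 2.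
have nu0 : 0 < nu by rewrite divr_gt0 // subr_gt0.
(* The error term in the energy is a constant times [(lam ^ (2 * L) * 2 / nu) ^ n]; both bounds on
   [lam ^ L] together make the base at most 1. *)
have [L L0 hL] : exists2 L : nat, (0 < L)%N & lam ^+ L <= Num.min 1 (nu / 2).
  by apply: exists_pow_le; rewrite ?l0 // lt_min ltr01 divr_gt0.
have {hL} [hL1 hL] : lam ^+ L <= 1 /\ lam ^+ L <= nu / 2.
  by move: hL; rewrite le_min => /andP.
(* With [L * n] iterates and initial distance [dl * q ^ n], the final distance is
   [dl * lam ^ (L * n)], so both errors of [eta_near_boundary] have the same order. *)
pose q := (lam / mu) ^+ L.
have lm0 : 0 < lam / mu by rewrite divr_gt0.
have lm1 : lam / mu < 1 by rewrite ltr_pdivrMr // mul1r; lra.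
have q0 : 0 < q by rewrite exprn_gt0.
have q1 : q < 1 by rewrite exprn_ilt1 ?ltW // -lt0n.
exists (8 * pi * M ^+ 2 + 8 * (Q * (1 + dl)) ^+ 2 / (2 * pi)), dl, q => //.
split; [by rewrite dl0 | by rewrite q0 |].
move=> n; set r := 1 - dl * q ^+ n.
have qn0 : 0 < q ^+ n by rewrite exprn_gt0.
have qn1 : q ^+ n <= 1 by rewrite exprn_ile1 // ltW.
have dq0 : 0 < dl * q ^+ n by rewrite mulr_gt0.
have dq1 : dl * q ^+ n <= 1 by rewrite mulr_ile1 // ltW.
have r0 : 0 <= r by rewrite /r; lra.
have r1 : r < 1 by rewrite /r; lra.
pose E := Q * (1 + dl) * lam ^+ (L * n).
have ll0 : 0 < lam ^+ (L * n) by rewrite exprn_gt0.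
have muq : mu ^+ (L * n) * (dl * q ^+ n) = dl * lam ^+ (L * n).
  rewrite /q -exprM expr_div_n; field; by rewrite expf_neq0 // gt_eqF.
have hE k : modulus (eta (rc r * expi (node n k)) - theta n k) <= E.
  have := hQ (L * n)%N n k (rc r * expi (node n k)) (dl * q ^+ n).
  rewrite muq => h; apply: le_trans (h _ _ _) _.
  - by rewrite modulusM modulus_expi mulr1 modulus_rc ger0_norm.
  - have -> : rc r * expi (node n k) - expi (node n k) =
    rc (r - 1) * expi (node n k).
      by rewrite (rcB r 1) mulrBl (_ : rc 1 = 1 :> C R) // mul1r.
    rewrite modulusM modulus_expi mulr1 modulus_rc ler0_norm; last by lra.
    by rewrite /r; lra.
  - rewrite mulrC muq; apply: le_trans dldl'.
    by apply: ler_piMr; [exact: ltW | apply: exprn_ile1; exact: ltW].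
  - by rewrite /E le_eqVlt; apply/orP; left; apply/eqP; ring.
apply: le_trans (energy_upper_bound r0 r1 hM hE) _.
rewrite -addrA lerD2l lerD2l -/nu.
rewrite /E exprMn.
have p0 : 0 < 2 * pi :> R by rewrite mulr_gt0 // pi_gt0.
have -> : 2 ^+ n * (8 * ((Q * (1 + dl)) ^+ 2 * (lam ^+ (L * n)) ^+ 2)
  / (2 * pi * nu ^+ n))
  = 8 * (Q * (1 + dl)) ^+ 2 / (2 * pi)
    * ((lam ^+ (L * n)) ^+ 2 * (2 / nu) ^+ n).
  rewrite [(2 / nu) ^+ n]expr_div_n; have nun : nu ^+ n !=
    0 by rewrite expf_neq0 // gt_eqF.
  have pn0 : (pi : R) != 0 := lt0r_neq0 (pi_gt0 R).
  move: (2 ^+ n) (nu ^+ n) nun (lam ^+ (L * n)) (pi : R) pn0 => x y y0 z w w0;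
    field.
  by rewrite ?y0 ?w0.
apply: ler_piMr.
  by rewrite divr_ge0 ?(ltW p0) // mulr_ge0 // sqr_ge0.
have -> : (lam ^+ (L * n)) ^+ 2 * (2 / nu) ^+ n =
  (lam ^+ L * (lam ^+ L * (2 / nu))) ^+ n.
  by rewrite exprM -exprM mulnC exprM -exprMn expr2 mulrA.
have lL0 : 0 < lam ^+ L by rewrite exprn_gt0.
apply: exprn_ile1.
  by rewrite mulr_ge0 ?(ltW lL0) // mulr_ge0 ?(ltW lL0) // divr_ge0 // ltW.
apply: mulr_ile1 => //; rewrite ?(ltW lL0) //.
  by rewrite mulr_ge0 ?(ltW lL0) // divr_ge0 // ltW.
rewrite -ler_pdivlMr; last by rewrite divr_gt0.
by rewrite invf_div mul1r.
Qed.

Lemma WP_mean_not_cvg0 : ~ (WP_mean eta r @[r --> (1 : R)^'-] --> (0 : R)).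
Proof.
move=> hlim.
have [C1 [dl [q [/andP[dl0 dl1] /andP[q0 q1] hup]]]] := energy_growth_bound.
have [c c0 [m hlow]] := boundary_energy_growth B_lt1 K_neq0.
have lq : ln q < 0 by rewrite ln_lt0 // q0.
have pi0 : 0 < pi :> R := pi_gt0 R.
(* A mean below [e] bounds the energy of generation [n] by [16 * pi * e * n * (- ln q)] plus a
   constant; this [e] makes the slope [c / 2], half of the known growth rate. *)
pose e := c / (32 * pi * - ln q).
have e0 : 0 < e by rewrite divr_gt0 // !mulr_gt0 // oppr_gt0.
have : \forall r \near (1 : R)^'-, WP_mean eta r < e.
  by apply: (cvgr_lt _ hlim).
rewrite near_withinE => -[d /= d0 hd].
have bound r : 0 < 1 - r -> 1 - r < d -> 1 - r < 1 ->
    circle_integral r <= e * (4 * pi * `|ln (1 - r)|).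
  move=> h1 h2 h3.
  have := hd r; rewrite /ball_ /= (ger0_norm (ltW h1)) => /(_ h2).
  rewrite -subr_gt0 => /(_ h1); rewrite /WP_mean.
  have lr : 0 < `|ln (1 - r)| by rewrite normr_gt0 lt_eqF // ln_lt0 // h1.
  rewrite -/(circle_integral r) mulrC.
  have X0 : 0 < 4 * pi * `|ln (1 - r)| by rewrite !mulr_gt0.
  by rewrite (ltr_pdivrMr _ _ X0) => /ltW.
have [n1 hn1] : exists n1 : nat, forall n, (n1 <= n)%N -> dl * q ^+ n <
  Num.min d 1.
  have cv : (fun n => dl * q ^+ n) @ \oo --> (dl * 0 : R).
    by apply: cvgMr; apply: cvg_expr; rewrite gtr0_norm.
  rewrite mulr0 in cv; have mn : 0 < Num.min d 1 by rewrite lt_min d0 ltr01.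
  have [N _ hN] := cvgr_lt _ cv _ mn.
  by exists N => // n hn; apply: hN.
have final j : (n1 <= j)%N ->
   c * j%:R <= c / 2 * (m + j)%:R + (16 * e * pi * - ln dl + C1).
  move=> hj; apply: le_trans (hlow j) _.
  have hm1 : (n1 <= m + j)%N := leq_trans hj (leq_addl m j).
  apply: le_trans (hup _) _.
  have qn0 : 0 < q ^+ (m + j) by rewrite exprn_gt0.
  have dq0 : 0 < dl * q ^+ (m + j) by rewrite mulr_gt0.
  have := hn1 _ hm1; rewrite lt_min => /andP[hd1 hd2].
  have sE : 1 - (1 - dl * q ^+ (m + j)) = dl * q ^+ (m + j) by ring.
  have := bound (1 - dl * q ^+ (m + j)); rewrite sE => /(_ dq0 hd1 hd2) hb.
  have lnE : `|ln (dl * q ^+ (m + j))| = - ln dl + (m + j)%:R * - ln q.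
    rewrite ltr0_norm ?ln_lt0 ?dq0 // lnM ?posrE // lnXn // -mulr_natl; ring.
  rewrite lnE in hb.
  have eE : e * pi * - ln q = c / 32.
    have : e * (32 * pi * - ln q) = c.
      by rewrite /e divfK // gt_eqF // !mulr_gt0 // oppr_gt0.
    lra.
  have : e * (4 * pi * (- ln dl + (m + j)%:R * - ln q)) =
    4 * (e * pi * - ln q) * (m + j)%:R + 4 * e * pi * - ln dl by ring.
  move=> eqn; rewrite eqn eE in hb; lra.
pose A := c * m%:R / 2 + (16 * e * pi * - ln dl + C1).
have fin2 j : (n1 <= j)%N -> c / 2 * j%:R <= A.
  by move=> /final; rewrite natrD /A; lra.
have [j hj] : exists j : nat, A / (c / 2) < j%:R.
  by exists (Num.truncn (A / (c / 2))).+1; exact: truncnS_gt.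
have := fin2 (n1 + j)%N (leq_addr _ _).
rewrite ltr_pdivrMr in hj; last by rewrite divr_gt0.
have : j%:R <= (n1 + j)%:R :> R by rewrite ler_nat leq_addl.
have c2 : 0 < c / 2 by rewrite divr_gt0.
nra.
Qed.

End Core.

(** * Symmetry of second derivatives and holomorphy *)

(** The values at the four corners, grouped in either order; each grouping equals one mixed
    derivative times [d ^ 2]. *)
Lemma second_difference (R : realType) (x1 x2 x3 x4 y1 y2 z1 z2 D1 D2 d : R) :
  0 < d -> x1 + - x2 - (x3 + - x4) = (y1 + - y2) * d -> y1 - y2 = D1 * d ->
  x1 + - x3 - (x2 + - x4) = (z1 + - z2) * d -> z1 - z2 = D2 * d -> D1 = D2.
Proof.
move=> d0 E1 E2 E3 E4; rewrite E2 in E1; rewrite E4 in E3.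
apply: (mulIf (lt0r_neq0 d0)); apply: (mulIf (lt0r_neq0 d0)).
rewrite -E1 -E3; ring.
Qed.

Lemma dist_half (R : realType) (A X Y e : R) :
  `|A - X| < e / 2 -> `|A - Y| < e / 2 -> `|X - Y| <= e.
Proof.
rewrite (distrC A) => k1 k2; have := ler_distD A X Y; lra.
Qed.

Section Schwarz.
Variables (R : realType) (V : normedModType R).
Implicit Types (g : V -> R) (u v w p : V).

Lemma is_derive_line g p v (s : R) : derivable g (p + s *: v) v ->
  is_derive s (1 : R) (fun r => g (p + r *: v)) ('D_v g (p + s *: v)).
Proof.
have E : (fun h : R => h^-1 *: (((fun r => g (p + r *: v)) \o shift s)
  (h *: (1 : R))
     - g (p + s *: v))) =
  (fun h : R => h^-1 *: ((g \o shift (p + s *: v)) (h *: v) - g (p + s *: v))).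
  apply/funext => h; rewrite /shift /= [h *: (1 : R)]mulr1.
  by rewrite scalerDl addrCA.
move=> dg; split; first by rewrite /derivable E.
by rewrite /derive E.
Qed.

Lemma norm_open (W : set V) u : open W -> W u ->
  exists2 r : R, 0 < r & forall p, `|p - u| < r -> W p.
Proof.
rewrite openE => /(_ u) oW Wu; have /nbhs_ballP[r /= r0 hr] := oW Wu.
exists r => // p hp; apply: hr; rewrite -ball_normE /= distrC //.
Qed.

Lemma norm_continuous g u : {for u, continuous g} -> forall e : R, 0 < e ->
  exists2 r : R, 0 < r & forall p, `|p - u| < r -> `|g p - g u| < e.
Proof.
move=> cg e e0; have := cg;
  move=> /cvgrPdist_lt /(_ e e0) /nbhs_ballP[r /= r0 hr].
exists r => // p hp; rewrite distrC; apply: hr.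
by rewrite -ball_normE /= distrC.
Qed.

(* The second difference of [g] on a small parallelogram is a value of either
   mixed derivative, up to the same factor. *)
Lemma derive_comm (W : set V) g u v w : open W -> W u -> class_C 2 W g ->
  'D_w ('D_v g) u = 'D_v ('D_w g) u.
Proof.
move=> oW Wu [_ h]; have [dv [_ hv]] := h v; have [dw [_ hw]] := h w.
have [dvw [cvw _]] := hv w; have [dwv [cwv _]] := hw v.
apply/eqP; rewrite -subr_eq0 -normr_eq0 eq_le normr_ge0 andbT.
apply/ler_addgt0Pr => e e0; rewrite add0r.
have e2 : 0 < e / 2 by rewrite divr_gt0.
have [r1 r10 h1] := norm_open oW Wu.
have [r2 r20 h2] := norm_continuous (cvw u Wu) e2.
have [r3 r30 h3] := norm_continuous (cwv u Wu) e2.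
pose r := Num.min r1 (Num.min r2 r3).
have r0 : 0 < r by rewrite !lt_min r10 r20.
have m0 : 0 < 1 + `|v| + `|w| by have := normr_ge0 v; have := normr_ge0 w; lra.
pose d := r / (2 * (1 + `|v| + `|w|)).
have d0 : 0 < d by rewrite divr_gt0 // mulr_gt0.
pose P (s t : R) := u + s *: v + t *: w.
have close s t : 0 <= s <= d -> 0 <= t <= d -> `|P s t - u| < r.
  move=> /andP[s0 sd] /andP[t0 td]; rewrite /P -(addrA u) [_ - u]addrC addKr.
  apply: le_lt_trans (ler_normD _ _) _; rewrite !normrZ !ger0_norm //.
  apply: (@le_lt_trans _ _ (d * (1 + `|v| + `|w|))).
    have := ler_wpM2r (normr_ge0 v) sd; have := ler_wpM2r (normr_ge0 w) td; lra.
  have -> : d * (1 + `|v| + `|w|) = r / 2 by rewrite /d; field; rewrite gt_eqF.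
  lra.
have WP s t : 0 <= s <= d -> 0 <= t <= d -> W (P s t).
  by move=> hs ht; apply: h1; have := close s t hs ht;
    rewrite !lt_min => /andP[].
have PC s t : P s t = (u + t *: w) + s *: v by rewrite /P addrAC.
have dS t s : 0 <= s <= d -> 0 <= t <= d ->
    is_derive s (1 : R) (fun s => g (P s t)) ('D_v g (P s t)).
  move=> hs ht.
  have -> : (fun s => g (P s t)) = (fun s => g (u + t *: w + s *: v)).
    by apply/funext => x; rewrite PC.
  rewrite PC; apply: is_derive_line; rewrite -PC; apply: dv; exact: WP.
have dT s t : 0 <= s <= d -> 0 <= t <= d ->
    is_derive t (1 : R) (fun t => g (P s t)) ('D_w g (P s t)).
  by move=> hs ht; apply: is_derive_line; apply: dw; apply: WP.
have dST s t : 0 <= s <= d -> 0 <= t <= d ->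
    is_derive t (1 : R) (fun t => 'D_v g (P s t)) ('D_w ('D_v g) (P s t)).
  by move=> hs ht; apply: is_derive_line; apply: dvw; apply: WP.
have dTS t s : 0 <= s <= d -> 0 <= t <= d ->
    is_derive s (1 : R) (fun s => 'D_w g (P s t)) ('D_v ('D_w g) (P s t)).
  move=> hs ht.
  have -> : (fun s => 'D_w g (P s t)) = (fun s => 'D_w g (u + t *: w + s *: v)).
    by apply/funext => x; rewrite PC.
  rewrite PC; apply: is_derive_line; rewrite -PC; apply: dwv; exact: WP.
have mvt (f f' : R -> R) : (forall x, 0 <= x <=
  d -> is_derive x (1 : R) f (f' x)) ->
    exists2 c, 0 <= c <= d & f d - f 0 = f' c * d.
  move=> hf.
  have hf' x : x \in `]0, d[ -> is_derive x (1 : R) f (f' x).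
    by rewrite in_itv => /andP[/ltW a0 /ltW a1]; apply: hf; rewrite a0 a1.
  have cf : {within `[0, d], continuous f}.
    by apply: derivable_within_continuous => x; rewrite in_itv => /hf[].
  have [c] := MVT_segment (ltW d0) hf' cf.
  by rewrite in_itv subr0 => hc E; exists c.
have h0 : 0 <= (0 : R) <= d by rewrite lexx ltW.
have hd : 0 <= d <= d by rewrite lexx ltW.
have [s1 hs1 E1] := mvt _ _ (fun s hs => derD (dS d s hs hd)
  (derN (dS 0 s hs h0))).
have [t1 ht1 E2] := mvt _ _ (fun t ht => dST s1 t hs1 ht).
have [t2 ht2 E3] := mvt _ _ (fun t ht => derD (dT d t hd ht)
  (derN (dT 0 t h0 ht))).
have [s2 hs2 E4] := mvt _ _ (fun s hs => dTS t2 s hs ht2).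
have key : 'D_w ('D_v g) (P s1 t1) = 'D_v ('D_w g) (P s2 t2) :=
  second_difference d0 E1 E2 E3 E4.
have c1 := close _ _ hs1 ht1; have c2 := close _ _ hs2 ht2.
rewrite !lt_min in c1 c2.
move: c1 c2 => /and3P[_ c1 _] /and3P[_ _ c2].
have k1 := h2 _ c1; have k2 := h3 _ c2; rewrite key in k1.
exact: dist_half k1 k2.
Qed.

End Schwarz.

(** * From continuous partial derivatives to complex differentiability *)

Section PartialDerivatives.
Variable R : realType.

(** The increment is split along the path through [(x, y')], and the mean value theorem is applied
    to each side. *)
Lemma total_derivative (f fx fy : R -> R -> R) (x y r : R) : 0 < r ->
  (forall x' y', `|x' - x| < r -> `|y' - y| < r ->
     is_derive x' (1 : R) (fun s => f s y') (fx x' y') /\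
     is_derive y' (1 : R) (fun s => f x' s) (fy x' y')) ->
  (forall e : R, 0 < e -> exists2 d : R, 0 < d & forall x' y',
     `|x' - x| < d -> `|y' - y| < d ->
     `|fx x' y' - fx x y| < e /\ `|fy x' y' - fy x y| < e) ->
  forall e : R, 0 < e -> exists2 d : R, 0 < d & forall x' y',
    `|x' - x| < d -> `|y' - y| < d ->
    `|f x' y' - f x y - (fx x y * (x' - x) + fy x y * (y' - y))| <=
      e * (`|x' - x| + `|y' - y|).
Proof.
move=> r0 hd hc e e0; have [d d0 hcd] := hc e e0.
exists (Num.min r d); first by rewrite lt_min r0.
move=> x' y'; rewrite !lt_min => /andP[x1 x2] /andP[y1 y2].
have mvt (k k' : R -> R) (p q : R) :
    (forall s, `|s - p| <= `|q - p| -> is_derive s (1 : R) k (k' s)) ->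
    exists2 c, `|c - p| <= `|q - p| & k q - k p = k' c * (q - p).
  move=> hk; have [pq|qp] := leP p q.
    have in1 s : p <= s <= q -> `|s - p| <= `|q - p|.
      by move=> /andP[h1 h2]; rewrite !ger0_norm ?subr_ge0 // lerD2r.
    have hk' s : s \in `]p, q[ -> is_derive s (1 : R) k (k' s).
      rewrite in_itv => /andP[/ltW h1 /ltW h2]; apply: hk; apply: in1;
        by rewrite h1.
    have ck : {within `[p, q], continuous k}.
      by apply: derivable_within_continuous => s; rewrite in_itv => /in1/hk[].
    have [c] := MVT_segment pq hk' ck; rewrite in_itv => /in1 hc' E.
    by exists c.
  have in1 s : q <= s <= p -> `|s - p| <= `|q - p|.
    move=> /andP[h1 h2]; rewrite !ler0_norm ?subr_le0 //; last exact: ltW.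
    by rewrite lerN2 lerD2r.
  have hk' s : s \in `]q, p[ -> is_derive s (1 : R) k (k' s).
    rewrite in_itv => /andP[/ltW h1 /ltW h2]; apply: hk; apply: in1;
      by rewrite h1.
  have ck : {within `[q, p], continuous k}.
    by apply: derivable_within_continuous => s; rewrite in_itv => /in1/hk[].
  have [c] := MVT_segment (ltW qp) hk' ck; rewrite in_itv => /in1 hc' E.
  exists c => //; lra.
have [c1 hc1 E1] := mvt (fun s => f s y') (fun s => fx s y') x x'
  (fun s hs => (hd s y' (le_lt_trans hs x1) y1).1).
have xx : `|x - x| < r by rewrite subrr normr0.
have [c2 hc2 E2] := mvt (fun s => f x s) (fun s => fy x s) y y'
  (fun s hs => (hd x s xx (le_lt_trans hs y1)).2).
have xd : `|x - x| < d by rewrite subrr normr0.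
have [k1 _] := hcd _ _ (le_lt_trans hc1 x2) y2.
have [_ k2] := hcd _ _ xd (le_lt_trans hc2 y2).
have -> : f x' y' - f x y - (fx x y * (x' - x) + fy x y * (y' - y)) =
  (fx c1 y' - fx x y) * (x' - x) + (fy x c2 - fy x y) * (y' - y).
  have -> : f x' y' - f x y = (f x' y' - f x y') + (f x y' - f x y) by ring.
  rewrite E1 E2; ring.
apply: le_trans (ler_normD _ _) _; rewrite !normrM mulrDr.
by apply: lerD; apply: ler_wpM2r => //; exact: ltW.
Qed.

Lemma cauchy_riemann (f : C R -> C R) (a b ax ay bx by_ : R -> R -> R) (z : C R)
  (r : R) :
  0 < r ->
  (forall w, modulus (w - z) < r -> f w =
    Complex (a (complex.Re w) (complex.Im w))
     (b (complex.Re w) (complex.Im w))) ->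
  (forall x' y', `|x' - complex.Re z| < r -> `|y' - complex.Im z| < r ->
     is_derive x' (1 : R) (fun s => a s y') (ax x' y') /\
     is_derive y' (1 : R) (fun s => a x' s) (ay x' y')) ->
  (forall x' y', `|x' - complex.Re z| < r -> `|y' - complex.Im z| < r ->
     is_derive x' (1 : R) (fun s => b s y') (bx x' y') /\
     is_derive y' (1 : R) (fun s => b x' s) (by_ x' y')) ->
  (forall e : R, 0 < e -> exists2 d : R, 0 < d & forall x' y',
     `|x' - complex.Re z| < d -> `|y' - complex.Im z| < d ->
     `|ax x' y' - ax (complex.Re z) (complex.Im z)| < e /\
     `|ay x' y' - ay (complex.Re z) (complex.Im z)| < e) ->
  (forall e : R, 0 < e -> exists2 d : R, 0 < d & forall x' y',
     `|x' - complex.Re z| < d -> `|y' - complex.Im z| < d ->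
     `|bx x' y' - bx (complex.Re z) (complex.Im z)| < e /\
     `|by_ x' y' - by_ (complex.Re z) (complex.Im z)| < e) ->
  ax (complex.Re z) (complex.Im z) = by_ (complex.Re z) (complex.Im z) ->
  ay (complex.Re z) (complex.Im z) = - bx (complex.Re z) (complex.Im z) ->
  cdiff f z (Complex (ax (complex.Re z) (complex.Im z))
    (bx (complex.Re z) (complex.Im z))).
Proof.
move=> r0 fE da db ca cb cr1 cr2 e e0.
have e4 : 0 < e / 4 by rewrite divr_gt0.
have [d1 d10 h1] := total_derivative r0 da ca e4.
have [d2 d20 h2] := total_derivative r0 db cb e4.
exists (Num.min r (Num.min d1 d2)); first by rewrite !lt_min r0 d10.
move=> w; rewrite !lt_min => /and3P[wr w1 w2].
have zz : modulus (z - z) < r by rewrite subrr modulus0.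
rewrite (fE w wr) (fE z zz).
have hre := Re_le_modulus (w - z); have him := Im_le_modulus (w - z).
rewrite !(Re_add, Im_add, Re_opp, Im_opp) in hre him.
have k1 := h1 _ _ (le_lt_trans hre w1) (le_lt_trans him w1).
have k2 := h2 _ _ (le_lt_trans hre w2) (le_lt_trans him w2).
apply: le_trans (modulus_le_ReIm _) _.
rewrite !(Re_add, Im_add, Re_opp, Im_opp, Re_mul, Im_mul) /=.
rewrite cr2 in k1; rewrite -cr1 in k2.
set p := complex.Re w in k1 k2 hre *; set q := complex.Im w in k1 k2 him *.
set x := complex.Re z in k1 k2 hre *; set y := complex.Im z in k1 k2 him *.
have -> : a p q - a x y - (ax x y * (p - x) - bx x y * (q - y)) =
  a p q - a x y - (ax x y * (p - x) + - bx x y * (q - y)) by ring.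
have -> : b p q - b x y - (ax x y * (q - y) + bx x y * (p - x)) =
  b p q - b x y - (bx x y * (p - x) + ax x y * (q - y)) by ring.
apply: le_trans (lerD k1 k2) _.
have := ler_wpM2l (ltW e4) (lerD hre him); lra.
Qed.

End PartialDerivatives.

(** * The variation of a smooth family *)

Section VariationField.
Variables (R : realType) (H : R -> P1 R -> P1 R).
Hypothesis H_smooth : smooth_family H.
Hypothesis H_conformal : forall t, param t -> conformal_on disk (H t).
Hypothesis H0 : forall z, disk z -> H 0 z = z.

Local Notation E := (R * R * R)%type.

Definition variation (z : C R) : C R := ddt0 (fun t => affine (H t (fin z))).

Definition reH (u : E) : R := complex.Re
  (affine (H u.1.1 (fin (Complex u.1.2 u.2)))).
Definition imH (u : E) : R := complex.Im
  (affine (H u.1.1 (fin (Complex u.1.2 u.2)))).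

Definition dir_t : E := (1, 0, 0).
Definition dir_x : E := (0, 1, 0).
Definition dir_y : E := (0, 0, 1).

Lemma is_derive_dir_t (g : E -> R) t x y : derivable g (t, x, y) dir_t ->
  is_derive t (1 : R) (fun s => g (s, x, y)) ('D_dir_t g (t, x, y)).
Proof.
have e s : (s, x, y) = (0, x, y) + s *: dir_t :> E.
  by rewrite -[RHS]/(0 + s * 1, x + s * 0, y + s * 0) mulr1 !mulr0 !addr0 add0r.
have -> : (fun s => g (s, x, y)) = (fun s => g ((0, x, y) + s *: dir_t)).
  by apply/funext => s; rewrite -e.
by rewrite e; apply: is_derive_line.
Qed.

Lemma is_derive_dir_x (g : E -> R) t x y : derivable g (t, x, y) dir_x ->
  is_derive x (1 : R) (fun s => g (t, s, y)) ('D_dir_x g (t, x, y)).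
Proof.
have e s : (t, s, y) = (t, 0, y) + s *: dir_x :> E.
  by rewrite -[RHS]/(t + s * 0, 0 + s * 1, y + s * 0) mulr1 !mulr0 !addr0 add0r.
have -> : (fun s => g (t, s, y)) = (fun s => g ((t, 0, y) + s *: dir_x)).
  by apply/funext => s; rewrite -e.
by rewrite e; apply: is_derive_line.
Qed.

Lemma is_derive_dir_y (g : E -> R) t x y : derivable g (t, x, y) dir_y ->
  is_derive y (1 : R) (fun s => g (t, x, s)) ('D_dir_y g (t, x, y)).
Proof.
have e s : (t, x, s) = (t, x, 0) + s *: dir_y :> E.
  by rewrite -[RHS]/(t + s * 0, x + s * 0, 0 + s * 1) mulr1 !mulr0 !addr0 add0r.
have -> : (fun s => g (t, x, s)) = (fun s => g ((t, x, 0) + s *: dir_y)).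
  by apply/funext => s; rewrite -e.
by rewrite e; apply: is_derive_line.
Qed.

Lemma open_box (W : set E) (t x y : R) : open W -> W (t, x, y) ->
  exists2 r : R, 0 < r & forall t' x' y',
    `|t' - t| < r -> `|x' - x| < r -> `|y' - y| < r -> W (t', x', y').
Proof.
rewrite openE => oW Wu; have /nbhs_ballP[r /= r0 hr] := oW _ Wu.
exists r => // t' x' y' h1 h2 h3; apply: hr.
by split; [split|]; rewrite /ball /= distrC.
Qed.

Lemma continuous_box (g : E -> R) (t x y : R) : {for (t, x, y), continuous g} ->
  forall e : R, 0 < e -> exists2 r : R, 0 < r & forall t' x' y',
    `|t' - t| < r -> `|x' - x| < r -> `|y' - y| < r ->
    `|g (t', x', y') - g (t, x, y)| < e.
Proof.
move=> cg e e0; have := cg;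
  move=> /cvgrPdist_lt /(_ e e0) /nbhs_ballP[r /= r0 hr].
exists r => // t' x' y' h1 h2 h3; rewrite distrC; apply: hr.
by split; [split|]; rewrite /ball /= distrC.
Qed.

(** At [t = 0] the value is the finite point [z], so the chart of the target is the affine
    coordinate throughout the neighborhood. *)
Lemma family_chart (z : C R) : modulus z < 1 ->
  exists W : set E, [/\ open W, W (0, complex.Re z, complex.Im z),
    (forall u, W u -> H u.1.1 (fin (Complex u.1.2 u.2)) <> infty),
    class_C 2 W reH & class_C 2 W imH].
Proof.
move=> z1; have p0 : param (0 : R) by rewrite /param /= in_itv /= oppr_lt0
  !ltr01.
have nz : `|z| < 1 by rewrite normc_lt1.
have [W [oW Wz dom sm]] := H_smooth p0 nz.
have Hz : H 0 (fin z) = fin z by apply: H0.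
rewrite Hz in dom sm.
have [s1 s2] := sm 2%N.
by exists W; split; [exact: oW | exact: Wz | exact: dom | exact: s1 |
  exact: s2].
Qed.

Lemma family_box (z : C R) : modulus z < 1 ->
  exists2 r : R, 0 < r & forall t x y, `|t| < r ->
    `|x - complex.Re z| < r -> `|y - complex.Im z| < r ->
    param t /\ modulus (Complex x y : C R) < 1.
Proof.
move=> z1; exists (Num.min 1 ((1 - modulus z) / 2)).
  by rewrite lt_min ltr01 divr_gt0 // subr_gt0.
move=> t x y; rewrite !lt_min => /andP[t1 _] /andP[_ hx] /andP[_ hy]; split.
  by rewrite /param /= in_itv /= -ltr_norml.
have -> : Complex x y = z + (Complex x y - z) :> C R by rewrite addrC subrK.
apply: le_lt_trans (modulusD _ _) _.
have := modulus_le_ReIm (Complex x y - z : C R).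
by rewrite !(Re_add, Im_add, Re_opp, Im_opp) /=; lra.
Qed.

Lemma derivative_unique (f : R -> R) (x a b : R) : is_derive x (1 : R) f a ->
  is_derive x (1 : R) f b -> a = b.
Proof. by move=> [_ <-] [_ <-]. Qed.

Lemma is_derive_near_eq (f g : R -> R) (x a r : R) : 0 < r ->
  (forall t, `|t - x| < r -> f t = g t) ->
  is_derive x (1 : R) f a -> is_derive x (1 : R) g a.
Proof.
move=> r0 fg /is_derive_eps h; apply/is_derive_eps => e e0.
have [d d0 hd] := h e e0; exists (Num.min r d); first by rewrite lt_min r0.
move=> t; rewrite lt_min => /andP[t1 t2]; rewrite -!fg //; first exact: hd.
by rewrite subrr normr0.
Qed.

Lemma family_CR (W : set E) t x y : open W -> W (t, x, y) ->
  (forall u, W u -> H u.1.1 (fin (Complex u.1.2 u.2)) <> infty) ->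
  class_C 2 W reH -> class_C 2 W imH ->
  param t -> modulus (Complex x y : C R) < 1 ->
  'D_dir_x reH (t, x, y) = 'D_dir_y imH (t, x, y) /\
  'D_dir_y reH (t, x, y) = - 'D_dir_x imH (t, x, y).
Proof.
move=> oW Wu dom [_ ca] [_ cb] pt z1; set z := Complex x y in z1.
have dz : disk (fin z) by rewrite /disk /= normc_lt1.
have [hol _] := H_conformal pt; have [_] := hol _ dz.
have hfin := dom _ Wu; rewrite /= -/z in hfin.
have -> : (fun w => chart (H t (fin z)) (H t (unchart (fin z) w))) =
   (fun w => affine (H t (fin w))).
  by apply/funext => w; case: (H t (fin z)) hfin.
move=> dv; pose d := 'D_1 (fun w => affine (H t (fin w))) z.
have cd : cdiff (fun w => affine (H t (fin w))) z d.
  by apply/cdiffP; split.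
have gx : rdiff (fun s => Complex s y : C R) x 1 by split;
  [exact: derI|exact: derC].
have gy : rdiff (fun s => Complex x s : C R) y (iunit R) by split;
  [exact: derC|exact: derI].
have [a1 b1] := rdiff_cdiff (g := fun s => Complex s y) cd gx.
have [a2 b2] := rdiff_cdiff (g := fun s => Complex x s) cd gy.
have e1 := derivative_unique a1 (is_derive_dir_x ((ca dir_x).1 _ Wu)).
have e2 := derivative_unique b1 (is_derive_dir_x ((cb dir_x).1 _ Wu)).
have e3 := derivative_unique a2 (is_derive_dir_y ((ca dir_y).1 _ Wu)).
have e4 := derivative_unique b2 (is_derive_dir_y ((cb dir_y).1 _ Wu)).
rewrite -e1 -e2 -e3 -e4 !(Re_mul, Im_mul) /=; split; ring.
Qed.

Lemma variationE (W : set E) x y : W (0, x, y) ->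
  class_C 2 W reH -> class_C 2 W imH ->
  variation (Complex x y) = Complex ('D_dir_t reH (0, x, y))
    ('D_dir_t imH (0, x, y)).
Proof.
move=> Wu [_ ca] [_ cb].
have [_ e1] := is_derive_dir_t ((ca dir_t).1 _ Wu).
have [_ e2] := is_derive_dir_t ((cb dir_t).1 _ Wu).
by rewrite /variation /ddt0 !derive1E -e1 -e2.
Qed.

(** The derivative of the variation, written as a mixed second derivative of the family; its
    continuity is then part of the smoothness of [H]. *)
Definition dvariation (z : C R) : C R :=
  Complex ('D_dir_x ('D_dir_t reH) (0, complex.Re z, complex.Im z))
          ('D_dir_x ('D_dir_t imH) (0, complex.Re z, complex.Im z)).

(** Each [H t] satisfies the Cauchy-Riemann equations. Differentiating them in [t] and exchanging
    the order of derivatives gives these equations for the variation, whose partial derivatives are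
    continuous. *)
Lemma cdiff_variation z : modulus z < 1 -> cdiff variation z (dvariation z).
Proof.
move=> z1; have [W [oW Wz dom sa sb]] := family_chart z1.
have [r1 r10 h1] := open_box oW Wz; have [r2 r20 h2] := family_box z1.
pose r := Num.min r1 r2; have r0 : 0 < r by rewrite lt_min r10.
have inW t x y : `|t| < r -> `|x - complex.Re z| < r -> `|y - complex.Im z| <
  r ->
    W (t, x, y).
  by rewrite !lt_min => /andP[? _] /andP[? _] /andP[? _]; apply: h1;
    rewrite ?subr0.
have z00 : `|0 : R| < r by rewrite normr0.
have [_ ca] := sa; have [_ cb] := sb.
have [_ [_ cat]] := ca dir_t; have [_ [_ cbt]] := cb dir_t.
have cr t : `|t| < r ->
    'D_dir_x reH (t, complex.Re z, complex.Im z) =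
      'D_dir_y imH (t, complex.Re z, complex.Im z) /\
    'D_dir_y reH (t, complex.Re z, complex.Im z) =
      - 'D_dir_x imH (t, complex.Re z, complex.Im z).
  move=> tr; have [|||pt m1] := h2 t (complex.Re z) (complex.Im z).
  - by move: tr; rewrite lt_min => /andP[].
  - by rewrite subrr normr0.
  - by rewrite subrr normr0.
  apply: (family_CR oW) => //; apply: inW => //; by rewrite subrr normr0.
have dd (g : E -> R) v : class_C 2 W g ->
    is_derive (0 : R) (1 : R) (fun s => 'D_v g (s, complex.Re z, complex.Im z))
      ('D_dir_t ('D_v g) (0, complex.Re z, complex.Im z)).
  move=> [_ cg]; apply: is_derive_dir_t; exact: ((cg v).2.2 dir_t).1.
have cr1 : 'D_dir_x ('D_dir_t reH) (0, complex.Re z, complex.Im z) =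
    'D_dir_y ('D_dir_t imH) (0, complex.Re z, complex.Im z).
  rewrite (derive_comm dir_t dir_x oW Wz sa) (derive_comm dir_t dir_y oW Wz sb).
  apply: derivative_unique (dd imH dir_y sb).
  apply: (is_derive_near_eq r0 _ (dd reH dir_x sa)) => t; rewrite subr0 => tr.
  by have [-> _] := cr t tr.
have cr2 : 'D_dir_y ('D_dir_t reH) (0, complex.Re z, complex.Im z) =
    - 'D_dir_x ('D_dir_t imH) (0, complex.Re z, complex.Im z).
  rewrite (derive_comm dir_t dir_y oW Wz sa) (derive_comm dir_t dir_x oW Wz sb).
  apply: derivative_unique (derN (dd imH dir_x sb)).
  apply: (is_derive_near_eq r0 _ (dd reH dir_y sa)) => t; rewrite subr0 => tr.
  by have [_ ->] := cr t tr.
have der (g : E -> R) : class_C 2 W g -> forall x' y',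
     `|x' - complex.Re z| < r -> `|y' - complex.Im z| < r ->
     is_derive x' (1 : R) (fun s => 'D_dir_t g (0, s, y'))
       ('D_dir_x ('D_dir_t g) (0, x', y')) /\
     is_derive y' (1 : R) (fun s => 'D_dir_t g (0, x', s))
       ('D_dir_y ('D_dir_t g) (0, x', y')).
  move=> [_ cg] x' y' hx hy; have [_ [_ cgt]] := cg dir_t.
  by split; [apply: is_derive_dir_x;
    apply: (cgt dir_x).1 | apply: is_derive_dir_y; apply: (cgt dir_y).1];
    apply: inW.
have cont (g : E -> R) : class_C 2 W g -> forall e : R, 0 < e ->
    exists2 d : R, 0 < d & forall x' y',
     `|x' - complex.Re z| < d -> `|y' - complex.Im z| < d ->
     `|'D_dir_x ('D_dir_t g) (0, x', y') - 'D_dir_x ('D_dir_t g)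
       (0, complex.Re z, complex.Im z)| < e /\
     `|'D_dir_y ('D_dir_t g) (0, x', y') - 'D_dir_y ('D_dir_t g)
       (0, complex.Re z, complex.Im z)| < e.
  move=> [_ cg] e e0; have [_ [_ cgt]] := cg dir_t.
  have [d1 d10 k1] := continuous_box ((cgt dir_x).2.1 _ Wz) e0.
  have [d2 d20 k2] := continuous_box ((cgt dir_y).2.1 _ Wz) e0.
  exists (Num.min d1 d2); first by rewrite lt_min d10.
  move=> x' y'; rewrite !lt_min => /andP[x1 x2] /andP[y1 y2].
  by split; [apply: k1 | apply: k2]; rewrite ?subrr ?normr0.
have fE w : modulus (w - z) < r -> variation w =
    Complex ('D_dir_t reH (0, complex.Re w, complex.Im w))
      ('D_dir_t imH (0, complex.Re w, complex.Im w)).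
  case: w => x y wr.
  have hx : `|x - complex.Re z| < r.
    by apply: le_lt_trans wr; have := Re_le_modulus (Complex x y - z);
      rewrite Re_add Re_opp.
  have hy : `|y - complex.Im z| < r.
    by apply: le_lt_trans wr; have := Im_le_modulus (Complex x y - z);
      rewrite Im_add Im_opp.
  exact: (variationE (inW 0 x y z00 hx hy) sa sb).
exact: (cauchy_riemann (a := fun x y => 'D_dir_t reH (0, x, y))
  (b := fun x y => 'D_dir_t imH (0, x, y))
  (ax := fun x y => 'D_dir_x ('D_dir_t reH) (0, x, y))
  (ay := fun x y => 'D_dir_y ('D_dir_t reH) (0, x, y))
  (bx := fun x y => 'D_dir_x ('D_dir_t imH) (0, x, y))
  (by_ := fun x y => 'D_dir_y ('D_dir_t imH) (0, x, y))
  r0 fE (der _ sa) (der _ sb) (cont _ sa) (cont _ sb) cr1 cr2).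
Qed.

Lemma derive1_variation z : modulus z < 1 -> derive1 variation z = dvariation z.
Proof.
by move=> /cdiff_variation/cdiffP[_ <-]; rewrite derive1E.
Qed.

Lemma variation_diff z : modulus z < 1 ->
  cdiff variation z (derive1 variation z).
Proof. by move=> z1; rewrite derive1_variation //; apply: cdiff_variation. Qed.

Lemma dvariation_cont z : modulus z < 1 -> ccont (derive1 variation) z.
Proof.
move=> z1 e e0; have [W [oW Wz dom [_ ca] [_ cb]]] := family_chart z1.
have [_ [_ cat]] := ca dir_t; have [_ [_ cbt]] := cb dir_t.
have e2 : 0 < e / 2 by rewrite divr_gt0.
have [d1 d10 k1] := continuous_box ((cat dir_x).2.1 _ Wz) e2.
have [d2 d20 k2] := continuous_box ((cbt dir_x).2.1 _ Wz) e2.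
exists (Num.min (1 - modulus z) (Num.min d1 d2)).
  by rewrite !lt_min subr_gt0 z1 d10.
move=> w; rewrite !lt_min => /and3P[w0 w1 w2].
have wz := modulus_rev w z.
rewrite !derive1_variation //; last by lra.
apply: le_lt_trans (modulus_le_ReIm _) _.
rewrite !(Re_add, Im_add, Re_opp, Im_opp) /=.
have hre := Re_le_modulus (w - z); have him := Im_le_modulus (w - z).
rewrite !(Re_add, Im_add, Re_opp, Im_opp) in hre him.
have h1 := k1 0 _ _ _ (le_lt_trans hre w1) (le_lt_trans him w1).
have h2 := k2 0 _ _ _ (le_lt_trans hre w2) (le_lt_trans him w2).
rewrite subrr normr0 in h1 h2.
by rewrite [ltRHS]splitr; exact: ltrD (h1 d10) (h2 d20).
Qed.

Lemma rdiff_family z : modulus z < 1 ->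
  rdiff (fun t => affine (H t (fin z))) 0 (variation z).
Proof.
move=> z1; have [W [oW Wz dom sa sb]] := family_chart z1.
have Ez : z = Complex (complex.Re z) (complex.Im z) by case: z {z1 Wz}.
rewrite {2}Ez (variationE Wz sa sb); have [_ ca] := sa; have [_ cb] := sb.
split.
  have h := is_derive_dir_t ((ca dir_t).1 _ Wz).
  by apply: der_eq h _ _ => // t; rewrite /reH /= -Ez.
have h := is_derive_dir_t ((cb dir_t).1 _ Wz).
by apply: der_eq h _ _ => // t; rewrite /imH /= -Ez.
Qed.

Lemma family_finite z : modulus z < 1 ->
  exists2 r : R, 0 < r & forall t, `|t| < r -> H t (fin z) <> infty.
Proof.
move=> z1; have [W [oW Wz dom _ _]] := family_chart z1.
have [r r0 hr] := open_box oW Wz; exists r => // t tr.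
have Wt : W (t, complex.Re z, complex.Im z).
  by apply: hr; rewrite ?subr0 ?subrr ?normr0.
have := dom _ Wt; by case: (z) {z1 Wz hr Wt}.
Qed.

End VariationField.

(** * Quadratic and Moebius maps in homogeneous coordinates *)

Section Homogeneous.
Variable R : realType.
Implicit Types (X Y a b c e : C R) (x : P1 R).

(** The point with homogeneous coordinates [[a : b]]. The pair [(0, 0)] is sent to infinity, hence
    the condition [nz] in what follows. *)
Definition point a b : P1 R := if b == 0 then infty else fin (a / b).

Lemma pointZ (k a b : C R) : k != 0 -> point (k * a) (k * b) = point a b.
Proof.
move=> k0; rewrite /point mulf_eq0 (negPf k0) /=; case: eqP => // /eqP b0.
by congr fin; field; rewrite b0 k0.
Qed.

Lemma point_fin (z : C R) : point z 1 = fin z.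
Proof. by rewrite /point oner_eq0 divr1. Qed.

Lemma point_infty : point 1 0 = infty.
Proof. by rewrite /point eqxx. Qed.

(** Holds for [b = 0] as well, since [affine infty] and [a / 0] are both 0. *)
Lemma affine_point a b : affine (point a b) = a / b.
Proof. by rewrite /point; case: eqP => [->|//] /=; rewrite invr0 mulr0. Qed.

Definition nz (a b : C R) := (a != 0) || (b != 0).

Lemma point_onto x : exists X Y, nz X Y /\ x = point X Y.
Proof.
case: x => [z|]; last by exists 1, 0; rewrite point_infty /nz oner_eq0.
by exists z, 1; rewrite -[Some z]/(fin z) -point_fin /nz oner_eq0 orbT.
Qed.

Lemma nz0 a b : ~~ nz a b -> a = 0 /\ b = 0.
Proof. by rewrite negb_or !negbK => /andP[/eqP -> /eqP ->]. Qed.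

Lemma point_eq_fin a b z : point a b = fin z -> b != 0 /\ a = z * b.
Proof.
rewrite /point; case: eqP => // /eqP b0 [<-]; split => //.
by rewrite divfK.
Qed.

Lemma point_eq_infty a b : point a b = infty -> b = 0.
Proof. by rewrite /point; case: eqP. Qed.

Lemma inv_point a b : nz a b -> inv (point a b) = point b a.
Proof.
rewrite /nz /point; case: (eqVneq b 0) => [->|b0] /=.
  by rewrite orbF => /negPf ->; rewrite mul0r.
move=> _; rewrite mulf_eq0 invr_eq0 (negPf b0) orbF; case: eqP => // _.
by rewrite invf_div.
Qed.

Lemma invK x : inv (inv x) = x.
Proof.
have [X [Y [n ->]]] := point_onto x.
by rewrite !inv_point // /nz orbC.
Qed.

Definition mobmap (phi : P1 R -> P1 R) := exists a b c e,
  a * e - b * c != 0 /\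
  forall X Y, nz X Y -> phi (point X Y) = point (a * X + b * Y) (c * X + e * Y).

Lemma mob_nz a b c e X Y : a * e - b * c != 0 -> nz X Y ->
  nz (a * X + b * Y) (c * X + e * Y).
Proof.
move=> d0; apply: contraTT => /nz0[h1 h2]; rewrite /nz negb_or !negbK.
apply/andP; split; apply/eqP; apply: (mulfI d0); rewrite mulr0.
  have -> : (a * e - b * c) * X = e * (a * X + b * Y) - b * (c * X + e * Y)
    by ring.
  by rewrite h1 h2 !mulr0 subrr.
have -> : (a * e - b * c) * Y = a * (c * X + e * Y) - c * (a * X + b * Y)
  by ring.
by rewrite h1 h2 !mulr0 subrr.
Qed.

(** Coprimality of the two forms is expressed by their having no common zero, a condition that
    passes through linear substitutions and hence through conjugation. *)
Definition quadmap (F : P1 R -> P1 R) := exists p0 p1 p2 q0 q1 q2 : C R,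
  (forall X Y, nz X Y -> nz (p0 * Y ^+ 2 + p1 * X * Y + p2 * X ^+ 2)
     (q0 * Y ^+ 2 + q1 * X * Y + q2 * X ^+ 2)) /\
  forall X Y, nz X Y -> F (point X Y) =
     point (p0 * Y ^+ 2 + p1 * X * Y + p2 * X ^+ 2)
     (q0 * Y ^+ 2 + q1 * X * Y + q2 * X ^+ 2).

Lemma mobmap_inverse phi psi : mobmap phi -> cancel phi psi -> cancel psi phi ->
  mobmap psi.
Proof.
move=> [a [b [c [e [d0 h]]]]] k1 k2; exists e, (- b), (- c), a.
have d0' : e * a - - b * - c != 0 by rewrite mulrNN mulrC.
split=> // X Y n; apply: (can_inj k1); rewrite k2.
have n' := mob_nz d0' n; rewrite (h _ _ n') -(pointZ X Y d0).
congr point; ring.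
Qed.

Lemma mobmap_comp phi psi : mobmap phi -> mobmap psi -> mobmap (phi \o psi).
Proof.
move=> [a [b [c [e [d0 h]]]]] [a' [b' [c' [e' [d0' h']]]]].
exists (a * a' + b * c'), (a * b' + b * e'), (c * a' + e * c'),
  (c * b' + e * e').
split.
  have -> : (a * a' + b * c') * (c * b' + e * e') - (a * b' + b * e')
    * (c * a' + e * c') =
    (a * e - b * c) * (a' * e' - b' * c') by ring.
  by rewrite mulf_neq0.
move=> X Y n /=; rewrite h' // h; last exact: mob_nz.
congr point; ring.
Qed.

Lemma quadmap_conj F phi psi : quadmap F -> mobmap phi -> mobmap psi ->
  quadmap (phi \o F \o psi).
Proof.
move=> [p0 [p1 [p2 [q0 [q1 [q2 [nF hF]]]]]]] [a [b [c [e [d0 h]]]]]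
  [a' [b' [c' [e' [d0' h']]]]].
pose s0 (k0 k1 k2 : C R) := k0 * e' ^+ 2 + k1 * b' * e' + k2 * b' ^+ 2.
pose s1 (k0 k1 k2 : C R) := k0 * (c' * e') *+ 2 + k1 * (a' * e' + b' * c') +
  k2 * (a' * b') *+ 2.
pose s2 (k0 k1 k2 : C R) := k0 * c' ^+ 2 + k1 * a' * c' + k2 * a' ^+ 2.
pose P := [:: a * s0 p0 p1 p2 + b * s0 q0 q1 q2;
  a * s1 p0 p1 p2 + b * s1 q0 q1 q2;
  a * s2 p0 p1 p2 + b * s2 q0 q1 q2; c * s0 p0 p1 p2 + e * s0 q0 q1 q2;
  c * s1 p0 p1 p2 + e * s1 q0 q1 q2; c * s2 p0 p1 p2 + e * s2 q0 q1 q2].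
exists P`_0, P`_1, P`_2, P`_3, P`_4, P`_5.
have E1 (k0 k1 k2 X Y : C R) : k0 * (c' * X + e' * Y) ^+ 2 +
    k1 * (a' * X + b' * Y) * (c' * X + e' * Y) + k2 * (a' * X + b' * Y) ^+ 2 =
   s0 k0 k1 k2 * Y ^+ 2 + s1 k0 k1 k2 * X * Y + s2 k0 k1 k2 * X ^+ 2.
  by rewrite /s0 /s1 /s2; ring.
have E2 (u v X Y : C R) : (u * s0 p0 p1 p2 + v * s0 q0 q1 q2) * Y ^+ 2 +
   (u * s1 p0 p1 p2 + v * s1 q0 q1 q2) * X * Y +
   (u * s2 p0 p1 p2 + v * s2 q0 q1 q2) * X ^+ 2 =
   u * (p0 * (c' * X + e' * Y) ^+ 2 +
    p1 * (a' * X + b' * Y) * (c' * X + e' * Y) + p2 * (a' * X + b' * Y) ^+ 2) +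
   v * (q0 * (c' * X + e' * Y) ^+ 2 +
    q1 * (a' * X + b' * Y) * (c' * X + e' * Y) + q2 * (a' * X + b' * Y) ^+ 2).
  by rewrite !E1; ring.
rewrite /P /=; split=> X Y n; have n' := mob_nz d0' n; rewrite !E2.
  by apply: mob_nz => //; apply: nF.
by rewrite h' // hF // h //; apply: nF.
Qed.

Lemma mobmap_fix3 phi : mobmap phi -> phi (fin 0) = fin 0 ->
  phi infty = infty -> phi (fin 1) = fin 1 -> forall x, phi x = x.
Proof.
move=> [a [b [c [e [d0 h]]]]] f0 foo f1 x.
have n01 : nz (0 : C R) 1 by rewrite /nz oner_eq0 orbT.
have n10 : nz (1 : C R) 0 by rewrite /nz oner_eq0.
have n11 : nz (1 : C R) 1 by rewrite /nz oner_eq0.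
move: f0; rewrite -{1}(point_fin 0) h // => /point_eq_fin[_].
rewrite mulr0 add0r mulr1 mul0r => b0.
move: foo; rewrite -{1}point_infty h // => /point_eq_infty.
rewrite mulr0 addr0 mulr1 => c0.
move: f1; rewrite -{1}(point_fin 1) h // => /point_eq_fin[_].
rewrite b0 c0 !mulr1 mul1r addr0 add0r => ae.
rewrite b0 c0 ae mul0r subr0 mulf_eq0 orbb in d0.
have [X [Y [n ->]]] := point_onto x.
by rewrite h // b0 c0 ae !mul0r addr0 add0r pointZ.
Qed.

(* In the affine coordinate, [z |-> z (A z + al) / (D z + 1)]. *)
Definition std_form (F : P1 R -> P1 R) (A al D : C R) :=
  [/\ A != 0, A - al * D != 0, A + al = D + 1 &
  forall X Y, nz X Y ->
    F (point X Y) = point (X * (A * X + al * Y)) (Y * (D * X + Y))].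

Lemma quadmap_std F : quadmap F -> F (fin 0) = fin 0 -> F infty = infty ->
  F (fin 1) = fin 1 -> exists A al D, std_form F A al D.
Proof.
move=> [p0 [p1 [p2 [q0 [q1 [q2 [n h]]]]]]] f0 foo f1.
have n01 : nz (0 : C R) 1 by rewrite /nz oner_eq0 orbT.
have n10 : nz (1 : C R) 0 by rewrite /nz oner_eq0.
have n11 : nz (1 : C R) 1 by rewrite /nz oner_eq0.
move: f0; rewrite -{1}(point_fin 0) h // => /point_eq_fin[].
rewrite expr1n expr0n /= !mulr0 !mul0r !addr0 !mulr1 => q00 p00.
move: foo; rewrite -{1}point_infty h // => /point_eq_infty.
rewrite expr0n expr1n /= !mulr0 !add0r mulr1 => q20.
move: f1; rewrite -{1}(point_fin 1) h // => /point_eq_fin[_].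
rewrite p00 q20 expr1n !mulr1 mul1r add0r addr0 => e1.
have p20 : p2 != 0.
  by have := n 1 0 n10; rewrite p00 q20 !expr0n expr1n /= !mulr0 !add0r !mulr1
    /nz eqxx orbF.
exists (p2 / q0), (p1 / q0), (q1 / q0); split.
- by rewrite mulf_neq0 ?invr_eq0.
(* At [[1 : - D]] the denominator vanishes, so the numerator, a multiple of [A - al * D], does
   not. *)
- have n1D : nz (1 : C R) (- (q1 / q0)) by rewrite /nz oner_eq0.
  have := n _ _ n1D; rewrite p00 q20 /nz.
  have -> : q0 * (- (q1 / q0)) ^+ 2 + q1 * 1 * - (q1 / q0) + 0 * 1 ^+ 2 =
    0 by field.
  rewrite eqxx orbF; apply: contra_neq => h0.
  have -> : 0 * (- (q1 / q0)) ^+ 2 + p1 * 1 * - (q1 / q0) + p2 * 1 ^+ 2 =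
    (p2 / q0 - p1 / q0 * (q1 / q0)) * q0 by field.
  by rewrite h0 mul0r.
- apply: (mulIf q00); rewrite !mulrDl !divfK // mul1r addrC e1; ring.
- move=> X Y nXY; rewrite h // p00 q20.
  rewrite -[RHS](pointZ _ _ q00); congr point; by field.
Qed.

(** The inversion exchanges 0 and infinity and fixes 1; the new coefficient [D / A] is the
    multiplier of [F] at infinity. *)
Lemma std_form_inv F A al D : std_form F A al D ->
  std_form (@inv R \o F \o @inv R) A^-1 (D / A) (al / A).
Proof.
move=> [A0 d0 e h]; split.
- by rewrite invr_eq0.
- have -> : A^-1 - D / A * (al / A) = (A - al * D) / A ^+ 2 by field.
  by rewrite mulf_neq0 // invr_eq0 expf_neq0.
- by apply: (mulIf A0); rewrite !mulrDl mulVf // !divfK // mul1r [al + A]addrC e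
  addrC.
- move=> X Y n /=.
  have n' : nz Y X by rewrite /nz orbC.
  rewrite inv_point // h // inv_point.
    rewrite -[RHS](pointZ _ _ A0); congr point; by field.
  rewrite /nz !mulf_eq0 !negb_or.
  have [Y0|Y0] := eqVneq Y 0 => /=.
    move: n; rewrite /nz Y0 eqxx orbF => X0.
    by rewrite X0 mulr0 add0r X0.
  have [X0|X0] := eqVneq X 0 => /=.
    by rewrite X0 mulr0 addr0 mulf_neq0.
  apply: contraNT d0; rewrite negb_or !negbK => /andP[/eqP h1 /eqP h2].
  apply/eqP; apply: (mulIf Y0); rewrite mul0r.
  have -> : (A - al * D) * Y = A * Y + al * X.
    have -> : X = - (D * Y) by apply/eqP; rewrite -subr_eq0 opprK addrC;
      apply/eqP.
    ring.
  exact: h1.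
Qed.

Lemma std_form_fin F A al D z : std_form F A al D ->
  F (fin z) = point (z * (A * z + al)) (D * z + 1).
Proof.
move=> [_ _ _ h]; rewrite -point_fin h ?mulr1 ?mul1r //.
by rewrite /nz oner_eq0 orbT.
Qed.

End Homogeneous.

(** * Rational maps of degree 1 and 2 as pairs of binary forms *)

Section RationalForms.
Variable R : realType.
Implicit Types (p q : {poly C R}) (F : P1 R -> P1 R).

Lemma ratmap_hom2 p q : maxn (size p) (size q) = 3%N -> forall X Y, nz X Y ->
  ratmap p q (point X Y) = point (p`_0 * Y ^+ 2 + p`_1 * X * Y + p`_2 * X ^+ 2)
     (q`_0 * Y ^+ 2 + q`_1 * X * Y + q`_2 * X ^+ 2).
Proof.
move=> sz X Y n.
have ev (s : {poly C R}) z : (size s <= 3)%N -> s.[z] = s`_0 + s`_1 * z +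
  s`_2 * z ^+ 2.
  move=> hs; rewrite (horner_coef_wide _ hs) !big_ord_recl big_ord0 /=.
  by rewrite /bump /= addr0 expr0 mulr1 expr1 addrA.
have sp : (size p <= 3)%N by rewrite -sz leq_maxl.
have sq : (size q <= 3)%N by rewrite -sz leq_maxr.
have [Y0|Y0] := eqVneq Y 0.
  have X0 : X != 0 by move: n; rewrite /nz Y0 eqxx orbF.
  have -> : point X Y = infty by rewrite /point Y0 eqxx.
  rewrite /ratmap /infty sz /= Y0 expr0n /= !mulr0 !add0r.
  rewrite -/(point p`_2 q`_2) ![_ * X ^+ 2]mulrC pointZ // expf_neq0 //.
have -> : point X Y = fin (X / Y) by rewrite /point (negPf Y0).
rewrite /ratmap /fin -/(point p.[X / Y] q.[X / Y]) !ev //.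
rewrite -[LHS](pointZ _ _ (expf_neq0 2 Y0)); congr point; by field.
Qed.

Lemma ratfrac_hom2_nz p q : ratfrac 2 p q -> forall X Y, nz X Y ->
  nz (p`_0 * Y ^+ 2 + p`_1 * X * Y + p`_2 * X ^+ 2)
     (q`_0 * Y ^+ 2 + q`_1 * X * Y + q`_2 * X ^+ 2).
Proof.
move=> [cop sz] X Y n.
have ev (s : {poly C R}) z : (size s <= 3)%N -> s.[z] = s`_0 + s`_1 * z +
  s`_2 * z ^+ 2.
  move=> hs; rewrite (horner_coef_wide _ hs) !big_ord_recl big_ord0 /=.
  by rewrite /bump /= addr0 expr0 mulr1 expr1 addrA.
have sp : (size p <= 3)%N by rewrite -sz leq_maxl.
have sq : (size q <= 3)%N by rewrite -sz leq_maxr.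
have [Y0|Y0] := eqVneq Y 0.
  have X0 : X != 0 by move: n; rewrite /nz Y0 eqxx orbF.
  rewrite Y0 expr0n /= !mulr0 !add0r /nz.
  move: sz; rewrite /maxn; case: ifP => _ sz.
    have : lead_coef q != 0 by rewrite lead_coef_eq0 -size_poly_eq0 sz.
    by rewrite /lead_coef sz /= => l0; rewrite [X in _ || X]mulf_neq0 ?orbT //
      expf_neq0.
  have : lead_coef p != 0 by rewrite lead_coef_eq0 -size_poly_eq0 sz.
  by rewrite /lead_coef sz /= => l0; rewrite mulf_neq0 // expf_neq0.
apply/negPn/negP => /nz0[h1 h2].
have rt (s : {poly C R}) : (size s <= 3)%N -> s`_0 * Y ^+ 2 + s`_1 * X * Y +
  s`_2 * X ^+ 2 = 0 ->
    s.[X / Y] = 0.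
  move=> hs hh; rewrite ev //; apply: (mulIf (expf_neq0 2 Y0)).
  by rewrite mul0r -[RHS]hh; field.
have rp : root p (X / Y) by apply/eqP; apply: rt.
have := coprimep_root cop rp; rewrite (rt q) ?eqxx //.
Qed.

Lemma rational_map_quadmap F : rational_map 2 F -> quadmap F.
Proof.
move=> [p [q [pq ->]]]; exists p`_0, p`_1, p`_2, q`_0, q`_1, q`_2; split.
  exact: ratfrac_hom2_nz.
by apply: ratmap_hom2; case: pq.
Qed.

Lemma rational_map_mobmap F : rational_map 1 F -> mobmap F.
Proof.
move=> [p [q [[cop sz] ->]]].
have ev (s : {poly C R}) z : (size s <= 2)%N -> s.[z] = s`_1 * z + s`_0.
  move=> hs; rewrite (horner_coef_wide _ hs) !big_ord_recl big_ord0 /=.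
  by rewrite /bump /= addr0 expr0 mulr1 expr1 addrC.
have sp : (size p <= 2)%N by rewrite -sz leq_maxl.
have sq : (size q <= 2)%N by rewrite -sz leq_maxr.
exists p`_1, p`_0, q`_1, q`_0; split; last first.
  move=> X Y n; have [Y0|Y0] := eqVneq Y 0.
    have X0 : X != 0 by move: n; rewrite /nz Y0 eqxx orbF.
    have -> : point X Y = infty by rewrite /point Y0 eqxx.
    rewrite /ratmap /infty sz /= Y0 !mulr0 !addr0.
    by rewrite -/(point p`_1 q`_1) ![_ * X]mulrC pointZ.
  have -> : point X Y = fin (X / Y) by rewrite /point (negPf Y0).
  rewrite /ratmap /fin -/(point p.[X / Y] q.[X / Y]) !ev //.
  rewrite -[LHS](pointZ _ _ Y0); congr point; by field.
(* If the determinant vanished, the root of whichever of [p] and [q] has degree 1 would be a root of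
   both. *)
apply/negP => /eqP d0.
have lead (s : {poly C R}) : size s = 2%N -> s`_1 != 0.
  move=> hs; have : lead_coef s != 0 by rewrite lead_coef_eq0 -size_poly_eq0 hs.
  by rewrite /lead_coef hs.
move: sz; rewrite /maxn; case: ifP => _ sz.
  have q1 := lead q sz.
  have rq : root q (- q`_0 / q`_1) by apply/eqP; rewrite ev //; field.
  rewrite coprimep_sym in cop.
  have /eqP := coprimep_root cop rq; rewrite ev //; apply.
  apply: (mulIf q1); rewrite mul0r.
  have -> : (p`_1 * (- q`_0 / q`_1) + p`_0) * q`_1 =
    - (p`_1 * q`_0 - p`_0 * q`_1) by field.
  by rewrite d0 oppr0.
have p1 := lead p sz.
have rp : root p (- p`_0 / p`_1) by apply/eqP; rewrite ev //; field.
have /eqP := coprimep_root cop rp; rewrite ev //; apply.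
by apply: (mulIf p1); rewrite mul0r -[RHS]d0; field.
Qed.

End RationalForms.

(** * Standard representatives *)

Section StandardRepresentatives.
Variable R : realType.
Implicit Types (c : set (marked R 2)) (m : marked R 2).

(** A finite marked point is a root of [p - X q], and coprimality keeps [q] nonzero there. A marked
    point at infinity lowers the degree of the product, so the coefficient [q_2] vanishes. *)
Lemma fixed_marked_fixed m i : fixed_marked m -> m.1 (m.2 i) = m.2 i.
Proof.
move=> [p [q [k [[cop sz] -> k0 e]]]].
case E: (m.2 i) => [z|].
  have pz : p.[z] = z * q.[z].
    apply/eqP; rewrite -subr_eq0; apply/eqP.
    have -> : p.[z] - z * q.[z] = (p - 'X * q).[z] by rewrite !hornerE.
    by rewrite e (bigD1 i) //= E hornerZ hornerM hornerXsubC subrr mul0r mulr0.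
  have qz : q.[z] != 0.
    apply/eqP => q0; have rq : root q z by apply/eqP.
    rewrite coprimep_sym in cop; have /eqP := coprimep_root cop rq.
    by rewrite pz q0 mulr0.
  by rewrite /ratmap (negPf qz) pz mulfK.
have szp : (size (p - 'X * q)%R <= 3)%N.
  rewrite e; apply: leq_trans (size_scale_leq _ _) _.
  rewrite (bigD1 i) //= E mul1r.
  apply: leq_trans (size_poly_prod_leq _ _) _ => /=.
  have -> : #|[pred j : 'I_3 | j != i]| = 2%N.
    by rewrite cardC1 card_ord.
  rewrite leq_subLR; apply: (@leq_ltn_trans (\sum_(j < 3 | j != i) 2)%N).
    apply: leq_sum => j _; case: (m.2 j) => [z|]; first by rewrite size_XsubC.
    by rewrite size_poly1.
  by rewrite sum_nat_const cardC1 card_ord.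
have sp : (size p <= 3)%N by rewrite -sz leq_maxl.
have q2 : q`_2 = 0.
  have : (p - 'X * q)`_3 = 0 by rewrite nth_default.
  rewrite coefB coefXM /= nth_default // sub0r => /eqP.
  by rewrite oppr_eq0 => /eqP.
by rewrite /ratmap sz /= q2 eqxx.
Qed.

Lemma QB_component c : QB c -> exists m0,
  [/\ fixed_marked m0, rational_map 2 m0.1 & c = moebius_class m0].
Proof.
move=> [m0 hm <-]; exists m0.
by have [h1 [h2 _ _ _]] := connected_component_sub hm.
Qed.

Lemma standard_quad c m : QB c -> standard c m ->
  [/\ quadmap m.1, m.1 (fin 0) = fin 0, m.1 infty = infty & m.1 (fin 1) =
    fin 1].
Proof.
move=> /QB_component[m0 [fm rm ->]] [[phi [psi [r1 k1 k2 [e1 e2]]]] s0 s1 s2].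
have mp := rational_map_mobmap r1.
have fix_ i : m.1 (m.2 i) = m.2 i.
  by rewrite e1 e2 /= k1 fixed_marked_fixed.
split; [|by rewrite -s0 fix_|by rewrite -s1 fix_|by rewrite -s2 fix_].
rewrite e1; apply: quadmap_conj => //; first exact: rational_map_quadmap.
exact: mobmap_inverse k1 k2.
Qed.

(** Two standard representatives differ by a Moebius map that fixes 0, infinity and 1. *)
Lemma standard_unique c m1 m2 : QB c -> standard c m1 -> standard c m2 ->
  m1.1 = m2.1.
Proof.
move=> /QB_component[m0 [fm rm ->]].
move=> [[phi1 [psi1 [r1 k1 l1 [e1 e1']]]] s0 s1 s2].
move=> [[phi2 [psi2 [r2 k2 l2 [e2 e2']]]] t0 t1 t2].
have mp1 := rational_map_mobmap r1.
have mp2 := mobmap_inverse (rational_map_mobmap r2) k2 l2.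
have ms := mobmap_comp mp1 mp2.
have val i : (phi1 \o psi2) (m2.2 i) = m1.2 i by rewrite e1' e2' /= k2.
have sid : forall x, (phi1 \o psi2) x = x.
  by apply: mobmap_fix3 => //; rewrite -?t0 -?t1 -?t2 val ?s0 ?s1 ?s2 ?t0 ?t1
    ?t2.
have p12 : phi1 = phi2.
  by apply/funext => x; rewrite -[LHS]/(phi1 x) -{1}(k2 x)
    -[LHS]/((phi1 \o psi2) (phi2 x)) sid.
have q12 : psi1 = psi2.
  by apply/funext => x; apply: (can_inj k1); rewrite l1 p12 l2.
by rewrite e1 e2 p12 q12.
Qed.

Definition blaschke_form (f : P1 R -> P1 R) (B : C R) :=
  std_form f (lead B) (lead B * B^*) B.

(** Fixing 0 makes one of the two zeros equal to 0; fixing 1 then determines the unimodular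
    constant. *)
Lemma blaschke_standard m : blaschke 2 m.1 -> m.1 (fin 0) = fin 0 ->
  m.1 (fin 1) = fin 1 -> exists2 B : C R, modulus B < 1 & blaschke_form m.1 B.
Proof.
move=> [theta [a [a1 ->]]] f0 f1.
set a0 := a ord0; set b0 := a (fintype.lift ord0 ord0).
have h0 : modulus a0 < 1 by rewrite -normc_lt1 a1.
have h1 : modulus b0 < 1 by rewrite -normc_lt1 a1.
set e : C R := expi _ in f0 f1 *.
have en : e != 0 by exact: expi_neq0.
set p := e *: _ in f0 f1 *; set q := \prod_(i < 2) _ in f0 f1 *.
have pE : p = e *: (('X - a0%:P) * ('X - b0%:P)).
  by rewrite /p !big_ord_recl big_ord0 mulr1.
have qE : q = (1 - a0^* *: 'X) * (1 - b0^* *: 'X).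
  by rewrite /q !big_ord_recl big_ord0 mulr1.
have szp : size p = 3%N.
  rewrite pE size_scale // size_proper_mul ?size_XsubC //.
  by rewrite !lead_coefXsubC mulr1 oner_eq0.
have szl (x : C R) : (size (1 - x *: 'X : {poly C R})%R <= 2)%N.
  apply: leq_trans (size_polyD _ _) _; rewrite size_polyN geq_max size_poly1 /=.
  by apply: leq_trans (size_scale_leq _ _) _; rewrite size_polyX.
have szq : (size q <= 3)%N.
  rewrite qE; apply: leq_trans (size_polyMleq _ _) _.
  by have := leq_add (szl (a0^*)) (szl (b0^*)); case: (_ + _)%N.
have sz : maxn (size p) (size q) = 3%N by rewrite szp; apply/maxn_idPl.
have c2 (u v u' v' : C R) : ((u%:P + v *: 'X) * (u'%:P + v' *: 'X))`_1 =
  u * v' + v * u' /\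
    ((u%:P + v *: 'X) * (u'%:P + v' *: 'X))`_2 = v * v' /\
    ((u%:P + v *: 'X) * (u'%:P + v' *: 'X))`_0 = u * u'.
  have -> : (u%:P + v *: 'X) * (u'%:P + v' *: 'X) =
    (u * u')%:P + (u * v' + v * u') *: 'X + (v * v') *: 'X^2.
    rewrite mulrDl !mulrDr -!mul_polyC -!polyCM !polyCD !polyCM; ring.
  by rewrite !(coefD, coefZ, coefC, coefX, coefXn) /= !(mulr0, mulr1, addr0,
    add0r).
have XE (x : C R) : 'X - x%:P = (- x)%:P + 1 *: 'X by rewrite scale1r polyCN
  addrC.
have LE (x : C R) : 1 - x *: 'X = 1%:P + (- x) *: 'X by rewrite scaleNr.
have p0 : p`_0 = e * (a0 * b0).
  by rewrite pE coefZ !XE (c2 _ _ _ _).2.2; ring.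
have q0 : q`_0 = 1.
  by rewrite qE !LE (c2 _ _ _ _).2.2; ring.
have p1 : p`_1 = - e * (a0 + b0).
  by rewrite pE coefZ !XE (c2 _ _ _ _).1; ring.
have p2 : p`_2 = e.
  by rewrite pE coefZ !XE (c2 _ _ _ _).2.1; ring.
have q1 : q`_1 = - (a0^* + b0^*).
  by rewrite qE !LE (c2 _ _ _ _).1; ring.
have q2 : q`_2 = a0^* * b0^*.
  by rewrite qE !LE (c2 _ _ _ _).2.1; ring.
have hom := ratmap_hom2 sz; rewrite p0 p1 p2 q0 q1 q2 in hom.
have n01 : nz (0 : C R) 1 by rewrite /nz oner_eq0 orbT.
have n11 : nz (1 : C R) 1 by rewrite /nz oner_eq0.
move: f0; rewrite -{1}(point_fin 0) hom // => /point_eq_fin[_].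
rewrite expr1n expr0n /= !mulr0 !mul0r !addr0 !mulr1 => /eqP.
rewrite !mulf_eq0 (negPf en) /= => ab.
pose x := a0 + b0.
have ab0 : a0 * b0 = 0 by apply/eqP; rewrite mulf_eq0.
have abc : a0^* * b0^* = 0 by rewrite -rmorphM /= ab0 rmorph0.
have xlt : modulus x < 1.
  by move: ab => /orP[] /eqP z0; rewrite /x z0 ?add0r ?addr0.
have xc : a0^* + b0^* = x^* by rewrite /x rmorphD.
rewrite ab0 abc mulr0 xc -/x in hom.
(* As [a0 * b0 = 0], the sum [x] is the other zero. *)
exists (- x^*); first by rewrite modulusN modulus_conj.
have B1 : modulus (- x^*) < 1 by rewrite modulusN modulus_conj.
have Bc : (- x^*)^* = - x by rewrite rmorphN /= conjCK.
have dn : den (- x^*) 1 != 0 by apply: den_neq0; rewrite ?modulus1.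
move: f1; rewrite -{1}(point_fin 1) hom // => /point_eq_fin[_].
rewrite !expr1n !mulr1 mul1r add0r => e1.
have le : e = lead (- x^*).
  rewrite /lead; have dc : (den (- x^*) 1)^* != 0 by rewrite conjC_eq0.
  apply: (mulIf dc); rewrite divfK // /den !mulr1 rmorphD rmorph1 /= Bc.
  rewrite addr0 in e1; rewrite -e1; ring.
have mx : modulus (x^* * x) < 1.
  rewrite modulusM modulus_conj; apply: mulr_ilt1; rewrite ?modulus_ge0 //.
split.
- by rewrite -le.
- rewrite Bc -le.
  have -> : e - e * - x * - x^* = e * (1 - x^* * x) by ring.
  rewrite mulf_neq0 // subr_eq0; apply: contraTneq mx => <-.
  by rewrite modulus1 ltxx.
- by rewrite Bc -le; rewrite addr0 in e1; rewrite -[RHS]addrC -e1; ring.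
- move=> X Y n; rewrite hom // Bc -le; congr point; ring.
Qed.

End StandardRepresentatives.

(** * Multipliers *)

Section Multipliers.
Variable R : realType.
Implicit Types (f F phi g : P1 R -> P1 R) (A al D B : C R).

Lemma rdiff_near_eq (f g : R -> C R) (s r : R) (a : C R) : 0 < r ->
  (forall t, `|t - s| < r -> f t = g t) -> rdiff f s a -> rdiff g s a.
Proof.
move=> r0 fg [h1 h2]; split.
  by apply: is_derive_near_eq r0 _ h1 => t /fg ->.
by apply: is_derive_near_eq r0 _ h2 => t /fg ->.
Qed.

Lemma rdiff_unique (f : R -> C R) s a b : rdiff f s a -> rdiff f s b -> a = b.
Proof.
move=> [h1 h2] [k1 k2]; apply: complex_ext.
  exact: derivative_unique h1 k1.
exact: derivative_unique h2 k2.
Qed.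

Lemma rdiff_rc s : rdiff (@rc R) s 1.
Proof. by split; [exact: derI | exact: derC]. Qed.

Lemma rdiff_std (g : R -> C R) A al D (a : C R) : g 0 = 0 -> rdiff g 0 a ->
  rdiff (fun t => g t * (A * g t + al) / (D * g t + 1)) 0 (al * a).
Proof.
move=> g0 hg.
have hn := rdiffM hg (rdiffD (rdiffM (rdiff_cst A 0) hg) (rdiff_cst al 0)).
have hd := rdiffD (rdiffM (rdiff_cst D 0) hg) (rdiff_cst 1 0).
have d0 : D * g 0 + 1 != 0 by rewrite g0 mulr0 add0r oner_eq0.
apply: rdiff_eq (rdiffM hn (rdiff_inv (g := fun t => D * g t + 1) d0 hd)) _ _ =>
  //.
rewrite /= g0; by field.
Qed.

Lemma blaschke_form_disk f B z : modulus B < 1 -> blaschke_form f B ->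
  modulus z < 1 -> f (fin z) = fin (bmap B z) /\ modulus (bmap B z) <=
    modulus z.
Proof.
move=> B1 hf z1; have := den_neq0 B1 (ltW z1) => d0; split; last first.
  by apply: modulus_bmap_le => //; exact: ltW.
rewrite (std_form_fin z hf) /point addrC -/(den B z) (negPf d0).
congr fin; rewrite /bmap; congr (_ / _); ring.
Qed.

Lemma bmap_fixed B z : modulus B < 1 -> modulus z < 1 -> bmap B z = z -> z = 0.
Proof.
move=> B1 z1 e; apply/eqP; apply: contraTT isT => z0.
have d0 := den_neq0 B1 (ltW z1).
have e1 : lead B * (z + B^*) = den B z.
  have : bmap B z * den B z = lead B * z * (z + B^*) by rewrite /bmap divfK.
  rewrite e => h; apply: (mulfI z0); rewrite h; ring.
have e2 : lead B * (1 + B^*) = 1 + B.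
  have c0 : (den B 1)^* != 0 by rewrite conjC_eq0 den_neq0 ?modulus1.
  have <- : (den B 1)^* = 1 + B^* by rewrite /den mulr1 rmorphD rmorph1.
  by rewrite /lead divfK // /den mulr1.
have e3 : (lead B - B) * (z - 1) = 0.
  have -> : (lead B - B) * (z - 1) = lead B * (z + B^*) - lead B * (1 + B^*)
     - B * z + B by ring.
  by rewrite e1 e2 /den; ring.
have l0 : lead B - B != 0.
  rewrite subr_eq0; apply/eqP => h; have := modulus_lead B1.
  by rewrite h => h1; rewrite h1 ltxx in B1.
have zn : z - 1 != 0.
  rewrite subr_eq0; apply/eqP => h; by rewrite h modulus1 ltxx in z1.
by move: e3 => /eqP; rewrite mulf_eq0 (negPf l0) (negPf zn).
Qed.

(** Invariance of the multiplier at 0: the curve [phi (f t)] has derivative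
    [phi'(0) * lead * conj B] at [t = 0] by one side of the conjugacy and [al * phi'(0)] by the
    other, and [phi'(0)] is invertible because [g] inverts [phi]. *)
Lemma multiplier_conj f F phi g B A al D : modulus B < 1 ->
  blaschke_form f B -> std_form F A al D ->
  (forall x, disk x -> g (phi x) = x) ->
  (forall x, disk x -> phi (f x) = F (phi x)) ->
  phi (fin 0) = fin 0 ->
  derivable (fun w : C R => affine (phi (fin w))) 0 1 ->
  derivable (fun w : C R => affine (g (fin w))) 0 1 ->
  al = lead B * B^*.
Proof.
move=> B1 hf hF gK conj p0 dphi dg.
have dfin (w : C R) : modulus w < 1 -> disk (fin w) by rewrite /disk /=
  normc_lt1.
have m0 : modulus (0 : C R) < 1 by rewrite modulus0.
have g0 : g (fin 0) = fin 0 by rewrite -{1}p0 gK //; exact: dfin.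
(* By injectivity [phi] takes the value infinity at one point [w0] at most, and [w0] is not 0;
   inside [|w| < |w0|] the affine coordinate is faithful. *)
have [r [r0 r1] fin_] : exists2 r : R, 0 < r /\ r <= 1 &
    forall w, modulus w < r -> phi (fin w) = fin (affine (phi (fin w))).
  have [h|h] := pselect (exists w, modulus w < 1 /\ phi (fin w) = infty);
    last first.
    exists 1; first by split.
    move=> w w1; case E: (phi (fin w)) => [z|]; first by [].
    by case: h; exists w.
  have [w0 [w1 hw]] := h; exists (modulus w0).
    split; last exact: ltW.
    by rewrite modulus_gt0; apply/eqP => e; move: hw; rewrite e p0.
  move=> w ww; case E: (phi (fin w)) => [z|]; first by [].
  have := gK _ (dfin w (lt_trans ww w1)); rewrite E -[None]hw gK;
    last exact: dfin.
  by move=> [e]; rewrite e ltxx in ww.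
pose Phi (w : C R) := affine (phi (fin w)).
pose G (w : C R) := affine (g (fin w)).
have Phi0 : Phi 0 = 0 by rewrite /Phi p0.
have [cc dP] : exists cc, cdiff Phi 0 cc.
  by exists ('D_1 Phi 0); exact: (cdiffP Phi 0 _).2 (derivableP dphi).
have [cg dG] : exists cg, cdiff G 0 cg.
  by exists ('D_1 G 0); exact: (cdiffP G 0 _).2 (derivableP dg).
have hrc := rdiff_rc 0.
have rc0 : rc 0 = 0 :> C R by [].
have dPt : rdiff (fun t => Phi (rc t)) 0 (cc * 1).
  by apply: (rdiff_cdiff (g := @rc R)) hrc; rewrite rc0.
rewrite mulr1 in dPt.
have dGt : rdiff (fun t => G (Phi (rc t))) 0 (cg * cc).
  by apply: (rdiff_cdiff (g := fun t => Phi (rc t))) dPt; rewrite rc0 Phi0.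
have small t : `|t - 0| < r -> modulus (rc t) < r by rewrite subr0 modulus_rc.
have cc1 : cg * cc = 1.
  apply: rdiff_unique hrc; apply: rdiff_near_eq r0 _ dGt => t /small tr.
  rewrite /G /Phi -fin_ // gK //; apply: dfin; exact: lt_le_trans tr r1.
have cc0 : cc != 0.
  by apply: contra_eq_neq cc1 => ->; rewrite mulr0 eq_sym oner_eq0.
have db : rdiff (fun t => bmap B (rc t)) 0 (lead B * B^* * 1).
  have h := rdiff_std (lead B) (lead B * B^*) B rc0 hrc.
  apply: rdiff_eq h _ _ => // t; rewrite /bmap /den [B * _ + 1]addrC.
  congr (_ / _); ring.
have b0 : bmap B 0 = 0 by rewrite /bmap mulr0 mul0r mul0r.
have d1 : rdiff (fun t => Phi (bmap B (rc t))) 0 (cc * (lead B * B^* * 1)).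
  by apply: (rdiff_cdiff (g := fun t => bmap B (rc t))) db; rewrite rc0 b0.
have d2 := rdiff_std A al D (g := fun t => Phi (rc t)) Phi0 dPt.
have : al * cc = cc * (lead B * B^* * 1).
  apply: rdiff_unique d1; apply: rdiff_near_eq r0 _ d2 => t /small tr.
  have t1 : modulus (rc t) < 1 := lt_le_trans tr r1.
  have [fE _] := blaschke_form_disk B1 hf t1.
  rewrite /Phi -fE conj; last exact: dfin.
  by rewrite (fin_ _ tr) (std_form_fin _ hF) affine_point.
by move=> h; apply: (mulIf cc0); rewrite h; ring.
Qed.

(** The point that [phi] sends to the fixed point 0 of [F] is fixed by [f], and 0 is the only fixed
    point of [f] in the disk. *)
Lemma fixed_in_disk f F phi g B A al D y : modulus B < 1 ->
  blaschke_form f B -> std_form F A al D ->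
  (forall x, disk x -> g (phi x) = x) ->
  (forall x, disk x -> phi (f x) = F (phi x)) ->
  disk y -> phi y = fin 0 -> phi (fin 0) = fin 0.
Proof.
move=> B1 hf hF gK conj; case: y => [z|//]; rewrite -[Some z]/(fin z).
rewrite /disk /= normc_lt1 => z1 pz.
have [fE fz] := blaschke_form_disk B1 hf z1.
have dz : disk (fin z) by rewrite /disk /= normc_lt1.
have dfz : disk (fin (bmap B z)).
  by rewrite /disk /= normc_lt1; apply: le_lt_trans fz z1.
have : phi (fin (bmap B z)) = phi (fin z).
  by rewrite -fE conj // pz (std_form_fin _ hF) mul0r mulr0 add0r point_fin.
move=> /(congr1 g); rewrite !gK // => -[/(bmap_fixed B1 z1) z0].
by move: pz; rewrite z0.
Qed.

Lemma blaschke_form_inv f B : modulus B < 1 -> blaschke_form f B ->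
  blaschke_form (@inv R \o f \o @inv R) (B^*).
Proof.
move=> B1 /std_form_inv.
have d1 : den B 1 != 0 by rewrite den_neq0 ?modulus1.
have c1 : (den B 1)^* != 0 by rewrite conjC_eq0.
have cE : (den B 1)^* = 1 + B^* by rewrite /den mulr1 rmorphD rmorph1.
have dE : den B 1 = 1 + B by rewrite /den mulr1.
have lE : lead (B^*) = (lead B)^-1.
  rewrite /lead invf_div; have -> : den (B^*) 1 = (den B 1)^* by rewrite cE /den
    mulr1.
  by rewrite conjCK.
have l0 := lead_neq0 B1.
rewrite /blaschke_form lE conjCK [B / _]mulrC.
by have -> : lead B * B^* / lead B = B^* by field.
Qed.

Lemma inv0 : inv (fin 0) = infty :> P1 R.
Proof. by rewrite /inv /fin eqxx. Qed.

Lemma inv_disk (x : P1 R) : disk x -> outer_disk (inv x).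
Proof.
case: x => [z|//]; rewrite /disk /= => z1; rewrite /inv;
  case: eqP => // /eqP z0.
by rewrite /outer_disk /fin /= normfV invf_gt1 ?normr_gt0.
Qed.

Lemma inv_outer_disk (x : P1 R) : outer_disk x -> disk (inv x).
Proof.
case: x => [z|]; last by rewrite /disk /= normr0 ltr01.
rewrite /outer_disk /= => z1; have z0 : z != 0.
  by apply: contraTneq z1 => ->; rewrite normr0 ltr10.
by rewrite /inv (negPf z0) /disk /= normfV invf_lt1 // normr_gt0.
Qed.

(** At infinity the argument for 0 is repeated after conjugation by the inversion. [B2 / lead B2] is
    the multiplier of the second Blaschke product at infinity, the conjugate of the one at 0. *)
Lemma mate_multipliers (c1 c2 cF : set (marked R 2)) (m1 m2 mF : marked R 2) B1
  B2 A al D :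
  QB c1 -> QB c2 -> mate c1 c2 cF ->
  standard c1 m1 -> standard c2 m2 -> standard cF mF ->
  modulus B1 < 1 -> modulus B2 < 1 ->
  blaschke_form m1.1 B1 -> blaschke_form m2.1 B2 -> std_form mF.1 A al D ->
  al = lead B1 * B1^* /\ D / A = B2 / lead B2.
Proof.
move=> q1 q2 [qF [f1 [f2 [F [s1 s2 sF [U [V [phi [psi hm]]]]]]]]].
case: hm => -[[_ U0] [_ Voo]] [bU bV] [cj1 cj2] _ _ t1 t2 tF lt1 lt2.
rewrite -(standard_unique q1 s1 t1) -(standard_unique q2 s2 t2).
rewrite -(standard_unique qF sF tF) => bf1 bf2 stF; split.
  case: bU => hol im [g [hg gK pK]].
  have := U0; rewrite -im => -[y dy py].
  have p0 := fixed_in_disk lt1 bf1 stF gK cj1 dy py.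
  have d0 : disk (fin 0 : P1 R) by rewrite /disk /= normr0 ltr01.
  have g0 : g (fin 0) = fin 0 by rewrite -{1}p0 gK.
  apply: (multiplier_conj lt1 bf1 stF gK cj1 p0).
    by have [_] := hol _ d0; rewrite p0.
  by have [_] := hg _ U0; rewrite g0.
case: bV => hol im [g [hg gK pK]].
pose phi' := @inv R \o psi \o @inv R; pose g' := @inv R \o g \o @inv R.
have gK' x : disk x -> g' (phi' x) = x.
  by move=> dx; rewrite /g' /phi' /= invK gK ?invK //; exact: inv_disk.
have cj' x : disk x -> phi' ((@inv R \o f2.1 \o @inv R) x) =
    (@inv R \o F.1 \o @inv R) (phi' x).
  by move=> dx; rewrite /phi' /= !invK cj2 //; exact: inv_disk.
have bf2' := blaschke_form_inv lt2 bf2.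
have stF' := std_form_inv stF.
have lt2' : modulus (B2^*) < 1 by rewrite modulus_conj.
have := Voo; rewrite -im => -[y dy py].
have py' : phi' (inv y) = fin 0 by rewrite /phi' /= invK py.
have p0 := fixed_in_disk lt2' bf2' stF' gK' cj' (inv_outer_disk dy) py'.
have poo : psi infty = infty.
  have : inv (psi (inv (fin 0))) = fin 0 := p0.
  by rewrite inv0 => /(congr1 (@inv R)); rewrite invK inv0.
have doo : outer_disk (infty : P1 R) by [].
have goo : g infty = infty by rewrite -{1}poo gK.
have e := multiplier_conj lt2' bf2' stF' gK' cj' p0.
rewrite e; last 2 first.
- by have [_] := hol _ doo; rewrite poo.
- have [_ h] := hg _ Voo.
  rewrite goo in h.
  exact: h.
have l0 := lead_neq0 lt2.
rewrite conjCK.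
have [_ _ _ _] := bf2'.
have d1 : den B2 1 != 0 by rewrite den_neq0 ?modulus1.
have -> : lead (B2^*) = (lead B2)^-1.
  rewrite /lead invf_div.
  have -> : den (B2^*) 1 = (den B2 1)^* by rewrite /den !mulr1 rmorphD rmorph1.
  by rewrite conjCK.
by rewrite mulrC.
Qed.

End Multipliers.

(** * The family of matings *)

Section MultiplierFamily.
Variable R : realType.
Implicit Types (a b z B : C R).

(* The quadratic map fixing 0, infinity and 1 whose multipliers at 0 and at
   infinity are [a] and [b]. *)
Definition multmap a b z : C R :=
  z * ((1 - a) * z + a * (1 - b)) / (b * (1 - a) * z + (1 - b)).

Lemma rdiff_multmap (a b g : R -> C R) s (a' b' g' : C R) :
  rdiff a s a' -> rdiff b s b' -> rdiff g s g' ->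
  b s * (1 - a s) * g s + (1 - b s) != 0 ->
  rdiff (fun t => multmap (a t) (b t) (g t)) s
   ((g' * ((1 - a s) * g s + a s * (1 - b s)) +
     g s * (- a' * g s + (1 - a s) * g' + a' * (1 - b s) - a s * b') -
     multmap (a s) (b s) (g s) *
     (b' * (1 - a s) * g s - b s * a' * g s + b s * (1 - a s) * g' - b')) /
    (b s * (1 - a s) * g s + (1 - b s))).
Proof.
move=> ha hb hg d0.
have h1a := rdiffD (rdiff_cst 1 s) (rdiffN ha).
have h1b := rdiffD (rdiff_cst 1 s) (rdiffN hb).
have hN := rdiffM hg (rdiffD (rdiffM h1a hg) (rdiffM ha h1b)).
have hD := rdiffD (rdiffM (rdiffM hb h1a) hg) h1b.
apply: rdiff_eq (rdiffM hN (rdiff_inv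
  (g := fun t => b t * (1 - a t) * g t + (1 - b t)) d0 hD)) _ _ => //.
rewrite /multmap; by field.
Qed.

Definition mult B : C R := lead B * B^*.

(** The Blaschke product is recovered from its multiplier at 0, in which all later derivatives in
    [t] are expressed. *)
Lemma mult_facts B : modulus B < 1 ->
  [/\ modulus (mult B) < 1, (mult B)^* = B / lead B, 1 - (mult B)^* != 0,
      lead B = (1 - mult B) / (1 - (mult B)^*) & B = (mult B)^* * lead B].
Proof.
move=> B1; have l0 := lead_neq0 B1.
have d0 : den B 1 != 0 by rewrite den_neq0 ?modulus1.
have c0 : (den B 1)^* != 0 by rewrite conjC_eq0.
have m1 : modulus (mult B) < 1.
  by rewrite /mult modulusM modulus_lead // mul1r modulus_conj.
have mc : (mult B)^* = B / lead B.
  rewrite /mult rmorphM /= conjCK mulrC; congr (_ * _).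
  by rewrite /lead rmorphM fmorphV /= conjCK invf_div.
have n0 (x : C R) : modulus x < 1 -> 1 - x != 0.
  move=> x1; rewrite subr_eq0; apply/eqP => h.
  by rewrite -h modulus1 ltxx in x1.
have n1 : 1 - (mult B)^* != 0 by apply: n0; rewrite modulus_conj.
split => //; last by rewrite mc divfK.
apply: (mulIf n1); rewrite divfK // mc mulrBr mulr1 mulrC divfK //.
rewrite /mult; have -> : lead B = (1 + B) / (1 + B^*).
  by rewrite /lead /den !mulr1 rmorphD rmorph1.
have c1 : 1 + B^* != 0 by move: c0; rewrite /den mulr1 rmorphD rmorph1.
by field.
Qed.

Lemma blaschke_form_multmap (f : P1 R -> P1 R) B z : modulus B < 1 ->
  blaschke_form f B -> modulus z < 1 ->
  affine (f (fin z)) = multmap (mult B) ((mult B)^*) z.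
Proof.
move=> B1 hf z1; have [fE _] := blaschke_form_disk B1 hf z1; rewrite fE /=.
have [_ mc n1 lE BE] := mult_facts B1.
have dn : den B z != 0 by rewrite den_neq0 // ltW.
rewrite /multmap.
have -> : (mult B)^* * (1 - mult B) * z + (1 - (mult B)^*) =
  (1 - (mult B)^*) * den B z.
  have -> : 1 - mult B = lead B * (1 - (mult B)^*) by rewrite lE divfK.
  have -> : (mult B)^* * (lead B * (1 - (mult B)^*)) * z + (1 - (mult B)^*) =
    (1 - (mult B)^*) * (1 + ((mult B)^* * lead B) * z) by ring.
  by rewrite -BE.
have -> : (1 - mult B) * z + mult B * (1 - (mult B)^*) =
   (1 - (mult B)^*) * (lead B * (z + B^*)).
  have -> : 1 - mult B = lead B * (1 - (mult B)^*) by rewrite lE divfK.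
  by rewrite /mult; ring.
by rewrite /bmap; field; rewrite n1 dn.
Qed.

Lemma multmap_den_neq0 B z : modulus B < 1 -> modulus z < 1 ->
  (mult B)^* * (1 - mult B) * z + (1 - (mult B)^*) != 0.
Proof.
move=> B1 z1; have [_ mc n1 lE BE] := mult_facts B1.
have -> : (mult B)^* * (1 - mult B) * z + (1 - (mult B)^*) =
  (1 - (mult B)^*) * den B z.
  have -> : 1 - mult B = lead B * (1 - (mult B)^*) by rewrite lE divfK.
  have -> : (mult B)^* * (lead B * (1 - (mult B)^*)) * z + (1 - (mult B)^*) =
    (1 - (mult B)^*) * (1 + ((mult B)^* * lead B) * z) by ring.
  by rewrite -BE.
by rewrite mulf_neq0 // den_neq0 // ltW.
Qed.

(** The left side is the derivative in [rdiff_multmap] with [a' = 0], the first factor of the mating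
    being constant. The derivative in the multiplier at infinity is the forcing, whence
    [K = b' * lead ^ 2]; the derivative in [z] is [dbmap]. *)
Lemma multmap_variation B z (b' g' : C R) : modulus B < 1 -> modulus z < 1 ->
  (g' * ((1 - mult B) * z + mult B * (1 - (mult B)^*)) +
     z * (- 0 * z + (1 - mult B) * g' + 0 * (1 - (mult B)^*) - mult B * b') -
     multmap (mult B) ((mult B)^*) z *
     (b' * (1 - mult B) * z - (mult B)^* * 0 * z + (mult B)^* * (1 - mult B)
       * g' - b')) /
    ((mult B)^* * (1 - mult B) * z + (1 - (mult B)^*)) =
  forcing B (b' * (lead B) ^+ 2) z + dbmap B z * g'.
Proof.
move=> B1 z1; have [_ mc n1 lE BE] := mult_facts B1.
have dn : den B z != 0 by rewrite den_neq0 // ltW.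
have dn1 : den B 1 != 0 by rewrite den_neq0 ?modulus1.
have c0 : (den B 1)^* != 0 by rewrite conjC_eq0.
have c1 : 1 + B^* != 0 by move: c0; rewrite /den mulr1 rmorphD rmorph1.
have b1 : 1 + B != 0 by move: dn1; rewrite /den mulr1.
have lB : lead B = (1 + B) / (1 + B^*).
  by rewrite /lead /den !mulr1 rmorphD rmorph1.
have l0 := lead_neq0 B1.
have n2 : 1 - B * B^* != 0.
  rewrite mul_conj -(rcB 1) rc_eq0 subr_eq0 gt_eqF //.
  by rewrite expr_lt1 ?modulus_ge0.
have mE : mult B = B^* * (1 + B) / (1 + B^*) by rewrite /mult lB; field.
have mcE : (mult B)^* = B * (1 + B^*) / (1 + B) by rewrite mc lB invf_div; ring.
rewrite /multmap mcE mE /forcing /dbmap lB; move: dn; rewrite /den => dn.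
field; rewrite ?c1 ?b1 ?dn ?n2 //=.
have -> : B * (1 + B^* - B^* * (1 + B)) * z + (1 + B - B * (1 + B^*)) =
  (1 - B * B^*) * (1 + B * z) by ring.
by rewrite mulf_neq0.
Qed.

Lemma smooth_rdiff (g : R -> C R) : smooth param g -> exists d, rdiff g 0 d.
Proof.
move=> sg; have p0 : param (0 : R) by rewrite /param /= in_itv /= oppr_lt0
  !ltr01.
have [[_ h1] [_ h2]] := sg 1%N.
have [d1 _] := h1 (1 : R); have [d2 _] := h2 (1 : R).
exists (Complex ('D_1 (fun t => complex.Re (g t)) 0)
  ('D_1 (fun t => complex.Im (g t)) 0)).
by split; apply: derivableP; [exact: d1 | exact: d2].
Qed.

(** The derivative at 0 is computed from both presentations. It turns smooth coefficients, known
    only up to a common factor, into a differentiable multiplier. *)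
Lemma std_form_multiplier (p q : {poly C R}) A al D : ratfrac 2 p q ->
  std_form (ratmap p q) A al D -> q`_0 != 0 /\ al = p`_1 / q`_0.
Proof.
move=> [_ sz] hf; have hom := ratmap_hom2 sz.
have n01 : nz (0 : C R) 1 by rewrite /nz oner_eq0 orbT.
have := std_form_fin 0 hf; rewrite mul0r mulr0 add0r point_fin.
rewrite -{1}(point_fin 0) hom // => /point_eq_fin[].
rewrite expr1n expr0n /= !mulr0 !mul0r !addr0 !mulr1 => q00 p00; split => //.
have rc0 : rc 0 = 0 :> C R by [].
have hr := rdiff_rc (R := R) 0.
have h1 := rdiff_std A al D rc0 hr.
have hn := rdiffD (rdiffM (rdiff_cst p`_1 0) hr)
  (rdiffM (rdiff_cst p`_2 0) (rdiffM hr hr)).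
have hd := rdiffD (rdiffD (rdiff_cst q`_0 0) (rdiffM (rdiff_cst q`_1 0) hr))
  (rdiffM (rdiff_cst q`_2 0) (rdiffM hr hr)).
have d0 : q`_0 + q`_1 * rc 0 + q`_2 * (rc 0 * rc 0) != 0.
  by rewrite rc0 !mulr0 !addr0.
have h2 := rdiffM hn (rdiff_inv
  (g := fun t => q`_0 + q`_1 * rc t + q`_2 * (rc t * rc t)) d0 hd).
have : al * 1 = p`_1 / q`_0.
  apply: rdiff_unique h1 _; apply: rdiff_eq h2 _ _ => [t|]; last first.
    by rewrite /= rc0; field.
  rewrite -affine_point; have n1 : nz (rc t) 1 by rewrite /nz oner_eq0 orbT.
  have := std_form_fin (rc t) hf; rewrite -{1}(point_fin (rc t)) hom // p00.
  rewrite expr1n !mulr1 add0r !expr2 => ->.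
  by rewrite affine_point.
by rewrite mulr1.
Qed.

End MultiplierFamily.

Theorem theorem2 (R : realType) (c : set (marked R 2)) (v : C R -> C R) :
  B c -> tangent c v -> nonzero v ->
  forall N : R, WP_seminorm c v N -> N <> 0%R.
Proof.
move=> _ _ [z0 [z0lt vz0]] N
  [_ [cc [f [F [H [[[hpath [p [q [hpq sp sq]]]] c0 hv]
  hmate [hsm hconf] [hconj hH0] hlim]]]]]] N0.
rewrite {}N0 expr0n /= in hlim.
have p0 : param (0 : R) by rewrite /param /= in_itv /= oppr_lt0 !ltr01.
have paramP (t : R) : `|t| < 1 -> param t by rewrite /param /= in_itv /=
  -ltr_norml.
have blaschke_t t : param t -> exists2 Bt : C R, modulus Bt < 1 &
    blaschke_form (f t).1 Bt /\ mult Bt = (p t)`_1 / (q t)`_0 /\ (q t)`_0 != 0.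
  move=> pt; have [[qc _] st bl] := hpath t pt.
  have [_ e0 _ e1] := standard_quad qc st.
  have [Bt Bt1 bt] := blaschke_standard bl e0 e1.
  exists Bt => //; split => //.
  have [rf fE] := hpq t pt; rewrite fE in bt.
  by have [? ?] := std_form_multiplier rf bt.
pose alpha t := (p t)`_1 / (q t)`_0.
have [B0 B01 [bf0 [m0 q00]]] := blaschke_t 0 p0.
have [da hda] : exists da, rdiff alpha 0 da.
  have [d1 h1] := smooth_rdiff (sp 1%N); have [d2 h2] := smooth_rdiff (sq 0%N).
  eexists; exact: (rdiffM h1 (rdiff_inv (g := fun t => (q t)`_0) q00 h2)).
have hdb := rdiff_conj hda.
have alpha0 : alpha 0 = mult B0 by rewrite m0.
(* The fixed points 0, 1, infinity and the multipliers at 0 and infinity determine the mating. *)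
have F_fam t z : param t -> affine ((F t).1 (fin z)) =
  multmap (mult B0) ((alpha t)^*) z.
  move=> pt; have [cF hm sF] := hmate t pt.
  have [[q0 _] s0 _] := hpath 0 p0; have [[qt _] st _] := hpath t pt.
  have [Bt Bt1 [bft [mt _]]] := blaschke_t t pt.
  have [qF _] := hm.
  have [quadF e0 eoo e1] := standard_quad qF sF.
  have [A [al [D hstd]]] := quadmap_std quadF e0 eoo e1.
  have [h1 h2] := mate_multipliers q0 qt hm s0 st sF B01 Bt1 bf0 bft hstd.
  have [A0 _ hA _] := hstd.
  rewrite (std_form_fin z hstd) affine_point.
  have [_ mc n1 _ _] := mult_facts Bt1.
  rewrite /alpha -mt; rewrite -mc in h2.
  have DE : D = (mult Bt)^* * A by rewrite -h2 divfK.
  rewrite -/(mult B0) in h1.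
  have AE : 1 - mult B0 = A * (1 - (mult Bt)^*).
    have -> : A * (1 - (mult Bt)^*) = A - D by rewrite DE; ring.
    have -> : A = D + 1 - al by rewrite -hA addrK.
    by rewrite -h1; ring.
  rewrite /multmap AE h1 DE.
  have -> : z * (A * (1 - (mult Bt)^*) * z + mult B0 * (1 - (mult Bt)^*)) =
    (1 - (mult Bt)^*) * (z * (A * z + mult B0)) by ring.
  have -> : (mult Bt)^* * (A * (1 - (mult Bt)^*)) * z + (1 - (mult Bt)^*) =
    (1 - (mult Bt)^*) * ((mult Bt)^* * A * z + 1) by ring.
  by rewrite -!affine_point pointZ.
(* At [t = 0] both multipliers are those of [f_0], so the mating is [f_0] itself. *)
have F0 z : modulus z < 1 -> (F 0).1 (fin z) = fin (bmap B0 z).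
  move=> z1; have [cF hm sF] := hmate 0 p0.
  have [[q0 _] s0 _] := hpath 0 p0.
  have [qF _] := hm.
  have [quadF e0 eoo e1] := standard_quad qF sF.
  have [A [al [D hstd]]] := quadmap_std quadF e0 eoo e1.
  have [h1 h2] := mate_multipliers q0 q0 hm s0 s0 sF B01 B01 bf0 bf0 hstd.
  have [A0 _ hA _] := hstd.
  have [_ mc n1 lE BE] := mult_facts B01.
  rewrite -mc in h2; rewrite -/(mult B0) in h1.
  have DE : D = (mult B0)^* * A by rewrite -h2 divfK.
  have e : A * (1 - (mult B0)^*) = A - D by rewrite DE; ring.
  have AE : A = lead B0.
    rewrite lE; apply: (mulIf n1); rewrite divfK // e.
    have -> : A = D + 1 - al by rewrite -hA addrK.
    by rewrite h1; ring.
  have bF : blaschke_form (F 0).1 B0.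
    by move: hstd; rewrite DE AE h1 -BE.
  by have [] := blaschke_form_disk B01 bF z1.
(* Each [f_t] is [multmap] of its multiplier and the conjugate; a stationary multiplier would make
   [f_t z0] stationary, against [v z0 != 0]. *)
have da0 : da != 0.
  apply: contraNneq vz0 => e; have z1 : modulus z0 < 1 by rewrite -normc_lt1.
  rewrite hv // (ddt0E (a := 0)) //.
  have d0 := multmap_den_neq0 B01 z1; rewrite -alpha0 in d0.
  have h := rdiff_multmap hda hdb (rdiff_cst z0 0) d0.
  apply: (@rdiff_near_eq R (fun t => multmap (alpha t) ((alpha t)^*) z0) _ 0
    1) => //.
    move=> t; rewrite subr0 => /paramP pt.
    have [Bt Bt1 [bft [mt _]]] := blaschke_t t pt.
    by rewrite (blaschke_form_multmap Bt1 bft z1) mt.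
  apply: rdiff_eq h _ _ => //.
  by rewrite e rmorph0 !(mul0r, mulr0, oppr0, add0r, addr0, subr0).
pose eta := variation H.
pose K := da^* * lead B0 ^+ 2.
have K0 : K != 0 by rewrite mulf_neq0 ?conjC_eq0 // expf_neq0 // lead_neq0.
(* Both sides are the derivative at [t = 0] of the curve [H_t (F_0 z) = F_t (H_t z)]. *)
have eta_eq z : modulus z < 1 ->
    eta (bmap B0 z) = forcing B0 K z + dbmap B0 z * eta z.
  move=> z1; have bz1 : modulus (bmap B0 z) < 1.
    by exact: le_lt_trans (modulus_bmap_le B01 (ltW z1)) z1.
  have hl := rdiff_family hsm hH0 bz1.
  have hr := rdiff_family hsm hH0 z1.
  have [r r0 hfin] := family_finite hsm hH0 z1.
  have dz : disk (fin z) by rewrite /disk /= normc_lt1.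
  pose g t := affine (H t (fin z)).
  have g0 : g 0 = z by rewrite /g hH0.
  have d0 := multmap_den_neq0 B01 z1; rewrite -{1 3}alpha0 -{1}g0 in d0.
  have hR := rdiff_multmap (rdiff_cst (mult B0) 0) hdb hr d0.
  rewrite -/(g 0) g0 alpha0 multmap_variation // in hR.
  apply: rdiff_unique hl _.
  (* The curves are compared only for [t] so small that [H_t z] is finite, since [affine] gives
     infinity a default value. *)
  apply: (@rdiff_near_eq R _ _ 0 (Num.min 1 r) _ _ _ hR).
    by rewrite lt_min ltr01.
  move=> t; rewrite subr0 lt_min => /andP[/paramP pt tr].
  rewrite -F0 // hconj //; have := hfin t tr.
  rewrite -/(g t); case E: (H t (fin z)) => [w|//] _.
  by rewrite -[Some w]/(fin w) (F_fam t w pt) /g E.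
apply: (WP_mean_not_cvg0 B01 K0 _ _ eta_eq hlim).
- exact: variation_diff.
- exact: dvariation_cont.
Qed.
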